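(* Let $\kappa>0$, $\Lambda>0$, $R>\sqrt{3/\Lambda}$ and $h_0\in\mathcal{C}^k([0,R])$ with $k\geq 1$. There exists $\delta>0$ (depending on $\Lambda,R$) such that if $\|h_0\|_{X_R}:=\sup_{[0,R]}|h_0|+\sup_{[0,R]}|h_0'|<\delta$, then for some $U=U(\|h_0\|_{X_R};R,\Lambda)>0$ the initial value problem $$Dh=G\,(h-\bar h),\qquad h(0,r)=h_0(r),$$ has a unique solution $h\in\mathcal{C}^k([0,U]\times[0,R])$. Moreover $$\sup_{[0,U]\times[0,R]}|h|=\sup_{[0,R]}|h_0|$$ and $$\sup_{[0,U]\times[0,R]}|h|+\sup_{[0,U]\times[0,R]}|\partial_r h|\leq (1+C^* )\,\|h_0\|_{X_R},$$ where the constant $C^*>0$ does not depend on $U$.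
   Context: For a function $h(u,r)$ on $[0,U]\times[0,R]$, define its radial average $\bar h(u,r):=\frac1r\int_0^r h(u,s)\,ds$, and the associated functions $$f(u,r)=\exp\!\left(\frac{\kappa}{2}\int_0^r\frac{(h-\bar h)^2(u,s)}{s}\,ds\right),\qquad \tilde f(u,r)=\bar f(u,r)-\frac{\Lambda}{r}\int_0^r f(u,s)\,s^2\,ds,$$ where $\bar f$ is the radial average of $f$. Then set $D=\partial_u-\frac{\tilde f}{2}\partial_r$ and $G=\frac{1}{2r}\left[(f-\tilde f)-\Lambda f r^2\right]$. (This integro-differential equation encodes the Bondi-spherically symmetric Einstein-$\Lambda$-scalar field system $R_{\mu\nu}=\kappa\partial_\mu\phi\partial_\nu\phi+\Lambda\mathbf{g}_{\mu\nu}$ with metric $-f\tilde f du^2-2f du dr+r^2\sigma_{\mathbb{S}^2}$, via $h=\partial_r(r\phi)$, $\phi=\bar h$, gauge $f(u,0)=1$.) *)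

(* Defs.v *)
From Stdlib Require Import Reals Lra ClassicalEpsilon.
Open Scope R_scope.

(* Total Riemann integral: the Riemann integral of f over [a,b] when it
   exists (value independent of the integrability proof), and 0 otherwise. *)
Definition RInt (f : R -> R) (a b : R) : R :=
  match excluded_middle_informative
          (exists I, exists pr : Riemann_integrable f a b, RiemannInt pr = I) with
  | left H => proj1_sig (constructive_indefinite_description _ H)
  | right _ => 0
  end.

(* radial average  \bar g (r) = (1/r) \int_0^r g(s) ds  (used only for r > 0,
   or as an integrand value at a single point, which is irrelevant). *)
Definition bar (g : R -> R) (r : R) : R := / r * RInt g 0 r.

Definition hbar (h : R -> R -> R) (u r : R) : R := bar (h u) r.

Definition f_of (kappa : R) (h : R -> R -> R) (u r : R) : R :=
  exp (kappa / 2 * RInt (fun s => (h u s - hbar h u s) ^ 2 / s) 0 r).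

Definition ftilde_of (kappa Lambda : R) (h : R -> R -> R) (u r : R) : R :=
  bar (f_of kappa h u) r - Lambda / r * RInt (fun s => f_of kappa h u s * s ^ 2) 0 r.

Definition G_of (kappa Lambda : R) (h : R -> R -> R) (u r : R) : R :=
  / (2 * r) * ((f_of kappa h u r - ftilde_of kappa Lambda h u r)
               - Lambda * f_of kappa h u r * r ^ 2).

Definition deriv_within (a b : R) (g : R -> R) (x l : R) : Prop :=
  forall eps, 0 < eps -> exists d, 0 < d /\
    forall y, a <= y <= b -> y <> x -> Rabs (y - x) < d ->
      Rabs ((g y - g x) / (y - x) - l) < eps.

Fixpoint Ck1 (k : nat) (g : R -> R) : Prop :=
  match k with
  | O => continuity g
  | S k' => exists g', (forall x, derivable_pt_lim g x (g' x)) /\ Ck1 k' g'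
  end.

Definition Ck_interval (k : nat) (a b : R) (g : R -> R) : Prop :=
  exists G, Ck1 k G /\ forall x, a <= x <= b -> G x = g x.

Definition continuous2 (h : R -> R -> R) : Prop :=
  forall u r eps, 0 < eps -> exists d, 0 < d /\
    forall u' r', Rabs (u' - u) < d -> Rabs (r' - r) < d ->
      Rabs (h u' r' - h u r) < eps.

Fixpoint Ck2 (k : nat) (h : R -> R -> R) : Prop :=
  match k with
  | O => continuous2 h
  | S k' => continuous2 h /\ exists hu hr,
      (forall u r, derivable_pt_lim (fun x => h x r) u (hu u r)) /\
      (forall u r, derivable_pt_lim (fun y => h u y) r (hr u r)) /\
      Ck2 k' hu /\ Ck2 k' hr
  end.

Definition Ck_rect (k : nat) (U Rr : R) (h : R -> R -> R) : Prop :=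
  exists H, Ck2 k H /\ forall u r, 0 <= u <= U -> 0 <= r <= Rr -> H u r = h u r.

Definition partial_u_rect (U Rr : R) (h hu : R -> R -> R) : Prop :=
  forall u r, 0 <= u <= U -> 0 <= r <= Rr -> deriv_within 0 U (fun x => h x r) u (hu u r).
Definition partial_r_rect (U Rr : R) (h hr : R -> R -> R) : Prop :=
  forall u r, 0 <= u <= U -> 0 <= r <= Rr -> deriv_within 0 Rr (fun y => h u y) r (hr u r).

(* h solves  D h = G (h - hbar),  h(0,.) = h0  on [0,U] x [0,R];
   the equation is imposed for 0 < r <= R (at r = 0 it holds by continuity). *)
Definition solves_IVP (kappa Lambda U Rr : R) (h0 : R -> R) (h : R -> R -> R) : Prop :=
  (forall r, 0 <= r <= Rr -> h 0 r = h0 r) /\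
  exists hu hr, partial_u_rect U Rr h hu /\ partial_r_rect U Rr h hr /\
    forall u r, 0 <= u <= U -> 0 < r <= Rr ->
      hu u r - ftilde_of kappa Lambda h u r / 2 * hr u r
      = G_of kappa Lambda h u r * (h u r - hbar h u r).

Definition sup_abs_interval (a b : R) (g : R -> R) (s : R) : Prop :=
  is_lub (fun y => exists x, a <= x <= b /\ y = Rabs (g x)) s.

Definition sup_abs_rect (U Rr : R) (h : R -> R -> R) (s : R) : Prop :=
  is_lub (fun y => exists u r, 0 <= u <= U /\ 0 <= r <= Rr /\ y = Rabs (h u r)) s.

(* Main.v *)
(** With F = f (1 - Lam r^2) one has ftilde = avg F and G = (F - avg F)/(2r) = (ftilde/2)', so the problem is a
    transport equation h_u = A h_r + B whose coefficients A and B depend on the slice h(u, .) through radial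
    averages and lose no derivative. After cutting off in r, and in u by a factor theta(u), everything lives on
    the plane; the characteristics X, the values k of h along them and the inverse Y of X form the fixed point
    of a map that contracts the sup norm on a ball of Lipschitz functions, with constants depending only on
    kappa, Lambda and R. Taylor estimates of second order along characteristics show that h is C^1, and higher
    regularity follows first in r (G and W are as regular as h) and then in u from the equation.
    Since R > sqrt (3/Lam), A is positive at r = 0 and negative at r = R, so characteristics leave [0, R] through
    both ends and a maximum principle holds without boundary data: applied to the square of a difference
    of solutions it gives uniqueness, and applied to h^2, with G <= 0 for small data, the sup bound. *)
Require Import Defs.
From Stdlib Require Import Reals Lra Lia Psatz Classical ClassicalEpsilon FunctionalExtensionality.
From Coquelicot Require Import Coquelicot.
Open Scope R_scope.

(** * Calculus *)

(** Contracting in the sup norm while Lipschitz bounds are kept as invariants is what a quasilinear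
    equation allows: two speeds A differ by a multiple of the distance of the slices, and this error
    meets h only through its Lipschitz constant. The invariants are inequalities between finitely
    many values and survive pointwise limits, so no function space is set up. With the inverse [Y]
    as an unknown, h = k(Y) is explicit and no inverse function theorem is involved.

    The obstacle is r = 0. For a slice that is only Lipschitz, q = (h - hbar)/r may be discontinuous
    there, and so may G'. The estimates use q through its bound and through the Lipschitz function r
    q = h - hbar: B equals r G q, and in [Wv] the factor Phi/2 - 3 G is O(r).

    The constant C of the slice bounds fixes the support sig = 1/(12 C) of theta, so the lifespan
    sig/2 is the same for all admissible data. Smallness serves two purposes: slices stay in the
    ball where C is valid, and G <= 0. *)

Ltac triangle := apply Rle_trans with (1 := Rabs_triang _ _).

Definition cont {T : UniformSpace} (f : T -> R) : Prop := forall x : T, continuous f x.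

Lemma cont_const {T : UniformSpace} (c : R) : cont (fun _ : T => c).
Proof. intros x; apply continuous_const. Qed.

Lemma cont_plus {T : UniformSpace} (f g : T -> R) :
  cont f -> cont g -> cont (fun x => f x + g x).
Proof. intros Hf Hg x; exact (continuous_plus f g x (Hf x) (Hg x)). Qed.

Lemma cont_opp {T : UniformSpace} (f : T -> R) : cont f -> cont (fun x => - f x).
Proof. intros Hf x; exact (continuous_opp f x (Hf x)). Qed.

Lemma cont_minus {T : UniformSpace} (f g : T -> R) :
  cont f -> cont g -> cont (fun x => f x - g x).
Proof. intros Hf Hg; apply cont_plus; [|apply cont_opp]; auto. Qed.

Lemma cont_mult {T : UniformSpace} (f g : T -> R) :
  cont f -> cont g -> cont (fun x => f x * g x).
Proof. intros Hf Hg x; exact (continuous_mult f g x (Hf x) (Hg x)). Qed.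

Lemma cont_comp {T S : UniformSpace} (f : T -> S) (g : S -> R) :
  (forall x, continuous f x) -> cont g -> cont (fun x => g (f x)).
Proof. intros Hf Hg x; apply continuous_comp; auto. Qed.

Lemma cont_exp {T : UniformSpace} (f : T -> R) : cont f -> cont (fun x => exp (f x)).
Proof. intros Hf; apply (cont_comp f exp); auto. intros x; apply continuous_exp. Qed.

Lemma cont_inv {T : UniformSpace} (f : T -> R) :
  cont f -> (forall x, f x <> 0) -> cont (fun x => / f x).
Proof.
  intros Hf H0 x. apply (continuous_comp f Rinv); auto.
  apply (@continuous_Rinv); auto.
Qed.

Lemma cont_div {T : UniformSpace} (f g : T -> R) :
  cont f -> cont g -> (forall x, g x <> 0) -> cont (fun x => f x / g x).
Proof. intros; apply cont_mult; auto. apply cont_inv; auto. Qed.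

Lemma cont_pow {T : UniformSpace} (f : T -> R) (n : nat) :
  cont f -> cont (fun x => f x ^ n).
Proof.
  intros Hf; induction n as [|n IH]; simpl; [apply cont_const|apply cont_mult; auto].
Qed.

Lemma cont_id : cont (fun x : R => x).
Proof. intros x; apply continuous_id. Qed.

Lemma cont_ext {T : UniformSpace} (f g : T -> R) :
  (forall x, f x = g x) -> cont f -> cont g.
Proof. intros E Hf x; apply (continuous_ext f); auto. Qed.

Lemma cont_eps {T : UniformSpace} (f : T -> R) :
  cont f <-> forall x eps, 0 < eps -> locally x (fun y => Rabs (f y - f x) < eps).
Proof.
  split.
  - intros Hf x eps He. specialize (Hf x).
    exact (Hf _ (locally_ball (f x) (mkposreal eps He))).
  - intros H x P [e He]. destruct (H x e (cond_pos e)) as [d Hd].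
    exists d; intros y Hy; apply He; exact (Hd y Hy).
Qed.

Lemma cont_Lip (f : R -> R) (K : R) :
  (forall x y, Rabs (f x - f y) <= K * Rabs (x - y)) -> cont f.
Proof.
  intros H; apply cont_eps; intros x eps He.
  assert (Hk : 0 < Rabs K + 1) by (generalize (Rabs_pos K); lra).
  assert (He' : 0 < eps / (Rabs K + 1)) by (apply Rdiv_lt_0_compat; lra).
  exists (mkposreal _ He'); intros y Hy.
  change (Rabs (y - x) < eps / (Rabs K + 1)) in Hy.
  apply Rle_lt_trans with (1 := H y x).
  apply Rle_lt_trans with ((Rabs K + 1) * Rabs (y - x)).
  - apply Rmult_le_compat_r; [apply Rabs_pos|]. generalize (Rle_abs K); lra.
  - apply Rmult_lt_compat_l with (r := Rabs K + 1) in Hy; [|lra].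
    replace ((Rabs K + 1) * (eps / (Rabs K + 1))) with eps in Hy by (field; lra). lra.
Qed.

Lemma cont_derive (f df : R -> R) : (forall x, is_derive f x (df x)) -> cont f.
Proof. intros H x; apply (ex_derive_continuous f); exists (df x); apply H. Qed.

Lemma ex_RInt_cont (f : R -> R) (a b : R) : cont f -> ex_RInt f a b.
Proof. intros Hf; apply (ex_RInt_continuous f); auto. Qed.

Lemma is_derive_prim (f : R -> R) (a x : R) :
  cont f -> is_derive (fun y => RInt f a y) x (f x).
Proof.
  intros Hf; apply (is_derive_RInt f (fun y => RInt f a y) a); [|apply Hf].
  apply filter_forall; intros y; apply (RInt_correct f), ex_RInt_cont, Hf.
Qed.

Lemma RInt_FTC (f df : R -> R) (a b : R) :
  (forall x, is_derive f x (df x)) -> cont df -> RInt df a b = f b - f a.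
Proof.
  intros H1 H2; apply is_RInt_unique.
  apply (is_RInt_derive f df); auto.
Qed.

Lemma RInt_sub (f g : R -> R) (a b : R) :
  cont f -> cont g -> RInt f a b - RInt g a b = RInt (fun x => f x - g x) a b.
Proof.
  intros Hf Hg. symmetry.
  apply (RInt_minus f g a b); apply ex_RInt_cont; auto.
Qed.

Lemma RInt_add (f g : R -> R) (a b : R) :
  cont f -> cont g -> RInt f a b + RInt g a b = RInt (fun x => f x + g x) a b.
Proof.
  intros Hf Hg. symmetry.
  apply (RInt_plus f g a b); apply ex_RInt_cont; auto.
Qed.

Lemma RInt_cmul (f : R -> R) (a b c : R) :
  cont f -> RInt (fun x => c * f x) a b = c * RInt f a b.
Proof. intros Hf. apply (RInt_scal f a b c); apply ex_RInt_cont; auto. Qed.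

Lemma RInt_chasles (f : R -> R) (a b c : R) :
  cont f -> RInt f a b + RInt f b c = RInt f a c.
Proof. intros Hf; apply (RInt_Chasles f); apply ex_RInt_cont; auto. Qed.

Lemma RInt_abs_le (f : R -> R) (a b M : R) :
  cont f -> (forall x, Rmin a b <= x <= Rmax a b -> Rabs (f x) <= M) ->
  Rabs (RInt f a b) <= M * Rabs (b - a).
Proof.
  intros Hf HM.
  destruct (Rle_dec a b) as [Hab|Hab].
  - rewrite (Rabs_pos_eq (b - a)) by lra. rewrite Rmult_comm.
    rewrite Rmin_left, Rmax_right in HM by lra.
    apply abs_RInt_le_const; auto; apply ex_RInt_cont; auto.
  - rewrite Rmin_right, Rmax_left in HM by lra.
    rewrite <- (opp_RInt_swap f) by (apply ex_RInt_cont; auto).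
    change (opp (RInt f b a)) with (- RInt f b a).
    rewrite Rabs_Ropp, (Rabs_left (b - a)) by lra. rewrite Rmult_comm.
    replace (- (b - a)) with (a - b) by ring.
    apply abs_RInt_le_const; [lra|apply ex_RInt_cont; auto|auto].
Qed.

(** Compactness of [a, b]: joint continuity gives a radius at each t, and a finite cover turns these
    into one neighbourhood of [p0] valid for all t. *)
Lemma tube {T : UniformSpace} (F : T * R -> R) (a b : R) (p0 : T) (eps : R) :
  cont F -> 0 < eps ->
  locally p0 (fun p => forall t, a <= t <= b -> Rabs (F (p, t) - F (p0, t)) < eps).
Proof.
  intros HF He.
  assert (H : forall t : R, exists d : posreal, forall p t', ball p0 d p -> Rabs (t' - t) < d ->
              Rabs (F (p, t') - F (p0, t)) < eps / 2).
  { intros t. assert (He2 : 0 < eps / 2) by lra.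
    destruct (proj1 (cont_eps F) HF (p0, t) (eps / 2) He2) as [d Hd].
    exists d; intros p t' Hp Ht. apply (Hd (p, t')). split; [exact Hp|exact Ht]. }
  apply choice in H; destruct H as [delta Hdelta].
  destruct (compactness_value_1d a b delta) as [d Hd].
  exists d; intros p Hp t Ht.
  specialize (Hd t Ht); apply NNPP in Hd; destruct Hd as (s & Hs & Hts & Hds).
  assert (H1 := Hdelta s p t (ball_le _ _ _ Hds _ Hp) Hts).
  assert (H2 := Hdelta s p0 t (ball_center p0 (delta s)) Hts).
  replace (F (p, t) - F (p0, t)) with ((F (p, t) - F (p0, s)) - (F (p0, t) - F (p0, s))) by ring.
  apply Rle_lt_trans with (1 := Rabs_triang _ _). rewrite Rabs_Ropp. lra.
Qed.

Lemma cont_slice {T : UniformSpace} (F : T * R -> R) (p : T) : cont F -> cont (fun t => F (p, t)).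
Proof.
  intros HF; apply cont_eps; intros t eps He.
  destruct (proj1 (cont_eps F) HF (p, t) eps He) as [d Hd].
  exists d; intros t' Ht; apply (Hd (p, t')). split; [apply ball_center|exact Ht].
Qed.

Lemma cont_RInt_param {T : UniformSpace} (F : T * R -> R) (a b : R) :
  cont F -> cont (fun p => RInt (fun t => F (p, t)) a b).
Proof.
  intros HF; apply cont_eps; intros p0 eps He.
  set (e := eps / (Rabs (b - a) + 1)).
  assert (Hb := Rabs_pos (b - a)).
  assert (He' : 0 < e) by (apply Rdiv_lt_0_compat; lra).
  generalize (tube F (Rmin a b) (Rmax a b) p0 e HF He'); apply filter_imp.
  intros p Hp.
  rewrite RInt_sub by (apply (cont_slice F); auto).
  apply Rle_lt_trans with (e * Rabs (b - a)).
  - apply RInt_abs_le; [apply cont_minus; apply (cont_slice F); auto|].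
    intros x Hx; left; apply Hp; auto.
  - replace eps with (e * (Rabs (b - a) + 1)) by (unfold e; field; lra).
    apply Rmult_lt_compat_l; lra.
Qed.

(** [C2] stands for joint continuity in two variables, not for two derivatives; it is [continuous2]
    in the product uniform structure. *)
Definition C2 (f : R -> R -> R) : Prop := cont (fun p : R * R => f (fst p) (snd p)).

Lemma C2_continuous2 (f : R -> R -> R) : C2 f <-> continuous2 f.
Proof.
  unfold C2; rewrite cont_eps; split.
  - intros H u r eps He. destruct (H (u, r) eps He) as [d Hd].
    exists d; split; [apply cond_pos|]. intros u' r' Hu Hr.
    apply (Hd (u', r')). split; [exact Hu|exact Hr].
  - intros H [u r] eps He. destruct (H u r eps He) as [d [Hd0 Hd]].
    exists (mkposreal d Hd0). intros [u' r'] [Hu Hr]. apply Hd; [exact Hu|exact Hr].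
Qed.

Lemma cont_fst {U V : UniformSpace} (x : U * V) : continuous (fst : U * V -> U) x.
Proof. destruct x; apply continuous_fst. Qed.
Lemma cont_snd {U V : UniformSpace} (x : U * V) : continuous (snd : U * V -> V) x.
Proof. destruct x; apply continuous_snd. Qed.

Lemma C2_comp {T : UniformSpace} (f : R -> R -> R) (a b : T -> R) :
  C2 f -> cont a -> cont b -> cont (fun x => f (a x) (b x)).
Proof.
  intros Hf Ha Hb x.
  apply (continuous_comp_2 a b f); auto.
Qed.

Lemma C2_sl (f : R -> R -> R) (u : R) : C2 f -> cont (f u).
Proof. intros H; apply (C2_comp f (fun _ => u) (fun r => r)); auto using cont_id, cont_const. Qed.

Lemma C2_su (f : R -> R -> R) (r : R) : C2 f -> cont (fun u => f u r).
Proof. intros H; apply (C2_comp f (fun u => u) (fun _ => r)); auto using cont_id, cont_const. Qed.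

Ltac conts :=
  repeat match goal with
  | H : cont ?f |- cont ?f => exact H
  | |- cont (fun x => x) => apply cont_id
  | |- cont (fun x => ?c) => apply (cont_const c)
  | |- cont (fun x => fst x) => exact cont_fst
  | |- cont (fun x => snd x) => exact cont_snd
  | |- cont fst => exact cont_fst
  | |- cont snd => exact cont_snd
  | |- cont (fun x => @?f x + @?g x) => apply (cont_plus f g)
  | |- cont (fun x => @?f x - @?g x) => apply (cont_minus f g)
  | |- cont (fun x => @?f x * @?g x) => apply (cont_mult f g)
  | |- cont (fun x => - @?f x) => apply (cont_opp f)
  | |- cont (fun x => @?f x ^ ?n) => apply (cont_pow f n)
  | |- cont (fun x => exp (@?f x)) => apply (cont_exp f)
  | |- cont (fun x => @?f x / ?c) => apply (cont_mult f (fun _ => / c))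
  | |- cont (fun x => ?f x) => change (cont f)
  end.

Ltac pos :=
  repeat match goal with
  | |- 0 <= _ * _ => apply Rmult_le_pos
  | |- 0 <= _ + _ => apply Rplus_le_le_0_compat
  end; auto; try lra.

Lemma is_derive_RInt_par (F dF : R -> R -> R) (a b x : R) :
  (forall x t, is_derive (fun y => F y t) x (dF x t)) -> C2 dF -> (forall y, cont (F y)) ->
  is_derive (fun y => RInt (F y) a b) x (RInt (dF x) a b).
Proof.
  intros HD HdF HF.
  assert (ED : forall t y, Derive (fun z => F z t) y = dF y t)
    by (intros; apply is_derive_unique, HD).
  replace (RInt (dF x) a b) with (RInt (fun t => Derive (fun z => F z t) x) a b).
  2:{ apply RInt_ext; intros; apply ED. }
  apply (is_derive_RInt_param F).
  - apply filter_forall; intros y t _; exists (dF y t); apply HD.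
  - intros t _. apply continuity_2d_pt_ext with dF; [intros; symmetry; apply ED|].
    apply continuity_2d_pt_filterlim. apply (HdF (x, t)).
  - apply filter_forall; intros y; apply ex_RInt_cont, HF.
Qed.

Lemma mvt_le (f df : R -> R) (a b M : R) :
  (forall x, Rmin a b <= x <= Rmax a b -> is_derive f x (df x)) ->
  (forall x, Rmin a b <= x <= Rmax a b -> Rabs (df x) <= M) ->
  Rabs (f b - f a) <= M * Rabs (b - a).
Proof.
  intros H1 H2. destruct (MVT_gen f a b df) as (c & Hc & E).
  - intros x Hx; apply H1; lra.
  - intros x Hx. apply continuity_pt_filterlim, (ex_derive_continuous f).
    exists (df x); apply H1; auto.
  - rewrite E, Rabs_mult. apply Rmult_le_compat_r; [apply Rabs_pos|auto].
Qed.

(** The mean value point is strictly inside the interval, which keeps it off an exceptional endpoint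
    in [mvt_le_except]. *)
Lemma mvt_open (f df : R -> R) (a b : R) :
  a < b -> cont f -> (forall x, a < x < b -> is_derive f x (df x)) ->
  exists c, a < c < b /\ f b - f a = df c * (b - a).
Proof.
  intros Hab Hc HD.
  assert (pr1 : forall c, a < c < b -> derivable_pt f c).
  { intros c Hcc; exists (df c); apply is_derive_Reals, HD, Hcc. }
  assert (pr2 : forall c, a < c < b -> derivable_pt id c) by (intros; apply derivable_pt_id).
  destruct (MVT f id a b pr1 pr2 Hab) as (c & P & E).
  - intros x _; apply continuity_pt_filterlim, Hc.
  - intros x _; apply continuity_pt_id.
  - exists c; split; [exact P|].
    rewrite (derive_pt_eq_0 f c (df c) (pr1 c P)) in E by (apply is_derive_Reals, HD, P).
    rewrite (derive_pt_eq_0 id c 1 (pr2 c P)) in E by apply derivable_pt_lim_id.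
    unfold id in E; lra.
Qed.

(** Cutting the interval at z leaves pieces whose interiors avoid z. It is applied with z = 0, where
    [Gv] and the average of a Lipschitz slice need not be differentiable. *)
Lemma mvt_le_except (f df : R -> R) (z a b M : R) :
  cont f ->
  (forall x, Rmin a b <= x <= Rmax a b -> x <> z -> is_derive f x (df x)) ->
  (forall x, Rmin a b <= x <= Rmax a b -> x <> z -> Rabs (df x) <= M) ->
  Rabs (f b - f a) <= M * Rabs (b - a).
Proof.
  intros Hc.
  assert (Base : forall a b, a <= b -> ~ a < z < b ->
    (forall x, a <= x <= b -> x <> z -> is_derive f x (df x)) ->
    (forall x, a <= x <= b -> x <> z -> Rabs (df x) <= M) ->
    Rabs (f b - f a) <= M * (b - a)).
  { clear a b; intros a b [Hab| ->] Hz H1 H2.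
    - destruct (mvt_open f df a b Hab Hc) as (c & Hcc & E).
      + intros x Hx; apply H1; lra.
      + rewrite E, Rabs_mult, (Rabs_pos_eq (b - a)) by lra.
        apply Rmult_le_compat_r; [lra|apply H2; lra].
    - rewrite !Rminus_diag, Rabs_R0; lra. }
  assert (Ord : forall a b, a <= b ->
    (forall x, a <= x <= b -> x <> z -> is_derive f x (df x)) ->
    (forall x, a <= x <= b -> x <> z -> Rabs (df x) <= M) ->
    Rabs (f b - f a) <= M * (b - a)).
  { clear a b; intros a b Hab H1 H2. destruct (Rle_dec z a) as [h|h]; [apply Base; auto; lra|].
    destruct (Rle_dec b z) as [h'|h']; [apply Base; auto; lra|].
    replace (f b - f a) with ((f b - f z) + (f z - f a)) by ring.
    triangle.
    replace (M * (b - a)) with (M * (b - z) + M * (z - a)) by ring.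
    apply Rplus_le_compat; apply Base; try lra; intros; (apply H1 || apply H2); auto; lra. }
  destruct (Rle_dec a b) as [h|h].
  - rewrite Rmin_left, Rmax_right by lra. rewrite (Rabs_pos_eq (b - a)) by lra. apply Ord, h.
  - rewrite Rmin_right, Rmax_left by lra. intros H1 H2.
    rewrite (Rabs_minus_sym b a), (Rabs_minus_sym (f b)), (Rabs_pos_eq (a - b)) by lra. apply Ord; auto; lra.
Qed.

Lemma RInt_extR (f g : R -> R) (a b : R) :
  (forall x, Rmin a b < x < Rmax a b -> f x = g x) -> RInt f a b = RInt g a b.
Proof. apply (RInt_ext f g). Qed.

Lemma is_derive_lin (r c x : R) : is_derive (fun y : R => (y - r) * c) x c.
Proof. auto_derive; auto; ring. Qed.

Ltac eqR := match goal with |- ?a = ?b => change (@eq R a b) end.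

(** * Lipschitz functions *)

Definition Lip (K : R) (f : R -> R) : Prop := forall x y, Rabs (f x - f y) <= K * Rabs (x - y).

Lemma Lip_cont K f : Lip K f -> cont f.
Proof. apply cont_Lip. Qed.

Lemma Lip_weaken K K' f : K <= K' -> Lip K f -> Lip K' f.
Proof.
  intros H Hf x y; apply Rle_trans with (1 := Hf x y).
  apply Rmult_le_compat_r; [apply Rabs_pos|exact H].
Qed.

Lemma Lip_scal K c f : Lip K f -> Lip (Rabs c * K) (fun x => c * f x).
Proof.
  intros Hf x y. replace (c * f x - c * f y) with (c * (f x - f y)) by ring.
  rewrite Rabs_mult, Rmult_assoc. apply Rmult_le_compat_l; [apply Rabs_pos|apply Hf].
Qed.

Lemma Lip_minus K K' f g : Lip K f -> Lip K' g -> Lip (K + K') (fun x => f x - g x).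
Proof.
  intros Hf Hg x y. replace (f x - g x - (f y - g y)) with ((f x - f y) - (g x - g y)) by ring.
  triangle. rewrite Rabs_Ropp. generalize (Hf x y) (Hg x y); lra.
Qed.

Lemma Lip_derive (f df : R -> R) (M : R) : (forall x, is_derive f x (df x)) -> (forall x, Rabs (df x) <= M) -> Lip M f.
Proof. intros H1 H2 x y. apply (mvt_le f df y x M); auto. Qed.

Lemma prod_diff a a' b b' Ma Mb da db :
  Rabs a <= Ma -> Rabs b' <= Mb -> Rabs (a - a') <= da -> Rabs (b - b') <= db ->
  Rabs (a * b - a' * b') <= Ma * db + Mb * da.
Proof.
  intros H1 H2 H3 H4. replace (a * b - a' * b') with (a * (b - b') + b' * (a - a')) by ring.
  triangle. rewrite !Rabs_mult.
  apply Rplus_le_compat; apply Rmult_le_compat; auto using Rabs_pos.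
Qed.

(* [r a r b] is controlled through [r a] and [r b] only, so [a] and [b] may be discontinuous at [0]. *)
Lemma rprod_Lip (a b : R -> R) (La Lb Ma Mb : R) :
  Lip La (fun r => r * a r) -> Lip Lb (fun r => r * b r) ->
  (forall r, Rabs (a r) <= Ma) -> (forall r, Rabs (b r) <= Mb) ->
  Lip (La * Mb + Ma * (Lb + Mb)) (fun r => r * a r * b r).
Proof.
  intros Ha Hb Ba Bb x y.
  replace (x * a x * b x - y * a y * b y) with
    ((x * a x - y * a y) * b x + a y * ((x * b x - y * b y) - (x - y) * b x)) by ring.
  triangle. rewrite !Rabs_mult.
  assert (Hxy := Rabs_pos (x - y)).
  assert (H1 : Rabs (x * a x - y * a y) * Rabs (b x) <= La * Rabs (x - y) * Mb).
  { apply Rmult_le_compat; auto using Rabs_pos. }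
  assert (H2 : Rabs (x * b x - y * b y - (x - y) * b x) <= (Lb + Mb) * Rabs (x - y)).
  { triangle. rewrite Rabs_Ropp, Rabs_mult.
    generalize (Hb x y) (Rmult_le_compat_l _ _ _ Hxy (Bb x)). lra. }
  assert (H3 : Rabs (a y) * Rabs (x * b x - y * b y - (x - y) * b x) <= Ma * ((Lb + Mb) * Rabs (x - y))).
  { apply Rmult_le_compat; auto using Rabs_pos. }
  lra.
Qed.

(** * Weighted radial averages *)

(** For r <> 0 this is r^(-j-1) times the integral of s^j g(s) over [0, r]. On the fixed interval
    [0, 1] nothing is singular at r = 0, and differentiating in r raises the weight j by one.
    [Lop 0] is the radial average. *)
Definition Lop (j : nat) (g : R -> R) (r : R) : R := RInt (fun t => t ^ j * g (t * r)) 0 1.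

Lemma pow01 (j : nat) t : 0 <= t <= 1 -> 0 <= t ^ j <= 1.
Proof.
  intros Ht; induction j as [|j IH]; simpl; [lra|]. nra.
Qed.

Lemma cont_Lop_arg (j : nat) (g : R -> R) (r : R) : cont g -> cont (fun t => t ^ j * g (t * r)).
Proof. intros; conts. apply (cont_comp (fun t => t * r) g); auto. change (cont (fun t : R => t * r)); conts. Qed.

Lemma Lop_diff (j : nat) (f g : R -> R) (r s M : R) : cont f -> cont g ->
  (forall t, 0 <= t <= 1 -> Rabs (f (t * r) - g (t * s)) <= M) -> Rabs (Lop j f r - Lop j g s) <= M.
Proof.
  intros Hf Hg H. unfold Lop. rewrite RInt_sub by (apply cont_Lop_arg; auto).
  apply Rle_trans with (M * Rabs (1 - 0)).
  - apply RInt_abs_le.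
    + apply cont_minus; apply cont_Lop_arg; auto.
    + rewrite Rmin_left, Rmax_right by lra. intros t Ht.
      replace (t ^ j * f (t * r) - t ^ j * g (t * s)) with (t ^ j * (f (t * r) - g (t * s))) by ring.
      destruct (pow01 j t Ht). rewrite Rabs_mult, (Rabs_pos_eq (t ^ j)) by auto.
      generalize (H t Ht) (Rabs_pos (f (t * r) - g (t * s))). nra.
  - replace (1 - 0) with 1 by ring. rewrite Rabs_R1; lra.
Qed.

Lemma Lop_zero (j : nat) (r : R) : Lop j (fun _ => 0) r = 0.
Proof.
  unfold Lop. rewrite (RInt_extR _ (fun _ => 0)) by (intros; ring).
  rewrite RInt_const. apply Rmult_0_r.
Qed.

Lemma Lop_const (c r : R) : Lop 0 (fun _ => c) r = c.
Proof.
  unfold Lop. rewrite (RInt_extR _ (fun _ => c)) by (intros; simpl; ring).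
  rewrite RInt_const. unfold scal; simpl; unfold mult; simpl; ring.
Qed.

Lemma Lop_bound (j : nat) (f : R -> R) (r M : R) : cont f ->
  (forall t, 0 <= t <= 1 -> Rabs (f (t * r)) <= M) -> Rabs (Lop j f r) <= M.
Proof.
  intros Hf H. rewrite <- (Rminus_0_r (Lop j f r)), <- (Lop_zero j r).
  apply Lop_diff; auto using cont_const. intros t Ht; rewrite Rminus_0_r; auto.
Qed.

Lemma Lop_ext (j : nat) (f g : R -> R) (r : R) :
  (forall t, 0 <= t <= 1 -> f (t * r) = g (t * r)) -> Lop j f r = Lop j g r.
Proof.
  intros H; apply RInt_ext. rewrite Rmin_left, Rmax_right by lra.
  intros t Ht; rewrite H by lra; reflexivity.
Qed.

Lemma Lop_Lip (j : nat) (K : R) (f : R -> R) : Lip K f -> Lip K (Lop j f).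
Proof.
  intros Hf x y; apply Lop_diff; try apply (Lip_cont K); auto.
  intros t Ht; apply Rle_trans with (1 := Hf _ _).
  replace (t * x - t * y) with (t * (x - y)) by ring. rewrite Rabs_mult, (Rabs_pos_eq t) by lra.
  assert (0 <= K * Rabs (x - y)) by (generalize (Rabs_pos (f x - f y)) (Hf x y); lra). nra.
Qed.

Lemma cont_Lop (j : nat) (f : R -> R) : cont f -> cont (Lop j f).
Proof.
  intros Hf. apply (cont_RInt_param (fun p : R * R => snd p ^ j * f (snd p * fst p))).
  conts. apply (cont_comp (fun p : R * R => snd p * fst p) f); auto.
  change (cont (fun p : R * R => snd p * fst p)). conts.
Qed.

Lemma Lop_derive (j : nat) (f df : R -> R) (r : R) :
  (forall x, is_derive f x (df x)) -> cont df -> is_derive (Lop j f) r (Lop (S j) df r).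
Proof.
  intros HD Hc. assert (Hf := cont_derive _ _ HD).
  apply (is_derive_RInt_par (fun r t => t ^ j * f (t * r)) (fun r t => t ^ S j * df (t * r))).
  - intros x t. replace (t ^ S j * df (t * x)) with (t ^ j * (t * df (t * x))) by (simpl; ring).
    apply (is_derive_scal (fun y => f (t * y))).
    apply (is_derive_comp f (fun y => t * y)); [apply HD|].
    auto_derive; auto; ring.
  - apply (cont_ext (fun p : R * R => snd p ^ S j * df (snd p * fst p))); [reflexivity|]. conts.
    apply (cont_comp (fun p : R * R => snd p * fst p) df); auto.
    change (cont (fun p : R * R => snd p * fst p)). conts.
  - intros y; apply cont_Lop_arg; auto.
Qed.

Lemma is_derive_dil (f df : R -> R) (r t : R) : (forall x, is_derive f x (df x)) ->
  is_derive (fun y => f (y * r)) t (r * df (t * r)).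
Proof.
  intros HD. apply (is_derive_comp f (fun y => y * r)); [apply HD|]. auto_derive; auto; ring.
Qed.

Lemma Lop0_prim (f df : R -> R) (r : R) :
  (forall x, is_derive f x (df x)) -> cont df -> r * Lop 0 df r = f r - f 0.
Proof.
  intros HD Hc. unfold Lop. rewrite <- RInt_cmul by (apply cont_Lop_arg; auto).
  rewrite (RInt_extR _ (fun t => r * df (t * r))) by (intros; simpl; ring).
  rewrite (RInt_FTC (fun t => f (t * r))).
  - f_equal; f_equal; ring.
  - intros x; apply is_derive_dil, HD.
  - conts. apply (cont_comp (fun t => t * r) df); auto. change (cont (fun t : R => t * r)); conts.
Qed.

Lemma Lop1_prim (f df : R -> R) (r : R) :
  (forall x, is_derive f x (df x)) -> cont df -> r * Lop 1 df r = f r - Lop 0 f r.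
Proof.
  intros HD Hc. assert (Hf := cont_derive _ _ HD).
  assert (C1 : forall g, cont g -> cont (fun t : R => g (t * r))).
  { intros g Hg; apply (cont_comp (fun t => t * r) g); auto. change (cont (fun t : R => t * r)); conts. }
  assert (E : Lop 0 f r + r * Lop 1 df r = f r).
  { unfold Lop. rewrite <- RInt_cmul by (apply cont_Lop_arg; auto).
    rewrite RInt_add by (conts; auto).
    rewrite (RInt_extR _ (fun t => f (t * r) + t * (r * df (t * r)))) by (intros; simpl; ring).
    rewrite (RInt_FTC (fun t => t * f (t * r))).
    - rewrite !Rmult_1_l; ring.
    - intros t. replace (f (t * r) + t * (r * df (t * r))) with (1 * f (t * r) + t * (r * df (t * r))) by ring.
      apply (is_derive_mult (fun t => t) (fun t => f (t * r)) t 1);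
        [apply (@is_derive_id R_AbsRing)|apply is_derive_dil, HD|intros; apply Rmult_comm].
    - conts; auto. }
  lra.
Qed.

Lemma Lop0_RInt (f : R -> R) (r : R) : cont f -> r * Lop 0 f r = RInt f 0 r.
Proof.
  intros Hf. rewrite (Lop0_prim (fun y => RInt f 0 y)); auto.
  - rewrite RInt_point; unfold zero; simpl; ring.
  - intros; apply is_derive_prim; auto.
Qed.

(** * The operators of the equation on one slice *)

Definition Dv (g : R -> R) (r : R) : R := g r - Lop 0 g r.
Definition qv (g : R -> R) (r : R) : R := Dv g r / r.
(** The integrand (h - hbar)^2 / r in the exponent of f. *)
Definition Qv (g : R -> R) (r : R) : R := Dv g r * qv g r.

Definition cutoff (rho : R) (chi : R -> R) : Prop :=
  cont chi /\ (forall r, 0 <= chi r <= 1) /\ (forall r, rho <= Rabs r -> chi r = 0).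

(* For g = h(u, .) and where the cutoff chi equals 1: exp Ev is f, Fv is f (1 - Lam r^2), Phiv is the
   derivative of Fv, Av is ftilde / 2 (the average of Fv, halved), Gv = Av' is G, and Bv is the right-hand
   side G (h - hbar). The derivative p = h_r satisfies p_u = A p_r + 2 G p + Wv, where only the
   combination Wv = (Phi/2 - 3 G)(h - hbar)/r matters since G' alone is not controlled at r = 0.
   At r = 0, qv takes the junk value 0. *)
Section Slice.
Variables (kap Lam : R) (chi : R -> R).

Definition Ev (g : R -> R) (r : R) : R := kap / 2 * (r * Lop 0 (fun s => chi s * Qv g s) r).
(** Integrating the cut-off derivative -2 Lam s, instead of cutting off 1 - Lam r^2, keeps the
    weight bounded on the line and makes it constant outside the support of [chi]. *)
Definition wv (r : R) : R := 1 - 2 * Lam * (r * Lop 0 (fun s => s * chi s) r).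
Definition Fv (g : R -> R) (r : R) : R := exp (Ev g r) * wv r.
Definition Phiv (g : R -> R) (r : R) : R :=
  chi r * (exp (Ev g r) * (kap / 2 * wv r * Qv g r - 2 * Lam * r)).
Definition Av (g : R -> R) (r : R) : R := Lop 0 (Fv g) r / 2.
Definition Gv (g : R -> R) (r : R) : R := Lop 1 (Phiv g) r / 2.
Definition Bv (g : R -> R) (r : R) : R := Gv g r * Dv g r.
Definition Wv (g : R -> R) (r : R) : R := (Phiv g r / 2 - 3 * Gv g r) * qv g r.

Variables (rho K1 : R).
Hypothesis Hkap : 0 < kap.
Hypothesis HLam : 0 < Lam.
Hypothesis Hrho : 0 < rho.
Hypothesis HK1 : 0 <= K1.
Hypothesis Hchi : cutoff rho chi.

Let chi_cont : cont chi := proj1 Hchi.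
Let chi_01 : forall r, 0 <= chi r <= 1 := proj1 (proj2 Hchi).
Let chi_out : forall r, rho <= Rabs r -> chi r = 0 := proj2 (proj2 Hchi).

Lemma Dv_bound K g r : Lip K g -> Rabs (Dv g r) <= K * Rabs r.
Proof.
  intros Hg. unfold Dv. rewrite <- (Lop_const (g r) r) at 1.
  apply Lop_diff; [apply cont_const|apply (Lip_cont K); auto|].
  intros t Ht; apply Rle_trans with (1 := Hg _ _).
  replace (r - t * r) with ((1 - t) * r) by ring. rewrite Rabs_mult, (Rabs_pos_eq (1 - t)) by lra.
  assert (0 <= K * Rabs (r - 0)) by (generalize (Rabs_pos (g r - g 0)) (Hg r 0); lra).
  rewrite Rminus_0_r in H. nra.
Qed.

Lemma Dv_0 g : cont g -> Dv g 0 = 0.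
Proof.
  intros Hg; unfold Dv. rewrite (Lop_ext 0 g (fun _ => g 0)) by (intros; rewrite Rmult_0_r; auto).
  rewrite Lop_const; ring.
Qed.

Lemma rqv g r : cont g -> r * qv g r = Dv g r.
Proof.
  intros Hg; unfold qv. destruct (Req_dec r 0) as [->|Hr]; [rewrite Dv_0; auto; lra|field; auto].
Qed.

Lemma Dv_Lip K g : Lip K g -> Lip (2 * K) (Dv g).
Proof.
  intros Hg; replace (2 * K) with (K + K) by ring. apply Lip_minus; auto. apply Lop_Lip; auto.
Qed.

Lemma Lip_K_nonneg K g : Lip K g -> 0 <= K.
Proof.
  intros Hg; generalize (Hg 1 0) (Rabs_pos (g 1 - g 0)).
  rewrite Rminus_0_r, Rabs_R1; lra.
Qed.

Lemma qv_bound K g r : Lip K g -> Rabs (qv g r) <= K.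
Proof.
  intros Hg; unfold qv, Rdiv. rewrite Rabs_mult.
  destruct (Req_dec r 0) as [->|Hr].
  - rewrite Dv_0, Rabs_R0, Rmult_0_l by (apply (Lip_cont K); auto). apply (Lip_K_nonneg K g Hg).
  - rewrite Rabs_inv. apply Rmult_le_reg_r with (Rabs r); [apply Rabs_pos_lt; auto|].
    rewrite Rmult_assoc, Rinv_l by (apply Rabs_no_R0; auto). rewrite Rmult_1_r. apply Dv_bound, Hg.
Qed.

Lemma Dv_diff g g' d r : cont g -> cont g' -> (forall r, Rabs (g r - g' r) <= d) ->
  Rabs (Dv g r - Dv g' r) <= 2 * d.
Proof.
  intros Hg Hg' H; unfold Dv.
  replace (g r - Lop 0 g r - (g' r - Lop 0 g' r)) with ((g r - g' r) - (Lop 0 g r - Lop 0 g' r)) by ring.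
  triangle. rewrite Rabs_Ropp.
  generalize (H r) (Lop_diff 0 g g' r r d Hg Hg' (fun t _ => H (t * r))). lra.
Qed.

Lemma Lip_ext K f g : (forall x, f x = g x) -> Lip K f -> Lip K g.
Proof. intros E H x y; rewrite <- !E; apply H. Qed.

(** Q = r q q has the form required by [rprod_Lip]: q is bounded and r q is Lipschitz, although q
    itself may jump at 0. *)
Lemma Qv_Lip K g : Lip K g -> Lip (5 * K * K) (Qv g).
Proof.
  intros Hg. assert (Hc := Lip_cont K g Hg).
  apply (Lip_ext _ (fun r => r * qv g r * qv g r)).
  - intros x; unfold Qv; rewrite rqv; auto.
  - replace (5 * K * K) with (2 * K * K + K * (2 * K + K)) by ring.
    apply rprod_Lip; try (intros; apply qv_bound; auto);
    apply (Lip_ext _ (Dv g)); try (intros; rewrite rqv; auto); apply Dv_Lip; auto.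
Qed.

Lemma Qv_bound K g r : Lip K g -> Rabs (Qv g r) <= K * K * Rabs r.
Proof.
  intros Hg; unfold Qv; rewrite Rabs_mult.
  replace (K * K * Rabs r) with ((K * Rabs r) * K) by ring.
  apply Rmult_le_compat; auto using Rabs_pos, Dv_bound, qv_bound.
Qed.

(** A difference of squares, (D - D')(q + q'): the division by r stays in the bounded factors, so
    the sup distance of the slices suffices. *)
Lemma Qv_diff K g g' d r : Lip K g -> Lip K g' -> (forall r, Rabs (g r - g' r) <= d) ->
  Rabs (Qv g r - Qv g' r) <= 4 * K * d.
Proof.
  intros Hg Hg' H. assert (Hd := Dv_diff g g' d r (Lip_cont K g Hg) (Lip_cont K g' Hg') H).
  assert (E : Qv g r - Qv g' r = (Dv g r - Dv g' r) * (qv g r + qv g' r)) by (unfold Qv, qv, Rdiv; ring).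
  rewrite E, Rabs_mult. replace (4 * K * d) with (2 * d * (K + K)) by ring.
  apply Rmult_le_compat; auto using Rabs_pos.
  triangle. apply Rplus_le_compat; apply qv_bound; auto.
Qed.

(** The integrand vanishes outside [-rho, rho], so the primitive is constant on each side and the
    bound is uniform in r. [Top_bound] uses it in time, with [th] in place of [chi]. *)
Lemma cut_prim_bound (f : R -> R) (M r : R) : cont f -> 0 <= M ->
  (forall s, Rabs s < rho -> Rabs (f s) <= M) -> Rabs (r * Lop 0 (fun s => chi s * f s) r) <= M * rho.
Proof.
  intros Hf HM H.
  assert (Hc : cont (fun s => chi s * f s)) by (conts; auto).
  assert (Hb : forall s, Rabs (chi s * f s) <= M).
  { intros s; destruct (Rlt_dec (Rabs s) rho) as [h|h].
    - rewrite Rabs_mult, (Rabs_pos_eq (chi s)) by apply chi_01.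
      generalize (chi_01 s) (H s h) (Rabs_pos (f s)); nra.
    - rewrite chi_out, Rmult_0_l, Rabs_R0; lra. }
  rewrite Lop0_RInt by auto.
  assert (In : forall x, Rabs x <= rho -> Rabs (RInt (fun s => chi s * f s) 0 x) <= M * rho).
  { intros x Hx; apply Rle_trans with (M * Rabs (x - 0)).
    - apply RInt_abs_le; auto.
    - rewrite Rminus_0_r; apply Rmult_le_compat_l; auto. }
  assert (Out : forall x y, (forall s, Rmin x y <= s <= Rmax x y -> rho <= Rabs s) ->
      RInt (fun s => chi s * f s) x y = 0).
  { intros x y Hxy. rewrite (RInt_extR _ (fun _ => 0)).
    - rewrite RInt_const. apply Rmult_0_r.
    - intros s Hs; rewrite chi_out; [ring|apply Hxy; lra]. }
  destruct (Rle_dec (Rabs r) rho) as [h|h]; [apply In; auto|].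
  destruct (Rle_dec 0 r) as [h'|h'].
  - rewrite Rabs_pos_eq in h by auto.
    rewrite <- (RInt_chasles _ 0 rho r), (Out rho r), Rplus_0_r; auto.
    + apply In; rewrite Rabs_pos_eq; lra.
    + rewrite Rmin_left, Rmax_right by lra. intros s Hs; rewrite Rabs_pos_eq; lra.
  - rewrite Rabs_left in h by lra.
    rewrite <- (RInt_chasles _ 0 (- rho) r), (Out (- rho) r), Rplus_0_r; auto.
    + apply In; rewrite Rabs_left; lra.
    + rewrite Rmin_right, Rmax_left by lra. intros s Hs; rewrite Rabs_left; lra.
Qed.

(** For slices of Lipschitz constant at most [K1]: [Cw] bounds |wv|, [E1] bounds |Ev|, [CPhi] |r|
    bounds |Phiv|, while [CE] and [CF] are the sup-norm Lipschitz constants of g -> Ev and g ->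
    Fv. *)
Definition Cw := 1 + 2 * Lam * (rho * rho).
Definition E1 := kap / 2 * (K1 * K1 * rho * rho).
Definition CPhi := exp E1 * (kap / 2 * Cw * (K1 * K1) + 2 * Lam).
Definition CE := kap / 2 * (4 * K1 * rho).
Definition CF := Cw * (exp E1 * CE).

Lemma Cw_pos : 0 < Cw.
Proof. unfold Cw; generalize (Rmult_lt_0_compat _ _ Hrho Hrho); nra. Qed.

Lemma CE_nonneg : 0 <= CE.
Proof. unfold CE; repeat apply Rmult_le_pos; lra. Qed.

Lemma CF_nonneg : 0 <= CF.
Proof.
  apply Rmult_le_pos; [left; apply Cw_pos|].
  apply Rmult_le_pos; [left; apply exp_pos|apply CE_nonneg].
Qed.

Lemma CPhi_pos : 0 < CPhi.
Proof.
  apply Rmult_lt_0_compat; [apply exp_pos|].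
  assert (0 <= kap / 2 * Cw * (K1 * K1)); [|lra].
  repeat apply Rmult_le_pos; try lra. left; apply Cw_pos.
Qed.

Lemma wv_bound r : Rabs (wv r) <= Cw.
Proof.
  unfold wv, Cw. triangle. rewrite Rabs_R1, Rabs_Ropp.
  apply Rplus_le_compat_l. rewrite Rabs_mult, (Rabs_pos_eq (2 * Lam)) by lra.
  apply Rmult_le_compat_l; [lra|].
  replace (Lop 0 (fun s => s * chi s) r) with (Lop 0 (fun s => chi s * s) r).
  - apply cut_prim_bound; [apply cont_id|lra|intros; lra].
  - apply Lop_ext; intros; ring.
Qed.

Lemma wv_derive r : is_derive wv r (- (2 * Lam * r * chi r)).
Proof.
  assert (Hc : cont (fun s => s * chi s)) by (conts; auto).
  apply (is_derive_ext (fun r => 1 - 2 * Lam * RInt (fun s => s * chi s) 0 r)).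
  { intros t; unfold wv; rewrite Lop0_RInt; auto. }
  replace (- (2 * Lam * r * chi r)) with (0 - 2 * Lam * (r * chi r)) by ring.
  apply (is_derive_minus (fun _ => 1)); [apply (@is_derive_const R_AbsRing R_NormedModule)|].
  apply (is_derive_scal (fun y => RInt (fun s => s * chi s) 0 y)).
  apply (is_derive_prim (fun s => s * chi s)); auto.
Qed.

(** * Bounds and Taylor estimates on a single slice *)

Section OneSlice.
Variables (K : R) (g : R -> R).
Hypothesis HK : 0 <= K <= K1.
Hypothesis Hg : Lip K g.

Let KK : K * K <= K1 * K1.
Proof. apply Rmult_le_compat; lra. Qed.

Lemma Qv_cont : cont (Qv g).
Proof. apply (Lip_cont (5 * K * K)), Qv_Lip, Hg. Qed.

Let chiQ_cont : cont (fun s => chi s * Qv g s).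
Proof. assert (H := Qv_cont); conts. Qed.

Lemma Ev_derive r : is_derive (Ev g) r (kap / 2 * (chi r * Qv g r)).
Proof.
  apply (is_derive_ext (fun r => kap / 2 * RInt (fun s => chi s * Qv g s) 0 r)).
  { intros t; unfold Ev; rewrite Lop0_RInt; auto. }
  apply (is_derive_scal (fun y => RInt (fun s => chi s * Qv g s) 0 y)).
  apply (is_derive_prim (fun s => chi s * Qv g s)); auto.
Qed.

Lemma Ev_bound r : Rabs (Ev g r) <= E1.
Proof.
  unfold Ev, E1. rewrite Rabs_mult, (Rabs_pos_eq (kap / 2)) by lra.
  apply Rmult_le_compat_l; [lra|]. apply cut_prim_bound; [apply Qv_cont|repeat apply Rmult_le_pos; lra|].
  intros s Hs; apply Rle_trans with (1 := Qv_bound K g s Hg).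
  apply Rmult_le_compat; try apply Rabs_pos; auto; [nra|lra].
Qed.

Lemma expEv_bound r : Rabs (exp (Ev g r)) <= exp E1.
Proof.
  rewrite Rabs_pos_eq by (left; apply exp_pos).
  generalize (Rle_trans _ _ _ (Rle_abs _) (Ev_bound r)); intros [h| ->]; [left; apply exp_increasing|]; lra.
Qed.

Lemma Fv_bound r : Rabs (Fv g r) <= exp E1 * Cw.
Proof. unfold Fv; rewrite Rabs_mult; apply Rmult_le_compat; auto using Rabs_pos, expEv_bound, wv_bound. Qed.

Lemma Fv_derive r : is_derive (Fv g) r (Phiv g r).
Proof.
  unfold Fv. replace (Phiv g r) with
    ((kap / 2 * (chi r * Qv g r) * exp (Ev g r)) * wv r + exp (Ev g r) * (- (2 * Lam * r * chi r)))
    by (unfold Phiv; ring).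
  apply (is_derive_mult (fun r => exp (Ev g r)) wv); [|apply wv_derive|intros; apply Rmult_comm].
  apply (is_derive_comp exp (Ev g)); [apply is_derive_exp|apply Ev_derive].
Qed.

Lemma Fv_cont : cont (Fv g).
Proof. apply cont_derive with (1 := Fv_derive). Qed.

Lemma Phiv_cont : cont (Phiv g).
Proof.
  unfold Phiv. assert (H1 := cont_derive _ _ Ev_derive). assert (H2 := cont_derive _ _ wv_derive).
  assert (H3 := Qv_cont); conts.
Qed.

(** The factor |r| is kept because [a_div] and [Bv_taylor] divide by r. *)
Lemma Phiv_bound_lin r : Rabs (Phiv g r) <= CPhi * Rabs r.
Proof.
  unfold Phiv, CPhi. rewrite Rabs_mult, (Rabs_pos_eq (chi r)) by apply chi_01.
  assert (Rabs (exp (Ev g r) * (kap / 2 * wv r * Qv g r - 2 * Lam * r)) <=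
          exp E1 * ((kap / 2 * Cw * (K1 * K1) + 2 * Lam) * Rabs r)).
  { rewrite Rabs_mult. apply Rmult_le_compat; auto using Rabs_pos, expEv_bound.
    triangle. rewrite Rabs_Ropp, !Rabs_mult.
    rewrite (Rabs_pos_eq (kap / 2)), (Rabs_pos_eq 2), (Rabs_pos_eq Lam) by lra.
    assert (Rabs (wv r) * Rabs (Qv g r) <= Cw * (K1 * K1 * Rabs r)).
    { apply Rmult_le_compat; auto using Rabs_pos, wv_bound.
      apply Rle_trans with (1 := Qv_bound K g r Hg). apply Rmult_le_compat_r; auto using Rabs_pos. }
    nra. }
  generalize (chi_01 r) (Rabs_pos (exp (Ev g r) * (kap / 2 * wv r * Qv g r - 2 * Lam * r))). nra.
Qed.

Lemma Phiv_bound r : Rabs (Phiv g r) <= CPhi * rho.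
Proof.
  destruct (Rlt_dec (Rabs r) rho) as [h|h].
  - apply Rle_trans with (1 := Phiv_bound_lin r). apply Rmult_le_compat_l; [left; apply CPhi_pos|lra].
  - unfold Phiv; rewrite chi_out, Rmult_0_l, Rabs_R0 by lra.
    apply Rmult_le_pos; [left; apply CPhi_pos|lra].
Qed.

Lemma Gv_bound_lin r : Rabs (Gv g r) <= CPhi * Rabs r.
Proof.
  assert (H : Rabs (Lop 1 (Phiv g) r) <= CPhi * Rabs r).
  { apply Lop_bound; [apply Phiv_cont|]. intros t Ht.
    apply Rle_trans with (1 := Phiv_bound_lin _). apply Rmult_le_compat_l; [left; apply CPhi_pos|].
    rewrite Rabs_mult, (Rabs_pos_eq t) by lra. generalize (Rabs_pos r); nra. }
  unfold Gv, Rdiv. rewrite Rabs_mult, (Rabs_pos_eq (/ 2)) by lra.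
  generalize (Rabs_pos (Lop 1 (Phiv g) r)); lra.
Qed.

Lemma Gv_bound r : Rabs (Gv g r) <= CPhi * rho.
Proof.
  assert (H : Rabs (Lop 1 (Phiv g) r) <= CPhi * rho).
  { apply Lop_bound; [apply Phiv_cont|]. intros; apply Phiv_bound. }
  unfold Gv, Rdiv. rewrite Rabs_mult, (Rabs_pos_eq (/ 2)) by lra.
  generalize (Rabs_pos (Lop 1 (Phiv g) r)); lra.
Qed.

Lemma rGv r : r * Gv g r = Dv (Fv g) r / 2.
Proof.
  unfold Gv, Dv, Rdiv. rewrite <- Rmult_assoc.
  rewrite (Lop1_prim (Fv g)); auto using Phiv_cont, Fv_derive.
Qed.

Lemma rGv_Lip : Lip (CPhi * rho) (fun r => r * Gv g r).
Proof.
  apply (Lip_ext _ (fun r => / 2 * Dv (Fv g) r)); [intros; rewrite rGv; lra|].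
  replace (CPhi * rho) with (Rabs (/ 2) * (2 * (CPhi * rho))) by (rewrite Rabs_pos_eq; lra).
  apply Lip_scal, Dv_Lip. apply (Lip_derive _ (Phiv g)); [apply Fv_derive|apply Phiv_bound].
Qed.

Lemma Av_derive r : is_derive (Av g) r (Gv g r).
Proof.
  apply (is_derive_ext (fun r => / 2 * Lop 0 (Fv g) r)); [intros; unfold Av; lra|].
  replace (Gv g r) with (/ 2 * Lop 1 (Phiv g) r) by (unfold Gv; lra).
  apply (is_derive_scal (Lop 0 (Fv g))). apply Lop_derive; [apply Fv_derive|apply Phiv_cont].
Qed.

Lemma Av_bound r : Rabs (Av g r) <= exp E1 * Cw.
Proof.
  assert (H : Rabs (Lop 0 (Fv g) r) <= exp E1 * Cw).
  { apply Lop_bound; [apply Fv_cont|]. intros; apply Fv_bound. }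
  unfold Av, Rdiv. rewrite Rabs_mult, (Rabs_pos_eq (/ 2)) by lra.
  generalize (Rabs_pos (Lop 0 (Fv g) r)); lra.
Qed.

Lemma Av_Lip : Lip (CPhi * rho) (Av g).
Proof. apply (Lip_derive _ (Gv g)); [apply Av_derive|apply Gv_bound]. Qed.

Lemma Bv_rprod r : r * Gv g r * qv g r = Bv g r.
Proof. rewrite (Rmult_comm r), Rmult_assoc, rqv by (apply (Lip_cont K), Hg). reflexivity. Qed.

Lemma rqv_Lip : Lip (2 * K) (fun r => r * qv g r).
Proof.
  apply (Lip_ext _ (Dv g)); [intros; rewrite rqv; auto; apply (Lip_cont K); auto|apply Dv_Lip; auto].
Qed.

(** B = r G q falls under [rprod_Lip]. The constant is proportional to K, which is what keeps the
    Lipschitz constant of [k] below K in the fixed point. *)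
Lemma Bv_Lip : Lip (4 * CPhi * rho * K) (Bv g).
Proof.
  apply (Lip_ext _ (fun r => r * Gv g r * qv g r)); [apply Bv_rprod|].
  replace (4 * CPhi * rho * K) with (CPhi * rho * K + CPhi * rho * (2 * K + K)) by ring.
  apply rprod_Lip; [apply rGv_Lip|apply rqv_Lip|apply Gv_bound|intros; apply qv_bound; auto].
Qed.

Lemma Bv_bound r : Rabs (Bv g r) <= exp E1 * Cw * K.
Proof.
  rewrite <- Bv_rprod, rGv, Rabs_mult. apply Rmult_le_compat; auto using Rabs_pos, qv_bound.
  unfold Dv, Rdiv; rewrite Rabs_mult, (Rabs_pos_eq (/ 2)) by lra.
  assert (H : Rabs (Lop 0 (Fv g) r) <= exp E1 * Cw).
  { apply Lop_bound; [apply Fv_cont|]. intros; apply Fv_bound. }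
  assert (H' := Fv_bound r).
  assert (H'' := Rabs_triang (Fv g r) (- Lop 0 (Fv g) r)). rewrite Rabs_Ropp in H''.
  unfold Rminus. lra.
Qed.

Lemma Wv_bound r : Rabs (Wv g r) <= 4 * CPhi * rho * K.
Proof.
  unfold Wv; rewrite Rabs_mult. apply Rmult_le_compat; auto using Rabs_pos, qv_bound.
  triangle. rewrite Rabs_Ropp, Rabs_mult, (Rabs_pos_eq 3) by lra.
  unfold Rdiv; rewrite Rabs_mult, (Rabs_pos_eq (/ 2)) by lra.
  generalize (Phiv_bound r) (Gv_bound r) (Rabs_pos (Phiv g r)). lra.
Qed.

Definition LexpE := kap / 2 * (K1 * K1 * rho) * exp E1.

Lemma chiQ_bound r : Rabs (chi r * Qv g r) <= K1 * K1 * rho.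
Proof.
  destruct (Rlt_dec (Rabs r) rho) as [h|h].
  - rewrite Rabs_mult, (Rabs_pos_eq (chi r)) by apply chi_01.
    assert (Rabs (Qv g r) <= K1 * K1 * rho).
    { apply Rle_trans with (1 := Qv_bound K g r Hg). apply Rmult_le_compat; auto using Rabs_pos; nra. }
    generalize (chi_01 r) (Rabs_pos (Qv g r)); nra.
  - rewrite chi_out, Rmult_0_l, Rabs_R0 by lra. repeat apply Rmult_le_pos; lra.
Qed.

Lemma expEv_Lip : Lip LexpE (fun r => exp (Ev g r)).
Proof.
  apply (Lip_derive _ (fun r => kap / 2 * (chi r * Qv g r) * exp (Ev g r))).
  - intros r; apply (is_derive_comp exp (Ev g)); [apply is_derive_exp|apply Ev_derive].
  - intros r. rewrite Rabs_mult. apply Rmult_le_compat; auto using Rabs_pos, expEv_bound.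
    rewrite Rabs_mult, (Rabs_pos_eq (kap / 2)) by lra. apply Rmult_le_compat_l; [lra|apply chiQ_bound].
Qed.

Lemma Phiv_eq h r : Phiv h r = chi r * (kap / 2 * (Fv h r * Qv h r) - 2 * Lam * (r * exp (Ev h r))).
Proof. unfold Phiv, Fv; ring. Qed.

Lemma Qv_bound_in r : Rabs r <= rho -> Rabs (Qv g r) <= K1 * K1 * rho.
Proof.
  intros Hr. apply Rle_trans with (1 := Qv_bound K g r Hg). apply Rmult_le_compat; auto using Rabs_pos; nra.
Qed.

Definition LPhi (Lc : R) :=
  kap / 2 * (exp E1 * Cw * (5 * (K1 * K1)) + K1 * K1 * rho * (CPhi * rho)) + 2 * Lam * (rho * LexpE + exp E1)
  + (kap / 2 * (exp E1 * Cw * (K1 * K1 * rho)) + 2 * Lam * (rho * exp E1)) * Lc.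

(** [P] is controlled only where |x| <= rho, because [Qv] may grow linearly. If y lies beyond, chi y
    = 0 and the difference is P x (chi x - chi y), so the increment of [chi] replaces that of
    [P]. *)
Lemma cut_Lip (P : R -> R) (L M Lc : R) : 0 <= L -> 0 <= M -> Lip Lc chi ->
  (forall x, Rabs x <= rho -> Rabs (P x) <= M) ->
  (forall x y, Rabs x <= rho -> Rabs y <= rho -> Rabs (P x - P y) <= L * Rabs (x - y)) ->
  Lip (L + M * Lc) (fun x => chi x * P x).
Proof.
  intros HL HM Hc HP HPL x y.
  assert (HLc := Lip_K_nonneg _ _ Hc). assert (Hxy := Rabs_pos (x - y)).
  assert (Half : forall x y, Rabs x <= rho -> rho <= Rabs y ->
    Rabs (chi x * P x - chi y * P y) <= (L + M * Lc) * Rabs (x - y)).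
  { clear x y Hxy; intros x y Hx Hy.
    replace (chi x * P x - chi y * P y) with (P x * (chi x - chi y)) by (rewrite (chi_out y) by auto; ring).
    rewrite Rabs_mult. apply Rle_trans with (M * (Lc * Rabs (x - y))).
    - apply Rmult_le_compat; auto using Rabs_pos.
    - generalize (Rmult_le_pos _ _ HL (Rabs_pos (x - y))); lra. }
  destruct (Rle_dec (Rabs x) rho) as [hx|hx], (Rle_dec (Rabs y) rho) as [hy|hy].
  - apply Rle_trans with (1 * (L * Rabs (x - y)) + M * (Lc * Rabs (x - y))); [|lra].
    apply prod_diff; auto. rewrite Rabs_pos_eq; apply chi_01.
  - apply Half; auto; lra.
  - rewrite (Rabs_minus_sym x y), (Rabs_minus_sym (chi x * P x)). apply Half; auto; lra.
  - rewrite (chi_out x), (chi_out y), !Rmult_0_l, Rminus_0_r, Rabs_R0 by lra.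
    apply Rmult_le_pos; auto. generalize (Rmult_le_pos _ _ HM HLc); lra.
Qed.

Lemma Phiv_Lip Lc : Lip Lc chi -> Lip (LPhi Lc) (Phiv g).
Proof.
  intros Hc. apply (Lip_ext _ _ _ (fun r => eq_sym (Phiv_eq g r))).
  assert (P1 := Rlt_le _ _ Cw_pos). assert (P2 := Rlt_le _ _ CPhi_pos). assert (P3 := Rlt_le _ _ (exp_pos E1)).
  assert (P4 : 0 <= LexpE) by (unfold LexpE; pos).
  apply (cut_Lip (fun r => kap / 2 * (Fv g r * Qv g r) - 2 * Lam * (r * exp (Ev g r)))); auto.
  - pos.
  - pos.
  - intros x Hx. triangle.
    rewrite Rabs_Ropp, (Rabs_mult (kap / 2)), (Rabs_mult (2 * Lam)), (Rabs_pos_eq (kap / 2)),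
      (Rabs_pos_eq (2 * Lam)) by lra.
    apply Rplus_le_compat; (apply Rmult_le_compat_l; [lra|]); rewrite Rabs_mult;
      apply Rmult_le_compat; auto using Rabs_pos, Fv_bound, expEv_bound, Qv_bound_in.
  - intros x y Hx Hy.
    replace (kap / 2 * (Fv g x * Qv g x) - 2 * Lam * (x * exp (Ev g x)) -
      (kap / 2 * (Fv g y * Qv g y) - 2 * Lam * (y * exp (Ev g y)))) with
      (kap / 2 * (Fv g x * Qv g x - Fv g y * Qv g y) - 2 * Lam * (x * exp (Ev g x) - y * exp (Ev g y))) by ring.
    triangle.
    rewrite Rabs_Ropp, (Rabs_mult (kap / 2)), (Rabs_mult (2 * Lam)), (Rabs_pos_eq (kap / 2)),
      (Rabs_pos_eq (2 * Lam)) by lra.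
    assert (H1 : Rabs (Fv g x * Qv g x - Fv g y * Qv g y) <=
      exp E1 * Cw * (5 * (K1 * K1) * Rabs (x - y)) + K1 * K1 * rho * (CPhi * rho * Rabs (x - y))).
    { apply prod_diff; auto using Fv_bound, Qv_bound_in.
      - apply (Lip_derive (Fv g) (Phiv g)); [apply Fv_derive|apply Phiv_bound].
      - apply (Lip_weaken (5 * K * K)); [lra|apply Qv_Lip, Hg]. }
    assert (H2 : Rabs (x * exp (Ev g x) - y * exp (Ev g y)) <=
      rho * (LexpE * Rabs (x - y)) + exp E1 * Rabs (x - y)).
    { apply prod_diff; auto using expEv_bound, (expEv_Lip x y). lra. }
    apply (Rmult_le_compat_l (kap / 2)) in H1; [|lra].
    apply (Rmult_le_compat_l (2 * Lam)) in H2; [|lra]. lra.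
Qed.

Lemma Gv_Lip Lc : Lip Lc chi -> Lip (LPhi Lc) (Gv g).
Proof.
  intros Hc. assert (HP := Phiv_Lip Lc Hc). assert (Hn := Lip_K_nonneg _ _ HP).
  apply (Lip_weaken (Rabs (/ 2) * LPhi Lc)); [rewrite Rabs_pos_eq; lra|].
  apply (Lip_ext _ (fun r => / 2 * Lop 1 (Phiv g) r)); [intros; unfold Gv; lra|].
  apply Lip_scal, Lop_Lip, HP.
Qed.

Let a r := Phiv g r / 2 - 3 * Gv g r.

Lemma a_lin r : Rabs (a r) <= 4 * CPhi * Rabs r.
Proof.
  unfold a. triangle. rewrite Rabs_Ropp, Rabs_mult, (Rabs_pos_eq 3) by lra.
  unfold Rdiv; rewrite Rabs_mult, (Rabs_pos_eq (/ 2)) by lra.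
  generalize (Phiv_bound_lin r) (Gv_bound_lin r) (Rabs_pos (Phiv g r)). lra.
Qed.

Lemma a_div r : Rabs (a r / r) <= 4 * CPhi.
Proof.
  assert (H := a_lin r). assert (HC := CPhi_pos).
  unfold Rdiv; rewrite Rabs_mult. destruct (Req_dec r 0) as [->|Hr].
  - rewrite Rinv_0, Rabs_R0, Rmult_0_r; lra.
  - rewrite Rabs_inv. apply Rmult_le_reg_r with (Rabs r); [apply Rabs_pos_lt; auto|].
    rewrite Rmult_assoc, Rinv_l by (apply Rabs_no_R0; auto). lra.
Qed.

Lemma r_a_div r : r * (a r / r) = a r.
Proof.
  destruct (Req_dec r 0) as [->|Hr]; [|field; auto].
  generalize (a_lin 0). rewrite Rabs_R0, Rmult_0_r. intros H.
  rewrite Rmult_0_l. destruct (Req_dec (a 0) 0) as [->|h]; auto. apply Rabs_pos_lt in h; lra.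
Qed.

(** With a = Phi/2 - 3 G, which is O(r), one has W = r (a/r) q: both a/r and q are bounded, both a
    and r q are Lipschitz, and [rprod_Lip] applies. *)
Lemma Wv_Lip Lc : Lip Lc chi -> Lip (4 * LPhi Lc * K1 + 12 * CPhi * K1) (Wv g).
Proof.
  intros Hc. assert (Hn := Lip_K_nonneg _ _ (Phiv_Lip Lc Hc)). assert (HC := CPhi_pos).
  apply (Lip_ext _ (fun r => r * (a r / r) * qv g r)); [intros; rewrite r_a_div; reflexivity|].
  apply (Lip_weaken (4 * LPhi Lc * K + 4 * CPhi * (2 * K + K))); [nra|].
  apply rprod_Lip; [|apply rqv_Lip|apply a_div|intros; apply qv_bound; auto].
  apply (Lip_ext _ a); [intros; rewrite r_a_div; reflexivity|].
  apply (Lip_weaken (Rabs (/ 2) * LPhi Lc + Rabs 3 * LPhi Lc)); [rewrite !Rabs_pos_eq; lra|].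
  apply (Lip_ext _ (fun r => / 2 * Phiv g r - 3 * Gv g r)); [intros; unfold a; lra|].
  apply Lip_minus; apply Lip_scal; auto using Phiv_Lip, Gv_Lip.
Qed.

Lemma Av_taylor Lc r s : Lip Lc chi ->
  Rabs (Av g s - Av g r - (s - r) * Gv g r) <= LPhi Lc * (s - r) ^ 2.
Proof.
  intros Hc. assert (HG := Gv_Lip Lc Hc). assert (Hn := Lip_K_nonneg _ _ HG).
  assert (H := mvt_le (fun x => Av g x - (x - r) * Gv g r) (fun x => Gv g x - Gv g r) r s (LPhi Lc * Rabs (s - r))).
  replace (Av g s - Av g r - (s - r) * Gv g r) with
   (Av g s - (s - r) * Gv g r - (Av g r - (r - r) * Gv g r)) by ring.
  replace ((s - r) ^ 2) with (Rabs (s - r) * Rabs (s - r)) by (rewrite <- Rabs_mult, Rabs_pos_eq by apply Rle_0_sqr; ring).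
  rewrite <- Rmult_assoc. apply H.
  - intros x _. 
    apply (is_derive_minus (Av g) (fun x => (x - r) * Gv g r)); [apply Av_derive|apply is_derive_lin].
  - intros x Hx. apply Rle_trans with (1 := HG x r). apply Rmult_le_compat_l; auto.
    revert Hx; unfold Rmin, Rmax, Rabs; destruct (Rle_dec r s); repeat destruct Rcase_abs; lra.
Qed.

Lemma Lop0_derive (h : R -> R) (x : R) : cont h -> x <> 0 -> is_derive (Lop 0 h) x (qv h x).
Proof.
  intros Hh Hx. apply (is_derive_ext_loc (fun y => RInt h 0 y / y)).
  - assert (H0 : 0 < Rabs x) by (apply Rabs_pos_lt; auto).
    exists (mkposreal _ H0). intros y Hy. change (Rabs (y - x) < Rabs x) in Hy.
    rewrite <- Lop0_RInt by auto. eqR. field. intros ->. rewrite Rminus_0_l, Rabs_Ropp in Hy; lra.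
  - replace (qv h x) with ((h x * x - RInt h 0 x * 1) / x ^ 2).
    + apply (is_derive_div (fun y => RInt h 0 y) (fun y => y)); auto.
      * apply is_derive_prim; auto.
      * apply (@is_derive_id R_AbsRing).
    + unfold qv, Dv. rewrite <- Lop0_RInt by auto. field; auto.
Qed.

(** Away from 0, G = (F - avg F)/(2 r); the quotient rule with (avg F)' = 2 G gives the formula. *)
Lemma Gv_derive (x : R) : x <> 0 -> is_derive (Gv g) x ((Phiv g x / 2 - 2 * Gv g x) / x).
Proof.
  intros Hx. apply (is_derive_ext_loc (fun y => / 2 * (Dv (Fv g) y / y))).
  - assert (H0 : 0 < Rabs x) by (apply Rabs_pos_lt; auto).
    exists (mkposreal _ H0). intros y Hy. change (Rabs (y - x) < Rabs x) in Hy.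
    assert (y <> 0). { intros ->. rewrite Rminus_0_l, Rabs_Ropp in Hy; lra. }
    replace (Gv g y) with (y * Gv g y / y) by (field; auto). rewrite rGv. eqR. field; auto.
  - replace ((Phiv g x / 2 - 2 * Gv g x) / x) with
      (/ 2 * (((Phiv g x - qv (Fv g) x) * x - Dv (Fv g) x * 1) / x ^ 2)).
    + apply (is_derive_scal (fun y => Dv (Fv g) y / y)).
      apply (is_derive_div (Dv (Fv g)) (fun y => y)); auto.
      * apply (is_derive_minus (Fv g) (Lop 0 (Fv g))); [apply Fv_derive|].
        apply Lop0_derive; auto. apply Fv_cont.
      * apply (@is_derive_id R_AbsRing).
    + replace (qv (Fv g) x) with (2 * Gv g x); [replace (Dv (Fv g) x) with (2 * (x * Gv g x))|].
      * field; auto.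
      * rewrite rGv; lra.
      * replace (Gv g x) with (x * Gv g x / x) by (field; auto). rewrite rGv; unfold qv; field; auto.
Qed.

Definition CT (Lc : R) := 3 * CPhi * K1 + (4 * LPhi Lc * K1 + 12 * CPhi * K1).

(** The value [g r] is frozen, since g has no derivative; its own increment is treated along
    characteristics in [k_expand]. The derivative in s of the remaining expression is G'(s) (g r -
    avg g(s)) - G(s) q(s). With G' = (Phi/2 - 2 G)/s this is (Phi/2 - 2 G)/s (g r - g s) + W(s),
    where the quotient is bounded. Both g r - g s and W(s) - W(r) are O(s - r), and the mean value
    estimate gives a quadratic remainder. *)
Lemma Bv_taylor Lc r s : Lip Lc chi ->
  Rabs (Gv g s * (g r - Lop 0 g s) - Gv g r * (g r - Lop 0 g r) - (s - r) * Wv g r) <= CT Lc * (s - r) ^ 2.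
Proof.
  intros Hc. assert (HG := Gv_Lip Lc Hc). assert (HW := Wv_Lip Lc Hc).
  assert (Hn := Lip_K_nonneg _ _ HG). assert (HC := CPhi_pos).
  assert (Hgc := Lip_cont K g Hg). assert (HGc := Lip_cont _ _ HG). assert (Hac := cont_Lop 0 g Hgc).
  assert (HWn := Lip_K_nonneg _ _ HW).
  replace (Gv g s * (g r - Lop 0 g s) - Gv g r * (g r - Lop 0 g r) - (s - r) * Wv g r) with
   (Gv g s * (g r - Lop 0 g s) - (s - r) * Wv g r - (Gv g r * (g r - Lop 0 g r) - (r - r) * Wv g r)) by ring.
  replace ((s - r) ^ 2) with (Rabs (s - r) * Rabs (s - r)) by (rewrite <- Rabs_mult, Rabs_pos_eq by apply Rle_0_sqr; ring).
  rewrite <- Rmult_assoc.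
  apply (mvt_le_except (fun x => Gv g x * (g r - Lop 0 g x) - (x - r) * Wv g r)
    (fun x => ((Phiv g x / 2 - 2 * Gv g x) / x) * (g r - Lop 0 g x) + Gv g x * (0 - qv g x) - Wv g r) 0).
  - conts; auto.
  - intros x _ Hx.
    apply (is_derive_minus (fun x => Gv g x * (g r - Lop 0 g x)) (fun x => (x - r) * Wv g r)).
    + apply (is_derive_mult (Gv g) (fun x => g r - Lop 0 g x)); [apply Gv_derive; auto| |intros; apply Rmult_comm].
      apply (is_derive_minus (fun _ => g r) (Lop 0 g)); [apply (@is_derive_const R_AbsRing R_NormedModule)|].
      apply Lop0_derive; auto.
    + apply is_derive_lin.
  - intros x Hx Hx0.
    replace ((Phiv g x / 2 - 2 * Gv g x) / x * (g r - Lop 0 g x) + Gv g x * (0 - qv g x) - Wv g r) with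
      ((Phiv g x / 2 - 2 * Gv g x) / x * (g r - g x) + (Wv g x - Wv g r))
      by (change (qv g x) with (Dv g x / x); change (Wv g x) with ((Phiv g x / 2 - 3 * Gv g x) * (Dv g x / x)); unfold Dv; field; auto).
    assert (Hxs : Rabs (x - r) <= Rabs (s - r)).
    { revert Hx; unfold Rmin, Rmax, Rabs; destruct (Rle_dec r s); repeat destruct Rcase_abs; lra. }
    triangle.
    assert (H1 : Rabs ((Phiv g x / 2 - 2 * Gv g x) / x) <= 3 * CPhi).
    { unfold Rdiv at 1. rewrite Rabs_mult, Rabs_inv.
      apply Rmult_le_reg_r with (Rabs x); [apply Rabs_pos_lt; auto|].
      rewrite Rmult_assoc, Rinv_l, Rmult_1_r by (apply Rabs_no_R0; auto).
      triangle. rewrite Rabs_Ropp, Rabs_mult, (Rabs_pos_eq 2) by lra.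
      unfold Rdiv; rewrite Rabs_mult, (Rabs_pos_eq (/ 2)) by lra.
      generalize (Phiv_bound_lin x) (Gv_bound_lin x) (Rabs_pos (Phiv g x)). lra. }
    assert (H2 : Rabs (g r - g x) <= K1 * Rabs (s - r)).
    { apply Rle_trans with (1 := Hg r x). rewrite (Rabs_minus_sym r x).
      apply Rmult_le_compat; try lra. apply Rabs_pos. }
    assert (H3 : Rabs (Wv g x - Wv g r) <= (4 * LPhi Lc * K1 + 12 * CPhi * K1) * Rabs (s - r)).
    { apply Rle_trans with (1 := HW x r). apply Rmult_le_compat_l; auto. }
    rewrite Rabs_mult.
    assert (H4 := Rmult_le_compat _ _ _ _ (Rabs_pos _) (Rabs_pos _) H1 H2).
    unfold CT. lra.
Qed.

End OneSlice.

(** * Dependence on the slice in the sup norm *)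

Section TwoSlices.
Variables (K : R) (g g' : R -> R) (d : R).
Hypothesis HK : 0 <= K <= K1.
Hypothesis Hg : Lip K g.
Hypothesis Hg' : Lip K g'.
Hypothesis Hd : forall r, Rabs (g r - g' r) <= d.

Let d_nonneg : 0 <= d := Rle_trans _ _ _ (Rabs_pos _) (Hd 0).
Let gc : cont g := Lip_cont K g Hg.
Let gc' : cont g' := Lip_cont K g' Hg'.
Let Cwp : 0 <= Cw := Rlt_le _ _ Cw_pos.
Let E1p : 0 <= exp E1 := Rlt_le _ _ (exp_pos E1).
Let CEp : 0 <= CE := CE_nonneg.
Let CFp : 0 <= CF := CF_nonneg.
Let CPhip : 0 <= CPhi := Rlt_le _ _ CPhi_pos.

Lemma Ev_diff r : Rabs (Ev g r - Ev g' r) <= CE * d.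
Proof.
  assert (H1 := Qv_cont K g Hg). assert (H2 := Qv_cont K g' Hg').
  unfold Ev, CE.
  assert (E : r * Lop 0 (fun s => chi s * Qv g s) r - r * Lop 0 (fun s => chi s * Qv g' s) r =
     r * Lop 0 (fun s => chi s * (Qv g s - Qv g' s)) r).
  { rewrite !Lop0_RInt by conts. rewrite RInt_sub by conts. apply RInt_extR; intros; ring. }
  assert (B : Rabs (r * Lop 0 (fun s => chi s * (Qv g s - Qv g' s)) r) <= 4 * K1 * d * rho).
  { apply (cut_prim_bound (fun s => Qv g s - Qv g' s)); [conts|pos|].
    intros s _. apply Rle_trans with (1 := Qv_diff K g g' d s Hg Hg' Hd).
    apply Rmult_le_compat_r; auto; lra. }
  replace (kap / 2 * (4 * K1 * rho) * d) with (kap / 2 * (4 * K1 * d * rho)) by ring.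
  rewrite <- Rmult_minus_distr_l, E, Rabs_mult, (Rabs_pos_eq (kap / 2)) by lra.
  apply Rmult_le_compat_l; lra.
Qed.

Lemma expEv_diff r : Rabs (exp (Ev g r) - exp (Ev g' r)) <= exp E1 * (CE * d).
Proof.
  apply Rle_trans with (exp E1 * Rabs (Ev g r - Ev g' r)); [|apply Rmult_le_compat_l; auto using Ev_diff].
  apply (mvt_le exp exp).
  - intros; apply is_derive_exp.
  - intros x Hx. rewrite Rabs_pos_eq by (left; apply exp_pos).
    assert (Hx' : x <= E1).
    { apply Rle_trans with (1 := proj2 Hx). apply Rmax_lub; apply Rle_trans with (1 := Rle_abs _);
      apply (Ev_bound K); auto. }
    destruct Hx' as [h| ->]; [left; apply exp_increasing; auto|lra].
Qed.

Lemma Fv_diff r : Rabs (Fv g r - Fv g' r) <= CF * d.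
Proof.
  unfold Fv, CF. rewrite <- Rmult_minus_distr_r, Rabs_mult.
  replace (Cw * (exp E1 * CE) * d) with (exp E1 * (CE * d) * Cw) by ring.
  apply Rmult_le_compat; auto using Rabs_pos, expEv_diff, wv_bound.
Qed.

Let Fc : cont (Fv g) := Fv_cont K g Hg.
Let Fc' : cont (Fv g') := Fv_cont K g' Hg'.

Lemma Av_diff r : Rabs (Av g r - Av g' r) <= CF * d.
Proof.
  assert (H : Rabs (Lop 0 (Fv g) r - Lop 0 (Fv g') r) <= CF * d).
  { apply Lop_diff; auto. intros; apply Fv_diff. }
  unfold Av. replace (Lop 0 (Fv g) r / 2 - Lop 0 (Fv g') r / 2) with
    ((Lop 0 (Fv g) r - Lop 0 (Fv g') r) * / 2) by lra.
  rewrite Rabs_mult, (Rabs_pos_eq (/ 2)) by lra.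
  generalize (Rabs_pos (Lop 0 (Fv g) r - Lop 0 (Fv g') r)). lra.
Qed.

(** The division by r is carried by the bounded [qv g], and r (G - G') is estimated through F - avg
    F. *)
Lemma Bv_diff r : Rabs (Bv g r - Bv g' r) <= (CF * K1 + 2 * CPhi * rho) * d.
Proof.
  replace (Bv g r - Bv g' r) with ((r * Gv g r - r * Gv g' r) * qv g r + Gv g' r * (Dv g r - Dv g' r)).
  2:{ rewrite <- (rqv g r) by auto. unfold Bv. rewrite <- (rqv g r), <- (rqv g' r) by auto. ring. }
  triangle. rewrite !Rabs_mult.
  assert (H1 : Rabs (r * Gv g r - r * Gv g' r) * Rabs (qv g r) <= (CF * d) * K1).
  { apply Rmult_le_compat; auto using Rabs_pos.
    - rewrite (rGv K g), (rGv K g') by auto.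
      assert (H := Dv_diff (Fv g) (Fv g') (CF * d) r Fc Fc' Fv_diff).
      replace (Dv (Fv g) r / 2 - Dv (Fv g') r / 2) with ((Dv (Fv g) r - Dv (Fv g') r) * / 2) by lra.
      rewrite Rabs_mult, (Rabs_pos_eq (/ 2)) by lra. lra.
    - apply Rle_trans with K; [apply qv_bound; auto|lra]. }
  assert (H2 : Rabs (Gv g' r) * Rabs (Dv g r - Dv g' r) <= (CPhi * rho) * (2 * d)).
  { apply Rmult_le_compat; auto using Rabs_pos.
    - apply (Gv_bound K); auto.
    - apply Dv_diff; auto. }
  lra.
Qed.

Definition LPd := kap / 2 * (exp E1 * Cw * (4 * K1) + K1 * K1 * rho * CF) + 2 * Lam * (rho * (exp E1 * CE)).

Lemma Phiv_diff r : Rabs (Phiv g r - Phiv g' r) <= LPd * d.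
Proof.
  assert (Hpos : 0 <= LPd * d) by (unfold LPd; pos).
  rewrite !Phiv_eq, <- Rmult_minus_distr_l, Rabs_mult, (Rabs_pos_eq (chi r)) by apply chi_01.
  destruct (Rle_dec rho (Rabs r)) as [h|h]; [rewrite chi_out, Rmult_0_l; auto|].
  set (T := Rabs _). assert (HT : T <= LPd * d).
  { unfold T.
    replace (kap / 2 * (Fv g r * Qv g r) - 2 * Lam * (r * exp (Ev g r)) -
      (kap / 2 * (Fv g' r * Qv g' r) - 2 * Lam * (r * exp (Ev g' r)))) with
      (kap / 2 * (Fv g r * Qv g r - Fv g' r * Qv g' r) - 2 * Lam * (r * (exp (Ev g r) - exp (Ev g' r)))) by ring.
    triangle.
    rewrite Rabs_Ropp, (Rabs_mult (kap / 2)), (Rabs_mult (2 * Lam)), (Rabs_pos_eq (kap / 2)),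
      (Rabs_pos_eq (2 * Lam)), (Rabs_mult r) by lra.
    assert (H1 : Rabs (Fv g r * Qv g r - Fv g' r * Qv g' r) <=
      exp E1 * Cw * (4 * K1 * d) + K1 * K1 * rho * (CF * d)).
    { apply prod_diff; auto using Fv_diff.
      - apply (Fv_bound K); auto.
      - apply (Qv_bound_in K); auto; lra.
      - apply Rle_trans with (1 := Qv_diff K g g' d r Hg Hg' Hd). apply Rmult_le_compat_r; auto; lra. }
    assert (H2 : Rabs r * Rabs (exp (Ev g r) - exp (Ev g' r)) <= rho * (exp E1 * (CE * d))).
    { apply Rmult_le_compat; auto using Rabs_pos, expEv_diff. lra. }
    apply (Rmult_le_compat_l (kap / 2)) in H1; [|lra].
    apply (Rmult_le_compat_l (2 * Lam)) in H2; [|lra]. unfold LPd; lra. }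
  generalize (chi_01 r) (Rabs_pos (kap / 2 * (Fv g r * Qv g r) - 2 * Lam * (r * exp (Ev g r)) -
      (kap / 2 * (Fv g' r * Qv g' r) - 2 * Lam * (r * exp (Ev g' r))))).
  fold T. nra.
Qed.

Lemma Gv_diff r : Rabs (Gv g r - Gv g' r) <= LPd * d.
Proof.
  assert (H : Rabs (Lop 1 (Phiv g) r - Lop 1 (Phiv g') r) <= LPd * d).
  { apply Lop_diff; [apply (Phiv_cont K); auto|apply (Phiv_cont K); auto|intros; apply Phiv_diff]. }
  unfold Gv. replace (Lop 1 (Phiv g) r / 2 - Lop 1 (Phiv g') r / 2) with
    ((Lop 1 (Phiv g) r - Lop 1 (Phiv g') r) * / 2) by lra.
  rewrite Rabs_mult, (Rabs_pos_eq (/ 2)) by lra.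
  generalize (Rabs_pos (Lop 1 (Phiv g) r - Lop 1 (Phiv g') r)). lra.
Qed.

(** Writing W = a D / r with a = Phi/2 - 3 G, the division by r goes to q in the term with a - a',
    and to a' = O(r) in the term with D - D'. *)
Lemma Wv_diff r : Rabs (Wv g r - Wv g' r) <= (4 * LPd * K1 + 8 * CPhi) * d.
Proof.
  set (a := fun h r => Phiv h r / 2 - 3 * Gv h r).
  replace (Wv g r - Wv g' r) with ((a g r - a g' r) * qv g r + (a g' r / r) * (Dv g r - Dv g' r)).
  2:{ unfold Wv, qv, a, Rdiv; ring. }
  triangle. rewrite !Rabs_mult.
  assert (H0 : Rabs (a g r - a g' r) <= 4 * (LPd * d)).
  { unfold a. replace (Phiv g r / 2 - 3 * Gv g r - (Phiv g' r / 2 - 3 * Gv g' r)) with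
      (/ 2 * (Phiv g r - Phiv g' r) - 3 * (Gv g r - Gv g' r)) by lra.
    triangle.
    rewrite Rabs_Ropp, !Rabs_mult, (Rabs_pos_eq (/ 2)), (Rabs_pos_eq 3) by lra.
    generalize (Phiv_diff r) (Gv_diff r) (Rabs_pos (Phiv g r - Phiv g' r)). lra. }
  assert (H1 : Rabs (a g r - a g' r) * Rabs (qv g r) <= 4 * (LPd * d) * K1).
  { apply Rmult_le_compat; auto using Rabs_pos. apply Rle_trans with K; [apply qv_bound; auto|lra]. }
  assert (H2 : Rabs (a g' r / r) * Rabs (Dv g r - Dv g' r) <= 4 * CPhi * (2 * d)).
  { apply Rmult_le_compat; auto using Rabs_pos.
    - apply (a_div K); auto.
    - apply Dv_diff; auto. }
  lra.
Qed.
End TwoSlices.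
End Slice.

(* The constant is uniform in the cutoff, whose smoothness will depend on k while the lifespan must not. *)
Definition slice_constant (kap Lam rho K1 C : R) : Prop :=
  0 < C /\ forall chi, cutoff rho chi -> forall K g, 0 <= K <= K1 -> Lip K g ->
    (forall r, Rabs (Av kap Lam chi g r) <= C) /\
    (forall r, Rabs (Gv kap Lam chi g r) <= C) /\
    (forall r, Rabs (Bv kap Lam chi g r) <= C * K) /\
    (forall r, Rabs (Wv kap Lam chi g r) <= C * K) /\
    Lip C (Av kap Lam chi g) /\
    Lip (C * K) (Bv kap Lam chi g) /\
    forall g' d, Lip K g' -> (forall r, Rabs (g r - g' r) <= d) ->
      (forall r, Rabs (Av kap Lam chi g r - Av kap Lam chi g' r) <= C * d) /\
      (forall r, Rabs (Bv kap Lam chi g r - Bv kap Lam chi g' r) <= C * d).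

Lemma slice_bounds (kap Lam rho K1 : R) : 0 < kap -> 0 < Lam -> 0 < rho -> 0 <= K1 ->
  exists C, slice_constant kap Lam rho K1 C.
Proof.
  intros H1 H2 H3 H4.
  set (c1 := exp (E1 kap rho K1) * Cw Lam rho). set (c2 := CPhi kap Lam rho K1). set (c3 := CF kap Lam rho K1).
  assert (P1 : 0 <= c1) by (unfold c1; pos; left; [apply exp_pos|apply Cw_pos; auto]).
  assert (P2 : 0 <= c2) by (left; apply CPhi_pos; auto).
  assert (P3 : 0 <= c3) by (apply CF_nonneg; auto).
  assert (P4 : 0 <= c2 * rho) by pos. assert (P5 : 0 <= c3 * K1) by pos.
  exists (1 + c1 + 4 * c2 * rho + c3 + c3 * K1). split; [lra|].
  intros chi Hchi K g HK Hg.
  assert (W1 : forall x y, x <= y -> x * K <= y * K) by (intros; apply Rmult_le_compat_r; lra).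
  repeat apply conj.
  - intros r; apply Rle_trans with c1; [apply (Av_bound kap Lam chi rho K1) with K; auto|lra].
  - intros r; apply Rle_trans with (c2 * rho); [apply (Gv_bound kap Lam chi rho K1) with K; auto|lra].
  - intros r; apply Rle_trans with (c1 * K); [apply (Bv_bound kap Lam chi rho K1); auto|apply W1; lra].
  - intros r; apply Rle_trans with (4 * c2 * rho * K); [apply (Wv_bound kap Lam chi rho K1); auto|apply W1; lra].
  - apply Lip_weaken with (c2 * rho); [lra|apply (Av_Lip kap Lam chi rho K1) with K; auto].
  - apply Lip_weaken with (4 * c2 * rho * K); [apply W1; lra|apply (Bv_Lip kap Lam chi rho K1); auto].
  - intros g' d Hg' Hd. assert (Pd : 0 <= d) by (apply Rle_trans with (2 := Hd 0); apply Rabs_pos).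
    assert (W2 : forall x y, x <= y -> x * d <= y * d) by (intros; apply Rmult_le_compat_r; lra).
    split; intros r.
    + apply Rle_trans with (c3 * d); [apply (Av_diff kap Lam chi rho K1) with K; auto|apply W2; lra].
    + apply Rle_trans with ((c3 * K1 + 2 * c2 * rho) * d);
        [apply (Bv_diff kap Lam chi rho K1) with K; auto|apply W2; lra].
Qed.

(** These constants depend on the Lipschitz constant of the cutoff. They serve only to show that the
    solution is differentiable and affect neither the lifespan nor the final bounds. *)
Lemma slice_bounds_Lip (kap Lam rho K1 : R) (chi : R -> R) (Lc : R) :
  0 < kap -> 0 < Lam -> 0 < rho -> 0 <= K1 -> cutoff rho chi -> Lip Lc chi ->
  exists C, 0 < C /\ forall K g, 0 <= K <= K1 -> Lip K g ->
    Lip C (Gv kap Lam chi g) /\ Lip C (Wv kap Lam chi g) /\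
    (forall r s, Rabs (Av kap Lam chi g s - Av kap Lam chi g r - (s - r) * Gv kap Lam chi g r) <= C * (s - r) ^ 2) /\
    (forall r s, Rabs (Gv kap Lam chi g s * (g r - Lop 0 g s) - Gv kap Lam chi g r * (g r - Lop 0 g r)
        - (s - r) * Wv kap Lam chi g r) <= C * (s - r) ^ 2) /\
    forall g' d, Lip K g' -> (forall r, Rabs (g r - g' r) <= d) ->
      (forall r, Rabs (Gv kap Lam chi g r - Gv kap Lam chi g' r) <= C * d) /\
      (forall r, Rabs (Wv kap Lam chi g r - Wv kap Lam chi g' r) <= C * d).
Proof.
  intros H1 H2 H3 H4 Hchi HL.
  set (c0 := LPhi kap Lam rho K1 Lc). set (c1 := 4 * c0 * K1 + 12 * CPhi kap Lam rho K1 * K1).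
  set (c2 := CT kap Lam rho K1 Lc). set (c3 := LPd kap Lam rho K1).
  set (c4 := 4 * c3 * K1 + 8 * CPhi kap Lam rho K1).
  (* Absolute values make the sum dominate each constant without a discussion of signs. *)
  exists (1 + Rabs c0 + Rabs c1 + Rabs c2 + Rabs c3 + Rabs c4).
  set (C := 1 + _ + _ + _ + _ + _).
  assert (HC : 0 < C /\ c0 <= C /\ c1 <= C /\ c2 <= C /\ c3 <= C /\ c4 <= C).
  { unfold C. generalize (Rabs_pos c0) (Rabs_pos c1) (Rabs_pos c2) (Rabs_pos c3) (Rabs_pos c4)
     (Rle_abs c0) (Rle_abs c1) (Rle_abs c2) (Rle_abs c3) (Rle_abs c4). repeat split; lra. }
  destruct HC as (HC & W0 & W1 & W2 & W3 & W4). clearbody C.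
  split; auto. intros K g HK Hg.
  repeat apply conj.
  - apply Lip_weaken with c0; auto. apply (Gv_Lip kap Lam chi rho K1) with K; auto.
  - apply Lip_weaken with c1; auto. apply (Wv_Lip kap Lam chi rho K1) with K; auto.
  - intros r s; apply Rle_trans with (c0 * (s - r) ^ 2);
      [apply (Av_taylor kap Lam chi rho K1) with K; auto|apply Rmult_le_compat_r; auto; apply pow2_ge_0].
  - intros r s; apply Rle_trans with (c2 * (s - r) ^ 2);
      [apply (Bv_taylor kap Lam chi rho K1) with K; auto|apply Rmult_le_compat_r; auto; apply pow2_ge_0].
  - intros g' d Hg' Hd. assert (Pd : 0 <= d) by (apply Rle_trans with (2 := Hd 0); apply Rabs_pos).
    split; intros r.
    + apply Rle_trans with (c3 * d); [apply (Gv_diff kap Lam chi rho K1) with K; auto|apply Rmult_le_compat_r; auto].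
    + apply Rle_trans with (c4 * d); [apply (Wv_diff kap Lam chi rho K1) with K; auto|apply Rmult_le_compat_r; auto].
Qed.

(** * Characteristics *)

Lemma lim_abs_le (v : nat -> R) (l M : R) :
  is_lim_seq v l -> (forall n, Rabs (v n) <= M) -> Rabs l <= M.
Proof.
  intros Hv H. apply (is_lim_seq_le (fun n => Rabs (v n)) (fun _ => M) (Rabs l) M); auto.
  - apply (is_lim_seq_abs v l Hv).
  - apply is_lim_seq_const.
Qed.

Lemma pow_half_small (c e : R) : 0 < e -> exists N, c * (/ 2) ^ N < e.
Proof.
  intros He. destruct (pow_lt_1_zero (/ 2)) with (y := e / (Rabs c + 1)) as [N HN].
  - rewrite Rabs_pos_eq; lra.
  - apply Rdiv_lt_0_compat; generalize (Rabs_pos c); lra.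
  - exists N. specialize (HN N (le_n N)).
    assert (Hp : 0 < (/ 2) ^ N) by (apply pow_lt; lra).
    rewrite Rabs_pos_eq in HN by lra. assert (Hc := Rabs_pos c).
    apply (Rmult_lt_compat_l (Rabs c + 1)) in HN; [|lra].
    replace ((Rabs c + 1) * (e / (Rabs c + 1))) with e in HN by (field; lra).
    generalize (Rle_abs c); nra.
Qed.

(** Iterates converge geometrically at each point, and completeness is that of R. Members of [Inv]
    may be unbounded functions, so the sup distance may be infinite; [d0] says that it is finite
    between the start and its image. *)
Lemma banach {T : Type} (Inv : (T -> R) -> Prop) (Phi : (T -> R) -> T -> R) (S0 : T -> R) (d0 : R) :
  Inv S0 -> (forall S, Inv S -> Inv (Phi S)) ->
  (forall (u : nat -> T -> R) (S : T -> R), (forall n, Inv (u n)) -> (forall x, is_lim_seq (fun n => u n x) (S x)) -> Inv S) ->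
  (forall S S' d, Inv S -> Inv S' -> (forall x, Rabs (S x - S' x) <= d) ->
     forall x, Rabs (Phi S x - Phi S' x) <= d / 2) ->
  (forall x, Rabs (Phi S0 x - S0 x) <= d0) ->
  exists S, Inv S /\ forall x, Phi S x = S x.
Proof.
  intros HI HP HL HC H0.
  set (u := fun n => Nat.iter n Phi S0).
  assert (Iu : forall n, Inv (u n)) by (induction n; simpl; auto).
  assert (Su : forall n x, Rabs (u (S n) x - u n x) <= d0 * (/ 2) ^ n).
  { induction n as [|n IH]; intros x.
    - simpl; rewrite Rmult_1_r; apply H0.
    - replace (d0 * (/ 2) ^ S n) with (d0 * (/ 2) ^ n / 2) by (simpl; lra).
      apply (HC (u (S n)) (u n)); auto. }
  (* The exact geometric sum, with its factor 1 - 2^(-m), is what makes the induction on m close. *)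
  assert (Du : forall n m x, Rabs (u (m + n)%nat x - u n x) <= 2 * d0 * (/ 2) ^ n * (1 - (/ 2) ^ m)).
  { intros n m x; induction m as [|m IH].
    - simpl. rewrite !Rminus_diag, Rabs_R0; lra.
    - replace (u (S m + n)%nat x - u n x) with ((u (S (m + n)) x - u (m + n)%nat x) + (u (m + n)%nat x - u n x))
        by (simpl; ring).
      triangle.
      generalize (Su (m + n)%nat x); rewrite pow_add; simpl; lra. }
  assert (d0p : forall x : T, 0 <= d0) by (intros x; apply Rle_trans with (2 := H0 x); apply Rabs_pos).
  assert (Du' : forall n m x, (n <= m)%nat -> Rabs (u m x - u n x) <= 2 * d0 * (/ 2) ^ n).
  { intros n m x Hnm. replace m with ((m - n) + n)%nat by lia.
    apply Rle_trans with (1 := Du n (m - n)%nat x).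
    assert (0 < (/ 2) ^ n) by (apply pow_lt; lra). assert (0 < (/ 2) ^ (m - n)) by (apply pow_lt; lra).
    rewrite <- (Rmult_1_r (2 * d0 * (/ 2) ^ n)) at 2. apply Rmult_le_compat_l; [|lra].
    specialize (d0p x). pos. }
  assert (Lu : forall x, exists l : R, is_lim_seq (fun n => u n x) l).
  { intros x. assert (Hc : Cauchy_crit (fun n => u n x)).
    { intros e He. destruct (pow_half_small (4 * d0) e He) as [N HN]. exists N. intros n m Hn Hm.
      unfold Rdist. replace (u n x - u m x) with ((u n x - u N x) - (u m x - u N x)) by ring.
      apply Rle_lt_trans with (1 := Rabs_triang _ _). rewrite Rabs_Ropp.
      generalize (Du' N n x Hn) (Du' N m x Hm); lra. }
    destruct (Rcomplete.R_complete _ Hc) as [l Hl]. exists l. apply is_lim_seq_Reals; auto. }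
  apply choice in Lu. destruct Lu as [L HLu].
  assert (IL : Inv L) by (apply (HL u); auto).
  assert (Bu : forall n x, Rabs (u n x - L x) <= 2 * d0 * (/ 2) ^ n).
  { intros n x. rewrite Rabs_minus_sym. apply lim_abs_le with (fun m => u (m + n)%nat x - u n x).
    - apply (is_lim_seq_minus' (fun m => u (m + n)%nat x) (fun _ => u n x)); [|apply is_lim_seq_const].
      apply (is_lim_seq_incr_n (fun m => u m x) n (L x)), HLu.
    - intros m; apply Du'; lia. }
  exists L; split; auto. intros x.
  apply Rminus_diag_uniq. apply NNPP; intros Hne. apply Rabs_pos_lt in Hne.
  destruct (pow_half_small (2 * d0) _ Hne) as [N HN].
  assert (H1 := HC (u N) L _ (Iu N) IL (Bu N) x).
  assert (H2 := Bu (S N) x). change (u (S N) x) with (Phi (u N) x) in H2. simpl in H2.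
  assert (H3 : Rabs (Phi L x - L x) <= Rabs (Phi (u N) x - L x) + Rabs (Phi (u N) x - Phi L x)).
  { replace (Phi L x - L x) with ((Phi (u N) x - L x) - (Phi (u N) x - Phi L x)) by ring.
    triangle. rewrite Rabs_Ropp; lra. }
  lra.
Qed.

(** Iterating n times from [B0] gives 2 c + (B0 - 2 c) 2^(-n). Any finite a priori bound is thus
    forgotten; this replaces Gronwall's inequality. *)
Lemma contract_bound {T : Type} (m : T -> R) (B0 c : R) :
  (forall x, Rabs (m x) <= B0) ->
  (forall B, 0 <= B -> (forall x, Rabs (m x) <= B) -> forall x, Rabs (m x) <= c + B / 2) ->
  forall x, Rabs (m x) <= 2 * c.
Proof.
  intros H0 H x.
  assert (Pm : forall B, (forall x, Rabs (m x) <= B) -> 0 <= B)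
    by (intros B HB; apply Rle_trans with (2 := HB x); apply Rabs_pos).
  assert (Hn : forall n y, Rabs (m y) <= 2 * c + (B0 - 2 * c) * (/ 2) ^ n).
  { induction n as [|n IH]; intros y; simpl.
    - rewrite Rmult_1_r; generalize (H0 y); lra.
    - generalize (H _ (Pm _ IH) IH y); lra. }
  apply Rnot_lt_le; intros Hlt.
  destruct (pow_half_small (B0 - 2 * c) (Rabs (m x) - 2 * c)) as [N HN]; [lra|].
  generalize (Hn N x); lra.
Qed.

(** Integration in time against the cutoff. As [th] has compact support, the integral of a bounded
    function is bounded for all u, and the equations can be posed on the whole line. *)
Definition Top (th : R -> R) (f : R -> R) (u : R) : R := RInt (fun s => th s * f s) 0 u.

Section Time.
Variables (th : R -> R) (sig : R).
Hypothesis Hsig : 0 < sig.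
Hypothesis Hth : cutoff sig th.

Let th_cont : cont th := proj1 Hth.

Lemma Top_bound f M u : cont f -> 0 <= M -> (forall s, Rabs (f s) <= M) -> Rabs (Top th f u) <= M * sig.
Proof.
  intros Hf HM H. unfold Top. rewrite <- Lop0_RInt by conts.
  apply (cut_prim_bound th sig); auto.
Qed.

Lemma Top_diff f g M u : cont f -> cont g -> 0 <= M -> (forall s, Rabs (f s - g s) <= M) ->
  Rabs (Top th f u - Top th g u) <= M * sig.
Proof.
  intros Hf Hg HM H.
  replace (Top th f u - Top th g u) with (Top th (fun s => f s - g s) u).
  - apply Top_bound; auto. conts.
  - unfold Top. rewrite RInt_sub by conts. apply RInt_extR; intros; ring.
Qed.

Lemma Top_Lip f M : cont f -> (forall s, Rabs (f s) <= M) -> Lip M (Top th f).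
Proof.
  intros Hf H. apply (Lip_derive _ (fun s => th s * f s)).
  - intros x. apply (is_derive_prim (fun s => th s * f s)). conts.
  - intros x. rewrite Rabs_mult. destruct (proj1 (proj2 Hth) x).
    rewrite (Rabs_pos_eq (th x)) by auto. generalize (H x) (Rabs_pos (f x)); nra.
Qed.

Lemma Top_derive f u : cont f -> is_derive (Top th f) u (th u * f u).
Proof. intros Hf. apply (is_derive_prim (fun s => th s * f s)). conts. Qed.

Lemma Top_0 f : Top th f 0 = 0.
Proof. exact (RInt_point 0 (fun s => th s * f s)). Qed.
End Time.

Notation op_bound K L O := (forall g, Lip K g -> forall r, Rabs (O g r) <= L).
Notation op_Lip K L O := (forall g, Lip K g -> Lip L (O g)).
Notation op_diff K L O := (forall g g' d, Lip K g -> Lip K g' -> (forall r, Rabs (g r - g' r) <= d) ->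
  forall r, Rabs (O g r - O g' r) <= L * d).

(** A disjoint union of three planes: one real function on [pt] encodes the triple (X, k, Y), and
    its sup norm is the maximum of the three. *)
Inductive pt := pX (u a : R) | pk (u a : R) | pY (u r : R).

(** * The fixed point for X, k and Y *)

Section FixedPoint.
Variables (kap Lam : R) (chi th H0 : R -> R) (sig C K : R).
Hypothesis Hsig : 0 < sig.
Hypothesis Hth : cutoff sig th.
Hypothesis HC : 0 < C.
Hypothesis HCs : C * sig <= / 12.
Hypothesis HK : 0 <= K <= / 2.
Hypothesis HH0 : Lip (K / 2) H0.

Notation A := (Av kap Lam chi).
Notation B := (Bv kap Lam chi).

Hypothesis HA : op_bound (2 * K) C A.
Hypothesis HB : op_bound (2 * K) (C * (2 * K)) B.
Hypothesis HAL : op_Lip (2 * K) C A.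
Hypothesis HBL : op_Lip (2 * K) (C * (2 * K)) B.
Hypothesis HAd : op_diff (2 * K) C A.
Hypothesis HBd : op_diff (2 * K) C B.

Let HC2K : C * (2 * K) <= C.
Proof. rewrite <- (Rmult_1_r C) at 2; apply Rmult_le_compat_l; lra. Qed.

(** The invariant set of the iteration. As X - id contracts by 1/2, an inverse of X(u, .) is
    2-Lipschitz, whence the constants 2 and 2 C for Y. *)
Record goodchar (X k Y : R -> R -> R) : Prop := {
  gX : forall u a b, Rabs ((X u a - a) - (X u b - b)) <= / 2 * Rabs (a - b);
  gXu : forall u u' a, Rabs (X u a - X u' a) <= C * Rabs (u - u');
  gk : forall u, Lip K (k u);
  gku : forall u u' a, Rabs (k u a - k u' a) <= C * Rabs (u - u');
  gY : forall u, Lip 2 (Y u);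
  gYu : forall u u' r, Rabs (Y u r - Y u' r) <= 2 * C * Rabs (u - u') }.

Definition hof (k Y : R -> R -> R) (u r : R) : R := k u (Y u r).
Definition newX (X k Y : R -> R -> R) (u a : R) : R := a - Top th (fun s => A (hof k Y s) (X s a)) u.
Definition newk (X k Y : R -> R -> R) (u a : R) : R := H0 a + Top th (fun s => B (hof k Y s) (X s a)) u.
(** At a fixed point this says X(u, Y(u, r)) = r. The updated [newX] is used, not X: newX - id has
    Lipschitz constant 1/8 instead of 1/2, and [newX] already depends on the triple with a small
    factor. *)
Definition newY (X k Y : R -> R -> R) (u r : R) : R := r - (newX X k Y u (Y u r) - Y u r).

Lemma goodchar_XLip X k Y u : goodchar X k Y -> Lip (3 / 2) (X u).
Proof.
  intros HG a b. replace (X u a - X u b) with (((X u a - a) - (X u b - b)) + (a - b)) by ring.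
  triangle. generalize (gX _ _ _ HG u a b); lra.
Qed.

Lemma hof_Lip X k Y u : goodchar X k Y -> Lip (2 * K) (hof k Y u).
Proof.
  intros HG a b. unfold hof. apply Rle_trans with (1 := gk _ _ _ HG u _ _).
  replace (2 * K * Rabs (a - b)) with (K * (2 * Rabs (a - b))) by ring.
  apply Rmult_le_compat_l; [lra|]. apply (gY _ _ _ HG).
Qed.

Lemma hof_diff X k Y (k' Y' : R -> R -> R) d u u' : goodchar X k Y ->
  (forall a, Rabs (k u a - k' u' a) <= d) -> (forall r, Rabs (Y u r - Y' u' r) <= 2 * d) ->
  forall r, Rabs (hof k Y u r - hof k' Y' u' r) <= 2 * d.
Proof.
  intros HG Hk HY r. unfold hof.
  replace (k u (Y u r) - k' u' (Y' u' r)) with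
    ((k u (Y u r) - k u (Y' u' r)) + (k u (Y' u' r) - k' u' (Y' u' r))) by ring.
  triangle.
  assert (H1 := gk _ _ _ HG u (Y u r) (Y' u' r)).
  assert (E1 := Hk (Y' u' r)). assert (E2 := HY r). assert (E3 := Rabs_pos (Y u r - Y' u' r)).
  assert (E4 := Rmult_le_compat_r _ _ (/ 2) E3 (proj2 HK)). lra.
Qed.

Lemma hof_uLip X k Y u u' : goodchar X k Y ->
  forall r, Rabs (hof k Y u r - hof k Y u' r) <= 2 * C * Rabs (u - u').
Proof.
  intros HG r. rewrite Rmult_assoc. apply (hof_diff X k Y k Y); auto.
  - intros; apply (gku _ _ _ HG).
  - intros; rewrite <- Rmult_assoc; apply (gYu _ _ _ HG).
Qed.

Lemma op_cont (O : (R -> R) -> R -> R) (L : R) X k Y a : goodchar X k Y ->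
  op_Lip (2 * K) L O ->
  op_diff (2 * K) L O ->
  cont (fun s => O (hof k Y s) (X s a)).
Proof.
  intros HG H1 H2.
  assert (HL : 0 <= L) by (apply (Lip_K_nonneg L (O (hof k Y 0))), H1, (hof_Lip X); auto).
  apply (cont_Lip _ (L * C + L * (2 * C))). intros s s'.
  replace (O (hof k Y s) (X s a) - O (hof k Y s') (X s' a)) with
    ((O (hof k Y s) (X s a) - O (hof k Y s) (X s' a)) + (O (hof k Y s) (X s' a) - O (hof k Y s') (X s' a))) by ring.
  triangle.
  rewrite Rmult_plus_distr_r. apply Rplus_le_compat.
  - apply Rle_trans with (1 := H1 _ (hof_Lip X k Y s HG) _ _). rewrite Rmult_assoc.
    apply Rmult_le_compat_l; auto. apply (gXu _ _ _ HG).
  - rewrite (Rmult_assoc L). apply (H2 _ _ (2 * C * Rabs (s - s'))); try apply (hof_Lip X); auto.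
    apply (hof_uLip X); auto.
Qed.

Lemma A_cont X k Y a : goodchar X k Y -> cont (fun s => A (hof k Y s) (X s a)).
Proof. intros HG; apply (op_cont A C); auto. Qed.

Lemma B_cont X k Y a : goodchar X k Y -> cont (fun s => B (hof k Y s) (X s a)).
Proof.
  intros HG; apply (op_cont B C); auto.
  intros g Hg; apply Lip_weaken with (C * (2 * K)); auto.
Qed.

Lemma newX_Lip X k Y u a b : goodchar X k Y ->
  Rabs ((newX X k Y u a - a) - (newX X k Y u b - b)) <= / 8 * Rabs (a - b).
Proof.
  intros HG. unfold newX.
  replace (a - Top th (fun s => A (hof k Y s) (X s a)) u - a - (b - Top th (fun s => A (hof k Y s) (X s b)) u - b))
   with (- (Top th (fun s => A (hof k Y s) (X s a)) u - Top th (fun s => A (hof k Y s) (X s b)) u)) by ring.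
  rewrite Rabs_Ropp. assert (Hab := Rabs_pos (a - b)).
  apply Rle_trans with (C * (3 / 2 * Rabs (a - b)) * sig).
  - apply (Top_diff th sig); auto using A_cont; [pos|].
    intros s. apply Rle_trans with (1 := HAL _ (hof_Lip X k Y s HG) _ _).
    apply Rmult_le_compat_l; [lra|]. apply (goodchar_XLip X k Y); auto.
  - replace (C * (3 / 2 * Rabs (a - b)) * sig) with ((C * sig) * (3 / 2 * Rabs (a - b))) by ring.
    assert (E := Rmult_le_compat_r (3 / 2 * Rabs (a - b)) _ _ ltac:(lra) HCs). lra.
Qed.

(** Since C sig <= 1/12, every constant has room: X - id gets 1/8, k gets K/2 + K/4, and Y gets 1 +
    2/8 in r and C + C/4 in u. *)
Lemma new_good X k Y : goodchar X k Y -> goodchar (newX X k Y) (newk X k Y) (newY X k Y).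
Proof.
  intros HG.
  assert (XU : forall u u' a, Rabs (newX X k Y u a - newX X k Y u' a) <= C * Rabs (u - u')).
  { intros u u' a. unfold newX.
    replace (a - Top th (fun s => A (hof k Y s) (X s a)) u - (a - Top th (fun s => A (hof k Y s) (X s a)) u')) with
     (- (Top th (fun s => A (hof k Y s) (X s a)) u - Top th (fun s => A (hof k Y s) (X s a)) u')) by ring.
    rewrite Rabs_Ropp. apply (Top_Lip th sig); auto using A_cont.
    intros s; apply HA, (hof_Lip X); auto. }
  split; auto.
  - intros u a b. apply Rle_trans with (1 := newX_Lip X k Y u a b HG). generalize (Rabs_pos (a - b)); lra.
  - intros u a b. unfold newk. assert (Hab := Rabs_pos (a - b)).
    replace (H0 a + Top th (fun s => B (hof k Y s) (X s a)) u - (H0 b + Top th (fun s => B (hof k Y s) (X s b)) u))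
     with ((H0 a - H0 b) + (Top th (fun s => B (hof k Y s) (X s a)) u - Top th (fun s => B (hof k Y s) (X s b)) u)) by ring.
    triangle.
    assert (H1 : Rabs (Top th (fun s => B (hof k Y s) (X s a)) u - Top th (fun s => B (hof k Y s) (X s b)) u)
       <= C * (2 * K) * (3 / 2 * Rabs (a - b)) * sig).
    { apply (Top_diff th sig); auto using B_cont; [pos|].
      intros s. apply Rle_trans with (1 := HBL _ (hof_Lip X k Y s HG) _ _).
      apply Rmult_le_compat_l; [pos|]. apply (goodchar_XLip X k Y); auto. }
    replace (C * (2 * K) * (3 / 2 * Rabs (a - b)) * sig) with ((C * sig) * (3 * (K * Rabs (a - b)))) in H1 by field.
    assert (E0 : 0 <= K * Rabs (a - b)) by pos.
    assert (E := Rmult_le_compat_r (3 * (K * Rabs (a - b))) _ _ ltac:(lra) HCs). assert (E' := HH0 a b). lra.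
  - intros u u' a. unfold newk.
    replace (H0 a + Top th (fun s => B (hof k Y s) (X s a)) u - (H0 a + Top th (fun s => B (hof k Y s) (X s a)) u')) with
     (Top th (fun s => B (hof k Y s) (X s a)) u - Top th (fun s => B (hof k Y s) (X s a)) u') by ring.
    apply (Top_Lip th sig); auto using B_cont.
    intros s. apply Rle_trans with (C * (2 * K)); [apply HB, (hof_Lip X); auto|exact HC2K].
  - intros u r s. unfold newY.
    replace (r - (newX X k Y u (Y u r) - Y u r) - (s - (newX X k Y u (Y u s) - Y u s))) with
      ((r - s) - ((newX X k Y u (Y u r) - Y u r) - (newX X k Y u (Y u s) - Y u s))) by ring.
    triangle. rewrite Rabs_Ropp.
    assert (H1 := newX_Lip X k Y u (Y u r) (Y u s) HG).
    assert (H2 := gY _ _ _ HG u r s). assert (H3 := Rabs_pos (r - s)). lra.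
  - intros u u' r. unfold newY.
    replace (r - (newX X k Y u (Y u r) - Y u r) - (r - (newX X k Y u' (Y u' r) - Y u' r))) with
     (- (((newX X k Y u (Y u r) - Y u r) - (newX X k Y u (Y u' r) - Y u' r)) +
       (newX X k Y u (Y u' r) - newX X k Y u' (Y u' r)))) by ring.
    rewrite Rabs_Ropp. triangle.
    assert (G1 := newX_Lip X k Y u (Y u r) (Y u' r) HG). assert (G2 := gYu _ _ _ HG u u' r). assert (G3 := XU u u' (Y u' r)).
    assert (0 <= C * Rabs (u - u')) by (generalize (Rabs_pos (u - u')); intros; pos). lra.
Qed.

(** As K <= 1/2, the slices differ by at most 2 d, so A and B along the characteristics differ by at
    most C d + 2 C d. Integration in time turns 3 C d into d/4, which is where C sig <= 1/12 comes
    from. For Y, d/8 is added to d/4. *)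
Lemma new_contract X k Y X' k' Y' d : goodchar X k Y -> goodchar X' k' Y' -> 0 <= d ->
  (forall u a, Rabs (X u a - X' u a) <= d) -> (forall u a, Rabs (k u a - k' u a) <= d) ->
  (forall u a, Rabs (Y u a - Y' u a) <= d) ->
  (forall u a, Rabs (newX X k Y u a - newX X' k' Y' u a) <= d / 4) /\
  (forall u a, Rabs (newk X k Y u a - newk X' k' Y' u a) <= d / 4) /\
  (forall u a, Rabs (newY X k Y u a - newY X' k' Y' u a) <= d / 2).
Proof.
  intros HG HG' Hd HX Hk HY.
  assert (Hh : forall u r, Rabs (hof k Y u r - hof k' Y' u r) <= 2 * d).
  { intros u; apply (hof_diff X k Y k' Y'); auto. intros r; generalize (HY u r); lra. }
  assert (Op : forall (O : (R -> R) -> R -> R) s a, op_Lip (2 * K) C O ->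
    op_diff (2 * K) C O ->
    Rabs (O (hof k Y s) (X s a) - O (hof k' Y' s) (X' s a)) <= 3 * C * d).
  { intros O s a H1 H2.
    replace (O (hof k Y s) (X s a) - O (hof k' Y' s) (X' s a)) with
     ((O (hof k Y s) (X s a) - O (hof k Y s) (X' s a)) + (O (hof k Y s) (X' s a) - O (hof k' Y' s) (X' s a))) by ring.
    triangle.
    assert (E1 := H1 _ (hof_Lip X k Y s HG) (X s a) (X' s a)).
    assert (E2 := H2 _ _ _ (hof_Lip X k Y s HG) (hof_Lip X' k' Y' s HG') (Hh s) (X' s a)).
    assert (E3 := Rmult_le_compat_l C _ _ (Rlt_le _ _ HC) (HX s a)). lra. }
  assert (Cs : 3 * C * d * sig <= d / 4).
  { replace (3 * C * d * sig) with ((C * sig) * (3 * d)) by ring.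
    assert (E := Rmult_le_compat_r (3 * d) _ _ ltac:(lra) HCs). lra. }
  assert (NX : forall u a, Rabs (newX X k Y u a - newX X' k' Y' u a) <= d / 4).
  { intros u a. unfold newX.
    replace (a - Top th (fun s => A (hof k Y s) (X s a)) u - (a - Top th (fun s => A (hof k' Y' s) (X' s a)) u))
    with (- (Top th (fun s => A (hof k Y s) (X s a)) u - Top th (fun s => A (hof k' Y' s) (X' s a)) u)) by ring.
    rewrite Rabs_Ropp. apply Rle_trans with (2 := Cs).
    apply (Top_diff th sig); auto using A_cont. pos. }
  split; [exact NX|split].
  - intros u a. unfold newk.
    replace (H0 a + Top th (fun s => B (hof k Y s) (X s a)) u - (H0 a + Top th (fun s => B (hof k' Y' s) (X' s a)) u))
    with (Top th (fun s => B (hof k Y s) (X s a)) u - Top th (fun s => B (hof k' Y' s) (X' s a)) u) by ring.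
    apply Rle_trans with (2 := Cs).
    apply (Top_diff th sig); auto using B_cont; [pos|]. intros s; apply (Op B); auto.
    intros g Hg; apply Lip_weaken with (C * (2 * K)); auto.
  - intros u r. unfold newY.
    replace (r - (newX X k Y u (Y u r) - Y u r) - (r - (newX X' k' Y' u (Y' u r) - Y' u r))) with
    (- (((newX X k Y u (Y u r) - Y u r) - (newX X k Y u (Y' u r) - Y' u r)) +
       (newX X k Y u (Y' u r) - newX X' k' Y' u (Y' u r)))) by ring.
    rewrite Rabs_Ropp. triangle.
    generalize (newX_Lip X k Y u (Y u r) (Y' u r) HG) (NX u (Y' u r)) (HY u r). lra.
Qed.

Lemma characteristics_exist : exists X k Y, goodchar X k Y /\
  (forall u a, X u a = a - Top th (fun s => A (hof k Y s) (X s a)) u) /\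
  (forall u a, k u a = H0 a + Top th (fun s => B (hof k Y s) (X s a)) u) /\
  (forall u r, X u (Y u r) = r).
Proof.
  set (Xc := fun (S : pt -> R) u a => S (pX u a)). set (kc := fun (S : pt -> R) u a => S (pk u a)).
  set (Yc := fun (S : pt -> R) u a => S (pY u a)).
  set (Inv := fun S => goodchar (Xc S) (kc S) (Yc S)).
  set (Phi := fun S p => match p with
    | pX u a => newX (Xc S) (kc S) (Yc S) u a
    | pk u a => newk (Xc S) (kc S) (Yc S) u a
    | pY u a => newY (Xc S) (kc S) (Yc S) u a end).
  set (S0 := fun p => match p with pX u a => a | pk u a => H0 a | pY u a => a end).
  assert (I0 : Inv S0).
  { split; unfold Xc, kc, Yc, S0; intros.
    - replace (a - a - (b - b)) with 0 by ring. rewrite Rabs_R0. generalize (Rabs_pos (a - b)); lra.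
    - rewrite Rminus_diag, Rabs_R0. generalize (Rabs_pos (u - u')); nra.
    - intros x y. generalize (HH0 x y) (Rabs_pos (x - y)). nra.
    - rewrite Rminus_diag, Rabs_R0. generalize (Rabs_pos (u - u')); nra.
    - intros x y. generalize (Rabs_pos (x - y)); lra.
    - rewrite Rminus_diag, Rabs_R0. generalize (Rabs_pos (u - u')); nra. }
  destruct (banach Inv Phi S0 (C * sig)) as (S & IS & ES).
  - exact I0.
  - intros S HS. apply (new_good _ _ _ HS).
  - intros v S Hv HL.
    assert (D : forall p q M, (forall n, Rabs (v n p - v n q) <= M) -> Rabs (S p - S q) <= M).
    { intros p q M H. apply lim_abs_le with (fun n => v n p - v n q); auto.
      apply (is_lim_seq_minus' (fun n => v n p) (fun n => v n q)); auto. }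
    split; unfold Xc, kc, Yc; intros.
    + apply lim_abs_le with (fun n => (v n (pX u a) - a) - (v n (pX u b) - b)).
      * apply (is_lim_seq_minus' (fun n => v n (pX u a) - a) (fun n => v n (pX u b) - b));
        [apply (is_lim_seq_minus' (fun n => v n (pX u a)) (fun _ => a))|
         apply (is_lim_seq_minus' (fun n => v n (pX u b)) (fun _ => b))]; auto using is_lim_seq_const.
      * intros n; apply (gX _ _ _ (Hv n)).
    + apply D; intros n; apply (gXu _ _ _ (Hv n)).
    + intros a b; apply D; intros n; apply (gk _ _ _ (Hv n)).
    + apply D; intros n; apply (gku _ _ _ (Hv n)).
    + intros a b; apply D; intros n; apply (gY _ _ _ (Hv n)).
    + apply D; intros n; apply (gYu _ _ _ (Hv n)).
  - intros S S' d HS HS' Hd.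
    assert (Pd : 0 <= d) by (apply Rle_trans with (2 := Hd (pX 0 0)); apply Rabs_pos).
    destruct (new_contract _ _ _ _ _ _ d HS HS' Pd) as (E1 & E2 & E3); unfold Xc, kc, Yc; auto.
    intros [u a|u a|u a]; simpl.
    + generalize (E1 u a); lra.
    + generalize (E2 u a); lra.
    + apply E3.
  - assert (BX : forall u a, Rabs (newX (Xc S0) (kc S0) (Yc S0) u a - a) <= C * sig).
    { intros u a. unfold newX. match goal with |- Rabs (_ - ?t - _) <= _ => replace (a - t - a) with (- t) by ring end. rewrite Rabs_Ropp.
      apply (Top_bound th sig); auto using A_cont; [lra|]. intros s; apply HA, (hof_Lip _ _ _ _ I0). }
    intros [u a|u a|u a]; simpl.
    + apply BX.
    + unfold newk. match goal with |- Rabs (_ + ?t - _) <= _ => replace (H0 a + t - H0 a) with t by ring end.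
      apply (Top_bound th sig); auto using B_cont; [lra|]. intros s.
      apply Rle_trans with (C * (2 * K)); [apply HB, (hof_Lip _ _ _ _ I0)|exact HC2K].
    + unfold newY. replace (a - (newX (Xc S0) (kc S0) (Yc S0) u (Yc S0 u a) - Yc S0 u a) - a) with
       (- (newX (Xc S0) (kc S0) (Yc S0) u (Yc S0 u a) - Yc S0 u a)) by ring.
      rewrite Rabs_Ropp. apply BX.
  - exists (Xc S), (kc S), (Yc S).
    assert (EX : forall u a, Xc S u a = newX (Xc S) (kc S) (Yc S) u a) by (intros; symmetry; apply (ES (pX u a))).
    split; [exact IS|split; [exact EX|split]].
    + intros u a; symmetry; apply (ES (pk u a)).
    + intros u r. generalize (ES (pY u r)); simpl. unfold newY. rewrite <- EX. change (S (pY u r)) with (Yc S u r). lra.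
Qed.
End FixedPoint.

(** * First derivatives of the solution *)

Lemma is_derive_eps (f : R -> R) (x l : R) :
  is_derive f x l <->
  forall eps, 0 < eps -> exists d, 0 < d /\ forall y, Rabs (y - x) < d ->
    Rabs (f y - f x - (y - x) * l) <= eps * Rabs (y - x).
Proof.
  split.
  - intros [_ H] eps He. destruct (H x (fun P HP => HP) (mkposreal eps He)) as [d Hd].
    exists d; split; [apply cond_pos|]. intros y Hy. exact (Hd y Hy).
  - intros H; split; [apply is_linear_scal_l|].
    intros x' Hx' [eps He].
    replace x' with x by (apply (is_filter_lim_locally_unique x x'); exact Hx').
    destruct (H eps He) as (d & Hd & Hy). exists (mkposreal d Hd). intros y B. exact (Hy y B).
Qed.

Lemma is_derive_quad (f : R -> R) (x l M : R) :
  (forall y, Rabs (f y - f x - (y - x) * l) <= M * (y - x) ^ 2) -> is_derive f x l.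
Proof.
  intros H; apply is_derive_eps; intros eps He. assert (HM := Rabs_pos M).
  exists (eps / (Rabs M + 1)). split; [apply Rdiv_lt_0_compat; lra|]. intros y Hy.
  apply Rle_trans with (1 := H y).
  replace ((y - x) ^ 2) with (Rabs (y - x) * Rabs (y - x)) by (rewrite <- Rabs_mult, Rabs_pos_eq by apply Rle_0_sqr; ring).
  rewrite <- Rmult_assoc. assert (Hp := Rabs_pos (y - x)). apply Rmult_le_compat_r; auto.
  apply Rle_trans with ((Rabs M + 1) * Rabs (y - x)).
  - apply Rmult_le_compat_r; auto. generalize (Rle_abs M); lra.
  - replace eps with ((Rabs M + 1) * (eps / (Rabs M + 1))) by (field; lra).
    apply Rmult_le_compat_l; lra.
Qed.

Lemma C2_Lip (f : R -> R -> R) (L : R) : 0 <= L ->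
  (forall u u' r r', Rabs (f u r - f u' r') <= L * (Rabs (u - u') + Rabs (r - r'))) -> C2 f.
Proof.
  intros HL H. apply C2_continuous2. intros u r eps He.
  exists (eps / (2 * (L + 1))). assert (Hd : 0 < eps / (2 * (L + 1))) by (apply Rdiv_lt_0_compat; lra).
  split; auto. intros u' r' Hu Hr. apply Rle_lt_trans with (1 := H u' u r' r).
  replace eps with ((L + 1) * (eps / (2 * (L + 1)) + eps / (2 * (L + 1)))) by (field; lra).
  apply Rle_lt_trans with ((L + 1) * (Rabs (u' - u) + Rabs (r' - r))).
  - apply Rmult_le_compat_r; [|lra]. generalize (Rabs_pos (u' - u)) (Rabs_pos (r' - r)); lra.
  - apply Rmult_lt_compat_l; lra.
Qed.

(** The substitution s = t u makes the interval of integration fixed, so that u becomes a mere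
    parameter. *)
Lemma C2_Top (th : R -> R) (f : R -> R -> R) : cont th -> C2 f -> C2 (fun u r => Top th (fun s => f s r) u).
Proof.
  intros Ht Hf. unfold C2.
  apply (cont_ext (fun p : R * R => fst p * RInt (fun t => th (t * fst p) * f (t * fst p) (snd p)) 0 1)).
  - intros [u r]; simpl. unfold Top. assert (Hc : cont (fun s => f s r)) by (apply C2_su; auto).
    rewrite <- (Lop0_RInt (fun s => th s * f s r)) by conts. unfold Lop. f_equal. apply RInt_extR; intros; simpl; ring.
  - apply (cont_mult fst); [conts|].
    apply (cont_RInt_param (fun q : (R * R) * R => th (snd q * fst (fst q)) * f (snd q * fst (fst q)) (snd (fst q)))).
    assert (H1 : cont (fun q : (R * R) * R => fst (fst q)))
      by (apply (cont_comp (@fst (R * R) R) fst); exact cont_fst).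
    assert (H2 : cont (fun q : (R * R) * R => snd (fst q)))
      by (apply (cont_comp (@fst (R * R) R) snd); [exact cont_fst|exact cont_snd]).
    assert (H3 : cont (fun q : (R * R) * R => snd q * fst (fst q))) by conts.
    apply cont_mult.
    + apply (cont_comp (fun q : (R * R) * R => snd q * fst (fst q)) th); auto.
    + apply (C2_comp f); auto.
Qed.

Section CharDeriv.
Variables (kap Lam : R) (chi th H0 dH0 : R -> R) (sig C K C' : R).
Hypothesis Hsig : 0 < sig.
Hypothesis Hth : cutoff sig th.
Hypothesis HC : 0 < C.
Hypothesis HC' : 0 < C'.
Hypothesis HCs : C * sig <= / 12.
Hypothesis HK : 0 <= K <= / 2.
Hypothesis HdH0 : forall a, is_derive H0 a (dH0 a).
Hypothesis cdH0 : cont dH0.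

Notation A := (Av kap Lam chi).
Notation B := (Bv kap Lam chi).
Notation G := (Gv kap Lam chi).
Notation W := (Wv kap Lam chi).

Hypothesis HG : op_bound (2 * K) C G.
Hypothesis HW : op_bound (2 * K) (C * (2 * K)) W.
Hypothesis HAL : op_Lip (2 * K) C A.
Hypothesis HBL : op_Lip (2 * K) (C * (2 * K)) B.
Hypothesis HAd : op_diff (2 * K) C A.
Hypothesis HBd : op_diff (2 * K) C B.
Hypothesis HGL : op_Lip (2 * K) C' G.
Hypothesis HWL : op_Lip (2 * K) C' W.
Hypothesis HGd : op_diff (2 * K) C' G.
Hypothesis HWd : op_diff (2 * K) C' W.
Hypothesis HAT : forall g, Lip (2 * K) g -> forall r s,
   Rabs (A g s - A g r - (s - r) * G g r) <= C' * (s - r) ^ 2.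
Hypothesis HBT : forall g, Lip (2 * K) g -> forall r s,
   Rabs (G g s * (g r - Lop 0 g s) - G g r * (g r - Lop 0 g r) - (s - r) * W g r) <= C' * (s - r) ^ 2.

Variables (X k Y : R -> R -> R).
Hypothesis good : goodchar C K X k Y.
Notation h := (hof k Y).
Hypothesis eqX : forall u a, X u a = a - Top th (fun s => A (h s) (X s a)) u.
Hypothesis eqk : forall u a, k u a = H0 a + Top th (fun s => B (h s) (X s a)) u.
Hypothesis XY : forall u r, X u (Y u r) = r.

Let th_cont : cont th := proj1 Hth.
Let hL : forall s, Lip (2 * K) (h s) := fun s => hof_Lip C K HK X k Y s good.
Let XL : forall u, Lip (3 / 2) (X u) := fun u => goodchar_XLip C K X k Y u good.

(** X(u, .) is injective because X - id contracts by 1/2, so its right inverse is also a left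
    inverse. *)
Lemma YX u a : Y u (X u a) = a.
Proof.
  assert (H := gX _ _ _ _ _ good u (Y u (X u a)) a). rewrite XY in H.
  replace (X u a - Y u (X u a) - (X u a - a)) with (- (Y u (X u a) - a)) in H by ring.
  rewrite Rabs_Ropp in H. apply Rminus_diag_uniq.
  destruct (Req_dec (Y u (X u a) - a) 0) as [E|E]; auto. apply Rabs_pos_lt in E. lra.
Qed.

Lemma h_X u a : h u (X u a) = k u a.
Proof. unfold hof. rewrite YX; auto. Qed.

Lemma X_C2 : C2 X.
Proof.
  apply (C2_Lip _ (C + 3 / 2)); [lra|]. intros u u' r r'.
  replace (X u r - X u' r') with ((X u r - X u r') + (X u r' - X u' r')) by ring.
  triangle.
  assert (H1 := XL u r r'). assert (H2 := gXu _ _ _ _ _ good u u' r').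
  assert (H3 := Rabs_pos (u - u')). assert (H4 := Rabs_pos (r - r')).
  assert (0 <= C * Rabs (r - r')) by pos. lra.
Qed.

Lemma Y_C2 : C2 Y.
Proof.
  apply (C2_Lip _ (2 * C + 2)); [lra|]. intros u u' r r'.
  replace (Y u r - Y u' r') with ((Y u r - Y u r') + (Y u r' - Y u' r')) by ring.
  triangle.
  assert (H1 := gY _ _ _ _ _ good u r r'). assert (H2 := gYu _ _ _ _ _ good u u' r').
  assert (H3 := Rabs_pos (u - u')). assert (H4 := Rabs_pos (r - r')).
  assert (0 <= C * Rabs (r - r')) by pos. lra.
Qed.

Lemma op_C2 (O : (R -> R) -> R -> R) (L : R) :
  op_Lip (2 * K) L O ->
  op_diff (2 * K) L O ->
  C2 (fun u r => O (h u) r).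
Proof.
  intros H1 H2.
  assert (HL : 0 <= L) by (apply (Lip_K_nonneg L (O (h 0))), H1, hL).
  apply (C2_Lip _ (L + L * (2 * C))); [pos|]. intros u u' r r'.
  replace (O (h u) r - O (h u') r') with ((O (h u) r - O (h u) r') + (O (h u) r' - O (h u') r')) by ring.
  triangle.
  assert (E1 := H1 _ (hL u) r r').
  assert (E2 := H2 _ _ _ (hL u) (hL u') (hof_uLip C K HK X k Y u u' good) r').
  assert (H3 := Rabs_pos (u - u')). assert (H4 := Rabs_pos (r - r')).
  assert (0 <= L * Rabs (u - u')) by pos. assert (0 <= L * (2 * C) * Rabs (r - r')) by pos. lra.
Qed.

Lemma A_C2 : C2 (fun u r => A (h u) r).
Proof. apply (op_C2 A C); auto. Qed.
Lemma B_C2 : C2 (fun u r => B (h u) r).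
Proof.
  apply (op_C2 B C); auto. intros g Hg; apply Lip_weaken with (C * (2 * K)); auto.
  rewrite <- (Rmult_1_r C) at 2; apply Rmult_le_compat_l; lra.
Qed.
Lemma G_C2 : C2 (fun u r => G (h u) r).
Proof. apply (op_C2 G C'); auto. Qed.
Lemma W_C2 : C2 (fun u r => W (h u) r).
Proof. apply (op_C2 W C'); auto. Qed.

Lemma along_C2 (f : R -> R -> R) : C2 f -> C2 (fun u a => f u (X u a)).
Proof. intros Hf. apply (C2_comp f fst (fun p => X (fst p) (snd p))); auto; [conts|apply X_C2]. Qed.

Let GX_C2 : C2 (fun s a => G (h s) (X s a)) := along_C2 _ G_C2.
Let WX_C2 : C2 (fun s a => W (h s) (X s a)) := along_C2 _ W_C2.
Let AX_c a : cont (fun s => A (h s) (X s a)) := C2_su _ a (along_C2 _ A_C2).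
Let BX_c a : cont (fun s => B (h s) (X s a)) := C2_su _ a (along_C2 _ B_C2).
Let GX_c a : cont (fun s => G (h s) (X s a)) := C2_su _ a GX_C2.
Let WX_c a : cont (fun s => W (h s) (X s a)) := C2_su _ a WX_C2.

(** Candidates for the derivatives: Z for X_a, P for k_a and p = P/Z for h_r. Formally Z_u = - theta
    G Z and P_u = theta (G P + W Z), so I = P Z satisfies I_u = theta Z^2 W and is given by an
    integral. Explicit formulas make continuity and higher regularity visible; that these are the
    derivatives is shown in [X_derive], [k_derive] and [h_derive_r]. *)
Definition Zc (u a : R) : R := exp (- Top th (fun s => G (h s) (X s a)) u).
Definition Ic (u a : R) : R := dH0 a + Top th (fun s => Zc s a ^ 2 * W (h s) (X s a)) u.
Definition Pc (u a : R) : R := Ic u a / Zc u a.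
Definition pc (u r : R) : R := Pc u (Y u r) / Zc u (Y u r).

Lemma Zc_C2 : C2 Zc.
Proof.
  assert (H := C2_Top th _ th_cont GX_C2). unfold C2, Zc. apply (cont_exp (fun p : R * R => - Top th _ (fst p))).
  apply cont_opp, H.
Qed.

Lemma Ic_C2 : C2 Ic.
Proof.
  assert (H1 := Zc_C2). assert (H2 := WX_C2).
  assert (H : C2 (fun s a => Zc s a ^ 2 * W (h s) (X s a))).
  { unfold C2 in *. apply cont_mult; [apply (cont_pow (fun p : R * R => Zc (fst p) (snd p)))|]; auto. }
  apply (C2_Top th) in H; auto. unfold C2, Ic. apply cont_plus; [|apply H].
  apply (cont_comp snd dH0); auto. exact cont_snd.
Qed.

Lemma Zc_pos u a : 0 < Zc u a.
Proof. apply exp_pos. Qed.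

Lemma Pc_C2 : C2 Pc.
Proof.
  assert (H1 := Zc_C2). assert (H2 := Ic_C2). unfold C2, Pc in *. apply cont_div; auto.
  intros x; apply Rgt_not_eq, Zc_pos.
Qed.

Lemma pc_C2 : C2 pc.
Proof.
  assert (H3 := Y_C2). unfold C2, pc. apply cont_div.
  - apply (C2_comp Pc fst (fun p => Y (fst p) (snd p))); [apply Pc_C2|conts|auto].
  - apply (C2_comp Zc fst (fun p => Y (fst p) (snd p))); [apply Zc_C2|conts|auto].
  - intros x; apply Rgt_not_eq, Zc_pos.
Qed.

Lemma Zc_derive u a : is_derive (fun s => Zc s a) u (th u * (- G (h u) (X u a) * Zc u a)).
Proof.
  replace (th u * (- G (h u) (X u a) * Zc u a)) with (- (th u * G (h u) (X u a)) * Zc u a) by ring.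
  unfold Zc at 1.
  apply (is_derive_comp exp (fun s => - Top th (fun s => G (h s) (X s a)) s)); [apply is_derive_exp|].
  apply (is_derive_opp (fun s => Top th (fun s => G (h s) (X s a)) s)).
  apply (Top_derive th sig Hth (fun s => G (h s) (X s a))); auto.
Qed.

Lemma Zc_bound u a : Rabs (Zc u a) <= 3.
Proof.
  rewrite Rabs_pos_eq by (left; apply Zc_pos). unfold Zc.
  apply Rle_trans with (exp 1); [|apply exp_le_3].
  assert (H : Rabs (Top th (fun s => G (h s) (X s a)) u) <= C * sig).
  { apply (Top_bound th sig); auto. lra. }
  assert (H1 := Rabs_maj2 (Top th (fun s => G (h s) (X s a)) u)).
  left. apply exp_increasing. lra.
Qed.

Let Zc_c a : cont (fun s => Zc s a) := C2_su _ a Zc_C2.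
Let Pc_c a : cont (fun s => Pc s a) := C2_su _ a Pc_C2.

Lemma Zc_eq u a : Zc u a = 1 - Top th (fun s => G (h s) (X s a) * Zc s a) u.
Proof.
  assert (c1 := GX_c a). assert (c2 := Zc_c a).
  assert (E : RInt (fun s => th s * (- G (h s) (X s a) * Zc s a)) 0 u = Zc u a - Zc 0 a).
  { apply (RInt_FTC (fun s => Zc s a)); [intros; apply Zc_derive|conts]. }
  assert (E0 : Zc 0 a = 1) by (unfold Zc; rewrite Top_0, Ropp_0, exp_0; auto).
  unfold Top. replace (RInt (fun s => th s * (G (h s) (X s a) * Zc s a)) 0 u) with
    (- RInt (fun s => th s * (- G (h s) (X s a) * Zc s a)) 0 u); [lra|].
  rewrite <- (Rmult_1_l (RInt _ _ _)), Ropp_mult_distr_l, <- RInt_cmul by conts.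
  apply RInt_extR; intros; ring.
Qed.

Lemma Pc_eq u a : Pc u a = dH0 a + Top th (fun s => G (h s) (X s a) * Pc s a + W (h s) (X s a) * Zc s a) u.
Proof.
  assert (c1 := GX_c a). assert (c2 := Zc_c a). assert (c3 := Pc_c a). assert (c4 := WX_c a).
  assert (E : RInt (fun s => th s * (G (h s) (X s a) * Pc s a + W (h s) (X s a) * Zc s a)) 0 u = Pc u a - Pc 0 a).
  { apply (RInt_FTC (fun s => Pc s a)); [|conts].
    intros v. assert (Zv := Zc_pos v a).
    replace (th v * (G (h v) (X v a) * Pc v a + W (h v) (X v a) * Zc v a)) with
     (((th v * (Zc v a ^ 2 * W (h v) (X v a))) * Zc v a - Ic v a * (th v * (- G (h v) (X v a) * Zc v a))) / (Zc v a) ^ 2)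
     by (unfold Pc; field; lra).
    apply (is_derive_div (fun v => Ic v a) (fun v => Zc v a)); [|apply Zc_derive|lra].
    replace (th v * (Zc v a ^ 2 * W (h v) (X v a))) with (0 + th v * (Zc v a ^ 2 * W (h v) (X v a))) by ring.
    apply (is_derive_plus (fun _ => dH0 a) (fun v => Top th (fun s => Zc s a ^ 2 * W (h s) (X s a)) v));
      [apply (@is_derive_const R_AbsRing R_NormedModule)|].
    apply (Top_derive th sig Hth (fun s => Zc s a ^ 2 * W (h s) (X s a))). conts. }
  assert (E0 : Pc 0 a = dH0 a) by (unfold Pc, Ic, Zc; rewrite !Top_0, Ropp_0, exp_0; field).
  unfold Top. lra.
Qed.

Let Xd u a b : (X u b - X u a) ^ 2 <= 9 / 4 * (b - a) ^ 2.
Proof.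
  assert (H := XL u b a).
  apply (Rmult_le_compat _ _ _ _ (Rabs_pos _) (Rabs_pos _) H) in H.
  rewrite <- Rabs_mult, Rabs_pos_eq in H by apply Rle_0_sqr.
  replace (3 / 2 * Rabs (b - a) * (3 / 2 * Rabs (b - a))) with (9 / 4 * (Rabs (b - a) * Rabs (b - a))) in H by field.
  rewrite <- Rabs_mult, (Rabs_pos_eq ((b - a) * (b - a))) in H by apply Rle_0_sqr. lra.
Qed.

Let sCB M : 0 <= M -> C * M * sig <= M / 12.
Proof.
  intros HM. replace (C * M * sig) with (C * sig * M) by ring.
  assert (E := Rmult_le_compat_r M _ _ HM HCs). lra.
Qed.

Let M1 := 9 / 2 * C' * sig.

(** As a function of u the remainder solves a linear integral equation whose source, by [HAT], is at
    most C' (9/4) (b - a)^2, where 9/4 is the square of the Lipschitz constant of X. Its linear part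
    is absorbed by [contract_bound], whose factor 2 appears in [M1]. *)
Lemma X_expand u a b : Rabs (X u b - X u a - (b - a) * Zc u a) <= M1 * (b - a) ^ 2.
Proof.
  replace (M1 * (b - a) ^ 2) with (2 * (C' * (9 / 4 * (b - a) ^ 2) * sig)) by (unfold M1; field).
  revert u. apply (contract_bound _ (3 / 2 * Rabs (b - a) + Rabs (b - a) * 3)).
  - intros u. triangle. rewrite Rabs_Ropp, Rabs_mult.
    apply Rplus_le_compat; [apply XL|]. apply Rmult_le_compat_l; [apply Rabs_pos|apply Zc_bound].
  - intros M HM Hm u. assert (Hab := pow2_ge_0 (b - a)).
    assert (c1 := AX_c a). assert (c2 := AX_c b). assert (c3 := GX_c a). assert (c4 := Zc_c a).
    set (f := fun s => A (h s) (X s b) - A (h s) (X s a) - (b - a) * (G (h s) (X s a) * Zc s a)).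
    assert (E : X u b - X u a - (b - a) * Zc u a = - Top th f u).
    { rewrite (eqX u a), (eqX u b), Zc_eq.
      assert (E : Top th f u = Top th (fun s => A (h s) (X s b)) u - Top th (fun s => A (h s) (X s a)) u
                  - (b - a) * Top th (fun s => G (h s) (X s a) * Zc s a) u).
      { unfold Top. rewrite <- RInt_cmul by conts. rewrite !RInt_sub by conts.
        apply RInt_extR; intros; unfold f; ring. }
      rewrite E; ring. }
    rewrite E, Rabs_Ropp.
    assert (HT : Rabs (Top th f u) <= (C' * (9 / 4 * (b - a) ^ 2) + C * M) * sig).
    { apply (Top_bound th sig); auto.
      - unfold f; conts.
      - pos.
      - intros s. unfold f.
        replace (A (h s) (X s b) - A (h s) (X s a) - (b - a) * (G (h s) (X s a) * Zc s a)) with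
         ((A (h s) (X s b) - A (h s) (X s a) - (X s b - X s a) * G (h s) (X s a)) +
          G (h s) (X s a) * (X s b - X s a - (b - a) * Zc s a)) by ring.
        triangle. rewrite Rabs_mult. apply Rplus_le_compat.
        + apply Rle_trans with (1 := HAT _ (hL s) _ _). apply Rmult_le_compat_l; [lra|apply Xd].
        + apply Rmult_le_compat; auto using Rabs_pos. }
    generalize (sCB M HM). lra.
Qed.

Let M2 := (3 / 2 * C' * K + 9 / 4 * C' + C * (2 * K) * M1) * sig.

Let M1_nonneg : 0 <= M1.
Proof. unfold M1; pos. Qed.

(** The same scheme as for X. The remainder of [H0] is carried along unevaluated, because [H0] is
    only C^1 and that term need not be quadratic. *)
Lemma k_expand u a b : Rabs (k u b - k u a - (b - a) * Pc u a) <=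
  2 * (Rabs (H0 b - H0 a - (b - a) * dH0 a) + M2 * (b - a) ^ 2).
Proof.
  set (e0 := Rabs (H0 b - H0 a - (b - a) * dH0 a)).
  assert (Hab := pow2_ge_0 (b - a)).
  assert (c3 := GX_c a). assert (c4 := Zc_c a). assert (c5 := WX_c a). assert (c6 := Pc_c a).
  assert (c1 := BX_c a). assert (c2 := BX_c b).
  revert u. apply (contract_bound _ (K * Rabs (b - a) + Rabs (b - a) * (3 * (Rabs (dH0 a) + 9 * (C * (2 * K)) * sig)))).
  - intros u. triangle. rewrite Rabs_Ropp, Rabs_mult.
    apply Rplus_le_compat; [apply (gk _ _ _ _ _ good)|]. apply Rmult_le_compat_l; [apply Rabs_pos|].
    unfold Pc, Rdiv. rewrite Rabs_mult, Rmult_comm.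
    apply Rmult_le_compat; auto using Rabs_pos.
    + rewrite Rabs_pos_eq by (left; apply Rinv_0_lt_compat, Zc_pos).
      unfold Zc. rewrite <- exp_Ropp, Ropp_involutive. apply Rle_trans with (exp 1); [|apply exp_le_3].
      assert (HT : Rabs (Top th (fun s => G (h s) (X s a)) u) <= C * sig).
      { apply (Top_bound th sig); auto. lra. }
      assert (H1 := Rle_abs (Top th (fun s => G (h s) (X s a)) u)). left; apply exp_increasing; lra.
    + unfold Ic. triangle. apply Rplus_le_compat_l.
      apply (Top_bound th sig); auto; [conts|pos|].
      intros s. rewrite Rabs_mult. apply Rmult_le_compat; auto using Rabs_pos.
      rewrite <- RPow_abs. replace 9 with (3 ^ 2) by ring. apply pow_incr. split; [apply Rabs_pos|apply Zc_bound].
  - intros M HM Hm u.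
    set (f := fun s => B (h s) (X s b) - B (h s) (X s a)
              - (b - a) * (G (h s) (X s a) * Pc s a + W (h s) (X s a) * Zc s a)).
    assert (E : k u b - k u a - (b - a) * Pc u a = (H0 b - H0 a - (b - a) * dH0 a) + Top th f u).
    { rewrite (eqk u a), (eqk u b), Pc_eq.
      assert (E : Top th f u = Top th (fun s => B (h s) (X s b)) u - Top th (fun s => B (h s) (X s a)) u
                  - (b - a) * Top th (fun s => G (h s) (X s a) * Pc s a + W (h s) (X s a) * Zc s a) u).
      { unfold Top. rewrite <- RInt_cmul by conts. rewrite !RInt_sub by conts.
        apply RInt_extR; intros; unfold f; ring. }
      rewrite E; ring. }
    rewrite E. triangle. fold e0.
    assert (HT : Rabs (Top th f u) <=
      ((3 / 2 * C' * K + 9 / 4 * C' + C * (2 * K) * M1) * (b - a) ^ 2 + C * M) * sig).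
    { apply (Top_bound th sig); auto.
      - unfold f; conts.
      - pos.
      - intros s. unfold f, Bv, Dv. rewrite !h_X.
        set (Ga := G (h s) (X s a)). set (Gb := G (h s) (X s b)). set (Wa := W (h s) (X s a)).
        (* In the second group the slice value is frozen at [k s a], which is the form of [HBT]. The
           increment of k meets Gb - Ga, a product of two increments, and Ga, which reproduces the
           remainder being estimated. *)
        replace (Gb * (k s b - Lop 0 (h s) (X s b)) - Ga * (k s a - Lop 0 (h s) (X s a)) -
          (b - a) * (Ga * Pc s a + Wa * Zc s a)) with
         ((Gb - Ga) * (k s b - k s a) +
          ((Gb * (k s a - Lop 0 (h s) (X s b)) - Ga * (k s a - Lop 0 (h s) (X s a)) - (X s b - X s a) * Wa) +
          (Wa * (X s b - X s a - (b - a) * Zc s a) +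
          Ga * (k s b - k s a - (b - a) * Pc s a)))) by ring.
        assert (E1 : Rabs ((Gb - Ga) * (k s b - k s a)) <= 3 / 2 * C' * K * (b - a) ^ 2).
        { rewrite Rabs_mult.
          apply Rle_trans with ((C' * (3 / 2 * Rabs (b - a))) * (K * Rabs (b - a))).
          - apply Rmult_le_compat; try apply Rabs_pos.
            + apply Rle_trans with (1 := HGL _ (hL s) _ _). apply Rmult_le_compat_l; [lra|apply XL].
            + apply (gk _ _ _ _ _ good).
          - right. replace (C' * (3 / 2 * Rabs (b - a)) * (K * Rabs (b - a))) with
              (3 / 2 * C' * K * (Rabs (b - a) * Rabs (b - a))) by ring.
            rewrite <- Rabs_mult, Rabs_pos_eq by apply Rle_0_sqr. ring. }
        assert (E2 : Rabs (Gb * (k s a - Lop 0 (h s) (X s b)) - Ga * (k s a - Lop 0 (h s) (X s a)) - (X s b - X s a) * Wa)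
           <= 9 / 4 * C' * (b - a) ^ 2).
        { rewrite <- (h_X s a). apply Rle_trans with (1 := HBT _ (hL s) _ _).
          generalize (Rmult_le_compat_l C' _ _ (Rlt_le _ _ HC') (Xd s a b)); lra. }
        assert (E3 : Rabs (Wa * (X s b - X s a - (b - a) * Zc s a)) <= C * (2 * K) * M1 * (b - a) ^ 2).
        { rewrite Rabs_mult, (Rmult_assoc (C * (2 * K))). apply Rmult_le_compat; auto using Rabs_pos, X_expand.
          apply HW, hL. }
        assert (E4 : Rabs (Ga * (k s b - k s a - (b - a) * Pc s a)) <= C * M).
        { rewrite Rabs_mult. apply Rmult_le_compat; auto using Rabs_pos. apply HG, hL. }
        triangle.
        assert (T1 := Rabs_triang (Gb * (k s a - Lop 0 (h s) (X s b)) - Ga * (k s a - Lop 0 (h s) (X s a)) - (X s b - X s a) * Wa)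
          (Wa * (X s b - X s a - (b - a) * Zc s a) + Ga * (k s b - k s a - (b - a) * Pc s a))).
        assert (T2 := Rabs_triang (Wa * (X s b - X s a - (b - a) * Zc s a)) (Ga * (k s b - k s a - (b - a) * Pc s a))).
        lra. }
    unfold M2. generalize (sCB M HM). lra.
Qed.

Lemma X_derive u a : is_derive (X u) a (Zc u a).
Proof. apply (is_derive_quad _ _ _ M1). intros b; apply X_expand. Qed.

Let Yd u r s : (Y u s - Y u r) ^ 2 <= 4 * (s - r) ^ 2.
Proof.
  assert (H := gY _ _ _ _ _ good u s r).
  apply (Rmult_le_compat _ _ _ _ (Rabs_pos _) (Rabs_pos _) H) in H.
  rewrite <- Rabs_mult, Rabs_pos_eq in H by apply Rle_0_sqr.
  replace (2 * Rabs (s - r) * (2 * Rabs (s - r))) with (4 * (Rabs (s - r) * Rabs (s - r))) in H by field.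
  rewrite <- Rabs_mult, (Rabs_pos_eq ((s - r) * (s - r))) in H by apply Rle_0_sqr. lra.
Qed.

Lemma Y_expand u r s : Rabs (Y u s - Y u r - (s - r) / Zc u (Y u r)) <= 4 * M1 / Zc u (Y u r) * (s - r) ^ 2.
Proof.
  assert (HZ := Zc_pos u (Y u r)). assert (H := X_expand u (Y u r) (Y u s)). rewrite !XY in H.
  replace (Y u s - Y u r - (s - r) / Zc u (Y u r)) with
    (- (s - r - (Y u s - Y u r) * Zc u (Y u r)) * / Zc u (Y u r)) by (field; lra).
  rewrite Rabs_mult, Rabs_Ropp, (Rabs_pos_eq (/ _)) by (left; apply Rinv_0_lt_compat; auto).
  replace (4 * M1 / Zc u (Y u r) * (s - r) ^ 2) with (M1 * (4 * (s - r) ^ 2) * / Zc u (Y u r)) by (field; lra).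
  apply Rmult_le_compat_r; [left; apply Rinv_0_lt_compat; auto|].
  apply Rle_trans with (1 := H). apply Rmult_le_compat_l; auto.
Qed.

Lemma Y_derive u r : is_derive (Y u) r (/ Zc u (Y u r)).
Proof.
  apply (is_derive_quad _ _ _ (4 * M1 / Zc u (Y u r))). intros s. apply (Y_expand u r s).
Qed.

Lemma k_derive u a : is_derive (k u) a (Pc u a).
Proof.
  apply is_derive_eps; intros eps He.
  destruct (proj1 (is_derive_eps H0 a (dH0 a)) (HdH0 a) (eps / 4)) as (d & Hd & H); [lra|].
  assert (HM2 : 0 <= M2) by (unfold M2; pos).
  exists (Rmin d (eps / (4 * (M2 + 1)))). split; [apply Rmin_glb_lt; auto; apply Rdiv_lt_0_compat; lra|].
  intros b Hb. assert (Hb1 := Rlt_le_trans _ _ _ Hb (Rmin_l _ _)). assert (Hb2 := Rlt_le_trans _ _ _ Hb (Rmin_r _ _)).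
  apply Rle_trans with (1 := k_expand u a b). specialize (H b Hb1).
  assert (Hp := Rabs_pos (b - a)).
  assert (E : M2 * (b - a) ^ 2 <= eps / 4 * Rabs (b - a)).
  { replace ((b - a) ^ 2) with (Rabs (b - a) * Rabs (b - a)) by (rewrite <- Rabs_mult, Rabs_pos_eq by apply Rle_0_sqr; ring).
    rewrite <- Rmult_assoc. apply Rmult_le_compat_r; auto.
    apply Rle_trans with ((M2 + 1) * Rabs (b - a)); [apply Rmult_le_compat_r; lra|].
    replace (eps / 4) with ((M2 + 1) * (eps / (4 * (M2 + 1)))) by (field; lra).
    apply Rmult_le_compat_l; lra. }
  lra.
Qed.

Lemma h_derive_r u r : is_derive (h u) r (pc u r).
Proof.
  unfold pc, Rdiv. rewrite Rmult_comm.
  apply (is_derive_comp (k u) (Y u)); [apply k_derive|apply Y_derive].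
Qed.

(** With a = Y(u, r) fixed, h(v, r) is the sum of k(v, a), differentiable by [eqk], and of h(v, r) -
    h(v, X(v, a)). The mean value theorem in r turns the latter into p(v, c)(r - X(v, a)), so
    continuity of p and the equation of X suffice and Y is never differentiated in u. *)
Lemma h_derive_u u r : is_derive (fun v => h v r) u (th u * (A (h u) r * pc u r + B (h u) r)).
Proof.
  set (a := Y u r). assert (Ea : X u a = r) by apply XY.
  assert (Dk : is_derive (fun v => k v a) u (th u * B (h u) r)).
  { apply (is_derive_ext (fun v => H0 a + Top th (fun s => B (h s) (X s a)) v)); [intros; symmetry; apply eqk|].
    replace (th u * B (h u) r) with (0 + th u * B (h u) (X u a)) by (rewrite Ea; ring).
    apply (is_derive_plus (fun _ => H0 a) (fun v => Top th (fun s => B (h s) (X s a)) v));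
      [apply (@is_derive_const R_AbsRing R_NormedModule)|].
    apply (Top_derive th sig Hth (fun s => B (h s) (X s a))); auto. }
  assert (DX : is_derive (fun v => X v a) u (- (th u * A (h u) r))).
  { apply (is_derive_ext (fun v => a - Top th (fun s => A (h s) (X s a)) v)); [intros; symmetry; apply eqX|].
    replace (- (th u * A (h u) r)) with (0 - th u * A (h u) (X u a)) by (rewrite Ea; ring).
    apply (is_derive_minus (fun _ => a) (fun v => Top th (fun s => A (h s) (X s a)) v));
      [apply (@is_derive_const R_AbsRing R_NormedModule)|].
    apply (Top_derive th sig Hth (fun s => A (h s) (X s a))); auto. }
  assert (Dh : is_derive (fun v => h v r - k v a) u (pc u r * (th u * A (h u) r))).
  { apply is_derive_eps; intros eps He.
    assert (He1 : 0 < eps / (2 * (C + 1))) by (apply Rdiv_lt_0_compat; lra).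
    assert (Hpp : 0 < eps / (2 * (Rabs (pc u r) + 1)))
      by (apply Rdiv_lt_0_compat; auto; generalize (Rabs_pos (pc u r)); lra).
    destruct (proj1 (C2_continuous2 pc) pc_C2 u r _ He1) as (d1 & Hd1 & Hp).
    destruct (proj1 (is_derive_eps _ _ _) DX _ Hpp) as (d2 & Hd2 & HX).
    exists (Rmin (Rmin d1 (d1 / (C + 1))) d2). split.
    { repeat apply Rmin_glb_lt; auto. apply Rdiv_lt_0_compat; lra. }
    intros v Hv. assert (Hv2 := Rlt_le_trans _ _ _ Hv (Rmin_r _ _)).
    assert (Hv' := Rlt_le_trans _ _ _ Hv (Rmin_l _ _)).
    assert (Hv1 := Rlt_le_trans _ _ _ Hv' (Rmin_l _ _)). assert (Hv3 := Rlt_le_trans _ _ _ Hv' (Rmin_r _ _)).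
    clear Hv Hv'. specialize (HX v Hv2). rewrite Ea in HX.
    assert (Hl := gXu _ _ _ _ _ good v u a). rewrite Ea in Hl.
    assert (Hvp := Rabs_pos (v - u)).
    assert (Hl' : Rabs (X v a - r) < d1).
    { apply Rle_lt_trans with (1 := Hl). apply Rle_lt_trans with ((C + 1) * Rabs (v - u)).
      - apply Rmult_le_compat_r; lra.
      - replace d1 with ((C + 1) * (d1 / (C + 1))) by (field; lra). apply Rmult_lt_compat_l; lra. }
    assert (E0 : h u r = k u a) by (rewrite <- Ea at 1; apply h_X).
    rewrite E0, Rminus_diag, Rminus_0_r. rewrite <- (h_X v a).
    destruct (MVT_gen (h v) (X v a) r (pc v)) as (c & Hc & E).
    { intros; apply h_derive_r. }
    { intros x _; apply continuity_pt_filterlim. apply (Lip_cont _ _ (hL v)). }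
    rewrite E.
    assert (Hcd : Rabs (c - r) < d1).
    { revert Hc Hl'. unfold Rmin, Rmax, Rabs. destruct (Rle_dec (X v a) r); repeat destruct Rcase_abs; lra. }
    specialize (Hp v c Hv1 Hcd).
    replace (pc v c * (r - X v a) - (v - u) * (pc u r * (th u * A (h u) r))) with
     (- ((pc v c - pc u r) * (X v a - r) + pc u r * (X v a - r - (v - u) * - (th u * A (h u) r)))) by ring.
    rewrite Rabs_Ropp. triangle. rewrite !Rabs_mult.
    assert (T1 : Rabs (pc v c - pc u r) * Rabs (X v a - r) <= eps / (2 * (C + 1)) * (C * Rabs (v - u))).
    { apply Rmult_le_compat; try apply Rabs_pos; lra. }
    assert (T1' : eps / (2 * (C + 1)) * (C * Rabs (v - u)) <= eps / 2 * Rabs (v - u)).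
    { rewrite <- Rmult_assoc. apply Rmult_le_compat_r; auto.
      replace (eps / 2) with (eps / (2 * (C + 1)) * (C + 1)) by (field; lra). apply Rmult_le_compat_l; lra. }
    assert (T2 : Rabs (pc u r) * Rabs (X v a - r - (v - u) * - (th u * A (h u) r)) <=
       (Rabs (pc u r) + 1) * (eps / (2 * (Rabs (pc u r) + 1)) * Rabs (v - u))).
    { apply Rmult_le_compat; try apply Rabs_pos; auto; lra. }
    replace ((Rabs (pc u r) + 1) * (eps / (2 * (Rabs (pc u r) + 1)) * Rabs (v - u))) with
      (eps / 2 * Rabs (v - u)) in T2 by (field; generalize (Rabs_pos (pc u r)); lra).
    lra. }
  apply (is_derive_ext (fun v => (h v r - k v a) + k v a)); [intros; eqR; ring|].
  replace (th u * (A (h u) r * pc u r + B (h u) r)) with (pc u r * (th u * A (h u) r) + th u * B (h u) r) by ring.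
  apply (is_derive_plus (fun v => h v r - k v a) (fun v => k v a)); auto.
Qed.
End CharDeriv.

(** * Higher regularity *)

Lemma fun2_ext (f g : R -> R -> R) : (forall u r, f u r = g u r) -> f = g.
Proof. intros H; apply functional_extensionality; intros u; apply functional_extensionality; apply H. Qed.

Definition drv (f fr : R -> R -> R) : Prop := forall u r, is_derive (f u) r (fr u r).
Definition duv (f fu : R -> R -> R) : Prop := forall u r, is_derive (fun v => f v r) u (fu u r).

Lemma Ck2_intro (k : nat) (f fu fr : R -> R -> R) :
  C2 f -> duv f fu -> drv f fr -> Ck2 k fu -> Ck2 k fr -> Ck2 (S k) f.
Proof.
  intros Hf Hu Hr HCu HCr; split; [apply C2_continuous2, Hf|].
  exists fu, fr; split; [|split; [|split]]; auto; intros u r; apply is_derive_Reals; [apply Hu|apply Hr].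
Qed.

Lemma Ck2_elim (k : nat) (f : R -> R -> R) : Ck2 (S k) f ->
  exists fu fr, duv f fu /\ drv f fr /\ Ck2 k fu /\ Ck2 k fr.
Proof.
  intros (_ & fu & fr & Hu & Hr & HCu & HCr). exists fu, fr; split; [|split; [|split]]; auto;
  intros u r; apply is_derive_Reals; auto.
Qed.

Lemma Ck2_C2 (k : nat) (f : R -> R -> R) : Ck2 k f -> C2 f.
Proof. destruct k; intros H; apply C2_continuous2; [exact H|apply H]. Qed.

Lemma Ck2_weaken (k : nat) : forall f, Ck2 (S k) f -> Ck2 k f.
Proof.
  induction k as [|k IH]; intros f H; [apply H|].
  assert (Hc := Ck2_C2 _ _ H). destruct (Ck2_elim _ _ H) as (fu & fr & Hu & Hr & HCu & HCr).
  apply (Ck2_intro k f fu fr); auto.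
Qed.

Lemma duv_plus f fu g gu : duv f fu -> duv g gu -> duv (fun u r => f u r + g u r) (fun u r => fu u r + gu u r).
Proof. intros Hf Hg u r. apply (is_derive_plus (fun v => f v r) (fun v => g v r)); auto. Qed.
Lemma drv_plus f fu g gu : drv f fu -> drv g gu -> drv (fun u r => f u r + g u r) (fun u r => fu u r + gu u r).
Proof. intros Hf Hg u r. apply (is_derive_plus (f u) (g u)); auto. Qed.
Lemma duv_mult f fu g gu : duv f fu -> duv g gu ->
  duv (fun u r => f u r * g u r) (fun u r => fu u r * g u r + f u r * gu u r).
Proof. intros Hf Hg u r. apply (is_derive_mult (fun v => f v r) (fun v => g v r)); auto. intros; apply Rmult_comm. Qed.
Lemma drv_mult f fu g gu : drv f fu -> drv g gu ->
  drv (fun u r => f u r * g u r) (fun u r => fu u r * g u r + f u r * gu u r).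
Proof. intros Hf Hg u r. apply (is_derive_mult (f u) (g u)); auto. intros; apply Rmult_comm. Qed.
Lemma duv_exp f fu : duv f fu -> duv (fun u r => exp (f u r)) (fun u r => fu u r * exp (f u r)).
Proof. intros Hf u r. apply (is_derive_comp exp (fun v => f v r)); auto using is_derive_exp. Qed.
Lemma drv_exp f fu : drv f fu -> drv (fun u r => exp (f u r)) (fun u r => fu u r * exp (f u r)).
Proof. intros Hf u r. apply (is_derive_comp exp (f u)); auto using is_derive_exp. Qed.

Lemma is_derive_constR (c x : R) : is_derive (fun _ : R => c) x 0.
Proof. apply (@is_derive_const R_AbsRing R_NormedModule). Qed.

Lemma Ck2_const (k : nat) : forall c, Ck2 k (fun _ _ => c).
Proof.
  induction k as [|k IH]; intros c.
  - apply C2_continuous2. intros x; apply continuous_const.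
  - apply (Ck2_intro k _ (fun _ _ => 0) (fun _ _ => 0)); auto.
    + intros x; apply continuous_const.
    + intros u r; apply is_derive_constR.
    + intros u r; apply is_derive_constR.
Qed.

Lemma Ck2_plus (k : nat) : forall f g, Ck2 k f -> Ck2 k g -> Ck2 k (fun u r => f u r + g u r).
Proof.
  induction k as [|k IH]; intros f g Hf Hg; assert (cf := Ck2_C2 _ _ Hf); assert (cg := Ck2_C2 _ _ Hg).
  - apply C2_continuous2. apply cont_plus; auto.
  - destruct (Ck2_elim _ _ Hf) as (fu & fr & Hu & Hr & HCu & HCr).
    destruct (Ck2_elim _ _ Hg) as (gu & gr & Gu & Gr & GCu & GCr).
    apply (Ck2_intro k _ _ _ (cont_plus _ _ cf cg) (duv_plus _ _ _ _ Hu Gu) (drv_plus _ _ _ _ Hr Gr)); auto.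
Qed.

Lemma Ck2_mult (k : nat) : forall f g, Ck2 k f -> Ck2 k g -> Ck2 k (fun u r => f u r * g u r).
Proof.
  induction k as [|k IH]; intros f g Hf Hg; assert (cf := Ck2_C2 _ _ Hf); assert (cg := Ck2_C2 _ _ Hg).
  - apply C2_continuous2. apply cont_mult; auto.
  - destruct (Ck2_elim _ _ Hf) as (fu & fr & Hu & Hr & HCu & HCr).
    destruct (Ck2_elim _ _ Hg) as (gu & gr & Gu & Gr & GCu & GCr).
    apply Ck2_weaken in Hf. apply Ck2_weaken in Hg.
    apply (Ck2_intro k _ _ _ (cont_mult _ _ cf cg) (duv_mult _ _ _ _ Hu Gu) (drv_mult _ _ _ _ Hr Gr));
      apply Ck2_plus; apply IH; auto.
Qed.

Lemma Ck2_exp (k : nat) : forall f, Ck2 k f -> Ck2 k (fun u r => exp (f u r)).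
Proof.
  induction k as [|k IH]; intros f Hf; assert (cf := Ck2_C2 _ _ Hf).
  - apply C2_continuous2. apply (cont_exp (fun p : R * R => f (fst p) (snd p))); auto.
  - destruct (Ck2_elim _ _ Hf) as (fu & fr & Hu & Hr & HCu & HCr). apply Ck2_weaken in Hf.
    apply (Ck2_intro k _ _ _ (cont_exp _ cf) (duv_exp _ _ Hu) (drv_exp _ _ Hr)); apply Ck2_mult; auto.
Qed.

Lemma C2_LopArg (j : nat) f : C2 f -> forall a, C2 (fun u t => t ^ j * f u (t * a)).
Proof.
  intros Hf a. unfold C2. apply (cont_mult (fun p : R * R => snd p ^ j)); [conts|].
  apply (C2_comp f fst (fun p => snd p * a)); auto; conts.
Qed.

Lemma C2_Lop (j : nat) f : C2 f -> C2 (fun u r => Lop j (f u) r).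
Proof.
  intros Hf. unfold C2, Lop.
  apply (cont_RInt_param (fun q : (R * R) * R => snd q ^ j * f (fst (fst q)) (snd q * snd (fst q)))).
  assert (H1 : cont (fun q : (R * R) * R => fst (fst q)))
    by (apply (cont_comp (@fst (R * R) R) fst); exact cont_fst).
  assert (H2 : cont (fun q : (R * R) * R => snd (fst q)))
    by (apply (cont_comp (@fst (R * R) R) snd); [exact cont_fst|exact cont_snd]).
  apply (cont_mult (fun q : (R * R) * R => snd q ^ j)); [conts|].
  apply (C2_comp f); auto. conts.
Qed.

Lemma drv_Lop (j : nat) f fr : drv f fr -> C2 fr -> drv (fun u r => Lop j (f u) r) (fun u r => Lop (S j) (fr u) r).
Proof. intros Hr Hc u r. apply Lop_derive; auto. apply C2_sl; auto. Qed.

Lemma duv_Lop (j : nat) f fu : C2 f -> duv f fu -> C2 fu -> duv (fun u r => Lop j (f u) r) (fun u r => Lop j (fu u) r).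
Proof.
  intros Hf Hu Hc u r.
  apply (is_derive_RInt_par (fun v t => t ^ j * f v (t * r)) (fun v t => t ^ j * fu v (t * r))).
  - intros x t. apply (is_derive_scal (fun v => f v (t * r))). apply Hu.
  - apply C2_LopArg; auto.
  - intros y. apply (C2_sl (fun u t => t ^ j * f u (t * r))), C2_LopArg; auto.
Qed.

Lemma Ck2_Lop (k : nat) : forall j f, Ck2 k f -> Ck2 k (fun u r => Lop j (f u) r).
Proof.
  induction k as [|k IH]; intros j f Hf; assert (cf := Ck2_C2 _ _ Hf).
  - apply C2_continuous2, C2_Lop; auto.
  - destruct (Ck2_elim _ _ Hf) as (fu & fr & Hu & Hr & HCu & HCr).
    assert (cu := Ck2_C2 _ _ HCu). assert (cr := Ck2_C2 _ _ HCr).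
    apply (Ck2_intro k _ _ _ (C2_Lop j f cf) (duv_Lop j _ _ cf Hu cu) (drv_Lop j _ _ Hr cr)); apply IH; auto.
Qed.

Lemma Ck1_cont (k : nat) f : Ck1 k f -> cont f.
Proof.
  destruct k as [|k]; [intros H x; apply continuity_pt_filterlim, H|].
  intros (g & Hg & _). apply (cont_derive f g). intros x; apply is_derive_Reals; auto.
Qed.

Lemma C2_r f : cont f -> C2 (fun _ r => f r).
Proof. intros Hf. apply (cont_comp snd f); auto. exact cont_snd. Qed.
Lemma C2_u f : cont f -> C2 (fun u _ => f u).
Proof. intros Hf. apply (cont_comp fst f); auto. exact cont_fst. Qed.

Lemma Ck2_r (k : nat) : forall f, Ck1 k f -> Ck2 k (fun _ r => f r).
Proof.
  induction k as [|k IH]; intros f Hf; assert (cf := Ck1_cont _ _ Hf).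
  - apply C2_continuous2, C2_r; auto.
  - destruct Hf as (g & Hg & HC). apply (Ck2_intro k _ (fun _ _ => 0) (fun _ r => g r)); auto using Ck2_const, C2_r.
    + intros u r; apply is_derive_constR.
    + intros u r; apply is_derive_Reals; auto.
Qed.

Lemma Ck2_u (k : nat) : forall f, Ck1 k f -> Ck2 k (fun u _ => f u).
Proof.
  induction k as [|k IH]; intros f Hf; assert (cf := Ck1_cont _ _ Hf).
  - apply C2_continuous2, C2_u; auto.
  - destruct Hf as (g & Hg & HC). apply (Ck2_intro k _ (fun u _ => g u) (fun _ _ => 0)); auto using Ck2_const, C2_u.
    + intros u r; apply is_derive_Reals; auto.
    + intros u r; apply is_derive_constR.
Qed.

(* n derivatives in r, all of class Ck2 j: regularity in r is obtained first, then traded for regularity in u. *)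
Fixpoint Rdiff (j n : nat) (f : R -> R -> R) : Prop :=
  Ck2 j f /\ match n with O => True | S n' => exists fr, drv f fr /\ Rdiff j n' fr end.

Lemma Rdiff_Ck2 j n f : Rdiff j n f -> Ck2 j f.
Proof. destruct n; intros H; apply H. Qed.

Lemma Rdiff_intro j n f fr : Ck2 j f -> drv f fr -> Rdiff j n fr -> Rdiff j (S n) f.
Proof. intros Hf Hd Hr; split; auto. exists fr; auto. Qed.

Lemma Rdiff_weaken j n : forall f, Rdiff j (S n) f -> Rdiff j n f.
Proof.
  induction n as [|n IH]; intros f [Hf (fr & Hd & Hr)].
  - split; auto.
  - apply (Rdiff_intro j n f fr); auto.
Qed.

Lemma drv_unique f fr gr : drv f fr -> drv f gr -> fr = gr.
Proof. intros H1 H2; apply fun2_ext; intros u r. rewrite <- (is_derive_unique _ _ _ (H1 u r)). apply is_derive_unique, H2. Qed.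

Lemma Rdiff_drv j n f fr : Rdiff j (S n) f -> drv f fr -> Rdiff j n fr.
Proof. intros [_ (gr & Hg & H)] Hf. rewrite (drv_unique f fr gr); auto. Qed.

Lemma Rdiff_const j n : forall c, Rdiff j n (fun _ _ => c).
Proof.
  induction n as [|n IH]; intros c; [split; auto; apply Ck2_const|].
  apply (Rdiff_intro j n _ (fun _ _ => 0)); auto using Ck2_const. intros u r; apply is_derive_constR.
Qed.

Lemma Rdiff_u j n f : Ck1 j f -> Rdiff j n (fun u _ => f u).
Proof.
  intros Hf; destruct n as [|n]; [split; auto; apply Ck2_u; auto|].
  apply (Rdiff_intro j n _ (fun _ _ => 0)); auto using Ck2_u, Rdiff_const. intros u r; apply is_derive_constR.
Qed.

Lemma Ck1_weaken (k : nat) : forall f, Ck1 (S k) f -> Ck1 k f.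
Proof.
  induction k as [|k IH]; intros f Hf.
  - intros x; apply continuity_pt_filterlim, (Ck1_cont _ _ Hf).
  - destruct Hf as (g & Hg & HC). exists g; split; auto.
Qed.

Lemma Ck1_le (k m : nat) f : (m <= k)%nat -> Ck1 k f -> Ck1 m f.
Proof. intros H; induction H; auto. intros Hf; apply IHle, Ck1_weaken, Hf. Qed.

Lemma Rdiff_r j n : forall f, Ck1 (j + n) f -> Rdiff j n (fun _ r => f r).
Proof.
  induction n as [|n IH]; intros f Hf.
  - split; auto. apply Ck2_r. rewrite Nat.add_0_r in Hf; auto.
  - assert (Hj : Ck1 j f) by (apply Ck1_le with (2 := Hf); lia).
    rewrite Nat.add_succ_r in Hf. destruct Hf as (g & Hg & HC).
    apply (Rdiff_intro j n _ (fun _ r => g r)); auto using Ck2_r.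
    intros u r; apply is_derive_Reals; auto.
Qed.

Lemma Rdiff_plus j n : forall f g, Rdiff j n f -> Rdiff j n g -> Rdiff j n (fun u r => f u r + g u r).
Proof.
  induction n as [|n IH]; intros f g [Hf Hf'] [Hg Hg']; [split; auto using Ck2_plus|].
  destruct Hf' as (fr & Df & Rf), Hg' as (gr & Dg & Rg).
  apply (Rdiff_intro j n _ _ (Ck2_plus j f g Hf Hg) (drv_plus _ _ _ _ Df Dg)); auto.
Qed.

Lemma Rdiff_mult j n : forall f g, Rdiff j n f -> Rdiff j n g -> Rdiff j n (fun u r => f u r * g u r).
Proof.
  induction n as [|n IH]; intros f g Hf Hg; assert (Wf := Hf); assert (Wg := Hg);
    destruct Hf as [Hf Hf'], Hg as [Hg Hg']; [split; auto using Ck2_mult|].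
  destruct Hf' as (fr & Df & Rf), Hg' as (gr & Dg & Rg).
  apply Rdiff_weaken in Wf. apply Rdiff_weaken in Wg.
  apply (Rdiff_intro j n _ _ (Ck2_mult j f g Hf Hg) (drv_mult _ _ _ _ Df Dg)). apply Rdiff_plus; auto.
Qed.

Lemma Rdiff_scal j n c f : Rdiff j n f -> Rdiff j n (fun u r => c * f u r).
Proof. intros Hf; apply (Rdiff_mult j n (fun _ _ => c)); auto using Rdiff_const. Qed.

Lemma Rdiff_minus j n f g : Rdiff j n f -> Rdiff j n g -> Rdiff j n (fun u r => f u r - g u r).
Proof.
  intros Hf Hg. replace (fun u r => f u r - g u r) with (fun u r => f u r + (-1) * g u r).
  - apply Rdiff_plus; auto. apply Rdiff_scal; auto.
  - apply fun2_ext; intros; ring.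
Qed.

Lemma Rdiff_exp j n : forall f, Rdiff j n f -> Rdiff j n (fun u r => exp (f u r)).
Proof.
  induction n as [|n IH]; intros f Hf; assert (Wf := Hf); destruct Hf as [Hf Hf']; [split; auto using Ck2_exp|].
  destruct Hf' as (fr & Df & Rf). apply Rdiff_weaken in Wf.
  apply (Rdiff_intro j n _ _ (Ck2_exp j f Hf) (drv_exp _ _ Df)). apply Rdiff_mult; auto.
Qed.

Lemma Rdiff_Lop j n : forall i f, Rdiff j n f -> Rdiff j n (fun u r => Lop i (f u) r).
Proof.
  induction n as [|n IH]; intros i f [Hf Hf']; [split; auto using Ck2_Lop|].
  destruct Hf' as (fr & Df & Rf).
  apply (Rdiff_intro j n _ _ (Ck2_Lop j i f Hf) (drv_Lop i _ _ Df (Ck2_C2 _ _ (Rdiff_Ck2 _ _ _ Rf)))). apply IH; auto.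
Qed.

Lemma Ck1_id (k : nat) : Ck1 k (fun r => r).
Proof.
  destruct k as [|k]; [intros x; apply continuity_pt_id|].
  exists (fun _ => 1); split; [intros; apply derivable_pt_lim_id|].
  assert (H : forall m c, Ck1 m (fun _ => c)).
  { induction m as [|m IH]; intros c; [intros x; apply continuity_pt_const; intros ? ?; reflexivity|].
    exists (fun _ => 0); split; auto. intros; apply derivable_pt_lim_const. }
  apply H.
Qed.

Lemma Rdiff_id j n : Rdiff j n (fun _ r => r).
Proof. apply (Rdiff_r j n (fun r => r)), Ck1_id. Qed.

(* [a] is merely Ck2 j with n derivatives, but [r a] has one more: the typical case is a = (g - avg g)/r. *)
Definition Vn (j n : nat) (a : R -> R -> R) : Prop := Rdiff j n a /\ Rdiff j (S n) (fun u r => r * a u r).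

(** Away from 0, r a b = (r a)(r b)/r. At 0 the difference quotient of y c(y) is c(y), so continuity
    of c alone gives the derivative c(0), and there al = a and be = b. *)
Lemma drv_prod_r (a b al be : R -> R -> R) : C2 a -> C2 b ->
  drv (fun u r => r * a u r) al -> drv (fun u r => r * b u r) be ->
  drv (fun u r => r * (a u r * b u r)) (fun u r => al u r * b u r + a u r * be u r - a u r * b u r).
Proof.
  intros Ca Cb Ha Hb u r.
  assert (At0 : forall c, C2 c -> is_derive (fun y => y * c u y) 0 (c u 0)).
  { intros c Hc. apply is_derive_eps; intros eps He.
    destruct (proj1 (cont_eps _) (C2_sl c u Hc) 0 eps He) as [d Hd].
    exists d; split; [apply cond_pos|]. intros y Hy.
    replace (y * c u y - 0 * c u 0 - (y - 0) * c u 0) with ((c u y - c u 0) * (y - 0)) by ring.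
    rewrite Rabs_mult. apply Rmult_le_compat_r; [apply Rabs_pos|]. left; apply Hd, Hy. }
  destruct (Req_dec r 0) as [->|Hr].
  - assert (Ea : al u 0 = a u 0).
    { rewrite <- (is_derive_unique _ _ _ (Ha u 0)). apply is_derive_unique, At0, Ca. }
    assert (Eb : be u 0 = b u 0).
    { rewrite <- (is_derive_unique _ _ _ (Hb u 0)). apply is_derive_unique, At0, Cb. }
    rewrite Ea, Eb. replace (a u 0 * b u 0 + a u 0 * b u 0 - a u 0 * b u 0) with (a u 0 * b u 0) by ring.
    apply (At0 (fun u r => a u r * b u r)). apply cont_mult; auto.
  - apply (is_derive_ext_loc (fun y => (y * a u y) * (y * b u y) / y)).
    + assert (H0 : 0 < Rabs r) by (apply Rabs_pos_lt; auto).
      exists (mkposreal _ H0). intros y Hy. change (Rabs (y - r) < Rabs r) in Hy.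
      eqR. field. intros ->. rewrite Rminus_0_l, Rabs_Ropp in Hy; lra.
    + replace (al u r * b u r + a u r * be u r - a u r * b u r) with
       (((al u r * (r * b u r) + (r * a u r) * be u r) * r - (r * a u r) * (r * b u r) * 1) / r ^ 2) by (field; auto).
      apply (is_derive_div (fun y => (y * a u y) * (y * b u y)) (fun y => y)); auto.
      * apply (is_derive_mult (fun y => y * a u y) (fun y => y * b u y)); [apply (Ha u)|apply (Hb u)|intros; apply Rmult_comm].
      * apply (@is_derive_id R_AbsRing).
Qed.

Lemma Vn_prod j n a b : Vn j n a -> Vn j n b -> Rdiff j (S n) (fun u r => r * (a u r * b u r)).
Proof.
  intros [Ra Ha] [Rb Hb].
  assert (Ca := Rdiff_Ck2 _ _ _ Ra). assert (Cb := Rdiff_Ck2 _ _ _ Rb).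
  destruct Ha as [Ka (al & Da & Ral)], Hb as [Kb (be & Db & Rbe)].
  apply (Rdiff_intro j n _ (fun u r => al u r * b u r + a u r * be u r - a u r * b u r)).
  - apply (Ck2_mult j (fun _ r => r)); [apply (Ck2_r j (fun r => r)), Ck1_id|apply Ck2_mult; auto].
  - apply drv_prod_r; auto; apply (Ck2_C2 j); auto.
  - apply Rdiff_minus; [apply Rdiff_plus|]; apply Rdiff_mult; auto.
Qed.

Lemma Vn_scal j n c a : Vn j n a -> Vn j n (fun u r => c * a u r).
Proof.
  intros [H1 H2]; split; [apply Rdiff_scal; auto|].
  replace (fun u r => r * (c * a u r)) with (fun u r => c * (r * a u r)) by (apply fun2_ext; intros; ring).
  apply Rdiff_scal; auto.
Qed.

Lemma Vn_minus j n a b : Vn j n a -> Vn j n b -> Vn j n (fun u r => a u r - b u r).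
Proof.
  intros [H1 H2] [H3 H4]; split; [apply Rdiff_minus; auto|].
  replace (fun u r => r * (a u r - b u r)) with (fun u r => r * a u r - r * b u r) by (apply fun2_ext; intros; ring).
  apply Rdiff_minus; auto.
Qed.

(** * Regularity of the slice operators *)

Section OpsReg.
Variables (kap Lam : R) (chi : R -> R) (j n : nat) (h : R -> R -> R).
Hypothesis Hchi : Ck1 (j + S n) chi.
Hypothesis Hh : Rdiff j (S n) h.

Let Rchi : Rdiff j (S n) (fun _ r => chi r) := Rdiff_r j (S n) chi Hchi.
Let cchi : cont chi := Ck1_cont _ _ Hchi.
Let ch u : cont (h u) := C2_sl h u (Ck2_C2 _ _ (Rdiff_Ck2 _ _ _ Hh)).

(** The witness is [Lop 1] of h_r, the regular version of [qv]; the two may differ at r = 0, where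
    [qv] is 0 by convention. *)
Lemma q_reg : exists q, Vn j n q /\ forall u r, r * q u r = Dv (h u) r.
Proof.
  destruct Hh as [Ch (hr & Dh & Rh)]. exists (fun u r => Lop 1 (hr u) r).
  assert (E : forall u r, r * Lop 1 (hr u) r = Dv (h u) r).
  { intros u r. unfold Dv. apply Lop1_prim; [apply Dh|]. apply C2_sl, (Ck2_C2 j), (Rdiff_Ck2 j n), Rh. }
  split; auto. split; [apply Rdiff_Lop; auto|].
  replace (fun u r => r * Lop 1 (hr u) r) with (fun u r => h u r - Lop 0 (h u) r)
    by (apply fun2_ext; intros; rewrite E; reflexivity).
  apply Rdiff_minus; auto. apply Rdiff_Lop; auto.
Qed.

Lemma Qv_eq q u r : r * q = Dv (h u) r -> Qv (h u) r = r * (q * q).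
Proof.
  intros E. unfold Qv, qv. destruct (Req_dec r 0) as [->|Hr].
  - rewrite <- E; lra.
  - rewrite <- E; field; auto.
Qed.

Lemma Dv_reg : Rdiff j (S n) (fun u r => Dv (h u) r).
Proof. unfold Dv. apply Rdiff_minus; auto. apply Rdiff_Lop; auto. Qed.

Lemma Qv_reg : Rdiff j (S n) (fun u r => Qv (h u) r).
Proof.
  destruct q_reg as (q & Vq & Eq).
  replace (fun u r => Qv (h u) r) with (fun u r => r * (q u r * q u r))
    by (apply fun2_ext; intros; symmetry; apply Qv_eq; auto).
  apply Vn_prod; auto.
Qed.

Lemma Ev_reg : Rdiff j (S n) (fun u r => Ev kap chi (h u) r).
Proof.
  unfold Ev. apply Rdiff_scal, Rdiff_mult; [apply Rdiff_id|].
  apply (Rdiff_Lop j (S n) 0 (fun u s => chi s * Qv (h u) s)). apply Rdiff_mult; auto using Qv_reg.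
Qed.

Lemma wv_reg : Rdiff j (S n) (fun _ r => wv Lam chi r).
Proof.
  unfold wv. apply Rdiff_minus; [apply Rdiff_const|]. apply Rdiff_scal, Rdiff_mult; [apply Rdiff_id|].
  apply (Rdiff_Lop j (S n) 0 (fun _ s => s * chi s)). apply Rdiff_mult; auto using Rdiff_id.
Qed.

Lemma Fv_reg : Rdiff j (S n) (fun u r => Fv kap Lam chi (h u) r).
Proof. apply Rdiff_mult; [apply Rdiff_exp, Ev_reg|apply wv_reg]. Qed.

Lemma Phiv_reg : Rdiff j (S n) (fun u r => Phiv kap Lam chi (h u) r).
Proof.
  unfold Phiv. apply (Rdiff_mult j (S n) (fun _ r => chi r)); auto. apply Rdiff_mult; [apply Rdiff_exp, Ev_reg|].
  apply Rdiff_minus.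
  - apply (Rdiff_mult j (S n) (fun _ r => kap / 2 * wv Lam chi r)); [apply Rdiff_scal, wv_reg|apply Qv_reg].
  - apply Rdiff_scal, Rdiff_id.
Qed.

Lemma Av_reg : Rdiff j (S n) (fun u r => Av kap Lam chi (h u) r).
Proof.
  replace (fun u r => Av kap Lam chi (h u) r) with (fun u r => / 2 * Lop 0 (Fv kap Lam chi (h u)) r)
    by (apply fun2_ext; intros; unfold Av; field).
  apply Rdiff_scal, (Rdiff_Lop j (S n) 0 (fun u r => Fv kap Lam chi (h u) r)), Fv_reg.
Qed.

Lemma Gv_reg : Rdiff j (S n) (fun u r => Gv kap Lam chi (h u) r).
Proof.
  replace (fun u r => Gv kap Lam chi (h u) r) with (fun u r => / 2 * Lop 1 (Phiv kap Lam chi (h u)) r)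
    by (apply fun2_ext; intros; unfold Gv; field).
  apply Rdiff_scal, (Rdiff_Lop j (S n) 1 (fun u r => Phiv kap Lam chi (h u) r)), Phiv_reg.
Qed.

Lemma Bv_reg : Rdiff j (S n) (fun u r => Bv kap Lam chi (h u) r).
Proof. apply Rdiff_mult; [apply Gv_reg|apply Dv_reg]. Qed.

(** Here Phi = r phi and 2 G = r [Lop 2] phi, so W = r (phi/2 - 3/2 [Lop 2] phi) q. Each factor has
    one derivative less than h, but [Vn_prod] recovers it through the factor r, and W is as regular
    as h. *)
Lemma Wv_reg : Rdiff j (S n) (fun u r => Wv kap Lam chi (h u) r).
Proof.
  destruct q_reg as (q & Vq & Eq).
  set (phi := fun u r => chi r * (exp (Ev kap chi (h u) r) * (kap / 2 * wv Lam chi r * (q u r * q u r) - 2 * Lam))).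
  assert (Ephi : forall u r, r * phi u r = Phiv kap Lam chi (h u) r).
  { intros u r. unfold phi, Phiv. rewrite (Qv_eq (q u r)) by auto. ring. }
  assert (Rphi : Rdiff j n phi).
  { unfold phi. apply (Rdiff_mult j n (fun _ r => chi r)); [apply Rdiff_weaken; auto|].
    apply Rdiff_mult; [apply Rdiff_weaken, Rdiff_exp, Ev_reg|]. apply Rdiff_minus; [|apply Rdiff_const].
    apply (Rdiff_mult j n (fun _ r => kap / 2 * wv Lam chi r)); [apply Rdiff_scal, Rdiff_weaken, wv_reg|].
    apply Rdiff_mult; apply Vq. }
  assert (V1 : Vn j n phi).
  { split; auto. replace (fun u r => r * phi u r) with (fun u r => Phiv kap Lam chi (h u) r)
      by (apply fun2_ext; intros; auto). apply Phiv_reg. }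
  assert (EL : forall u r, r * Lop 2 (phi u) r = 2 * Gv kap Lam chi (h u) r).
  { intros u r. unfold Gv. replace (2 * (Lop 1 (Phiv kap Lam chi (h u)) r / 2)) with (Lop 1 (Phiv kap Lam chi (h u)) r) by field.
    assert (cp : cont (phi u)) by (apply C2_sl, (Ck2_C2 j), (Rdiff_Ck2 j n), Rphi).
    unfold Lop. rewrite <- RInt_cmul by (apply cont_Lop_arg; auto).
    apply RInt_extR; intros t _. rewrite <- Ephi. simpl; ring. }
  assert (V2 : Vn j n (fun u r => Lop 2 (phi u) r)).
  { split; [apply Rdiff_Lop; auto|].
    replace (fun u r => r * Lop 2 (phi u) r) with (fun u r => 2 * Gv kap Lam chi (h u) r)
      by (apply fun2_ext; intros; auto). apply Rdiff_scal, Gv_reg. }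
  assert (V3 : Vn j n (fun u r => / 2 * phi u r - 3 / 2 * Lop 2 (phi u) r)).
  { apply Vn_minus; apply Vn_scal; auto. }
  replace (fun u r => Wv kap Lam chi (h u) r) with
    (fun u r => r * ((/ 2 * phi u r - 3 / 2 * Lop 2 (phi u) r) * q u r)).
  - apply (Vn_prod j n (fun u r => / 2 * phi u r - 3 / 2 * Lop 2 (phi u) r)); auto.
  - apply fun2_ext; intros u r.
    replace (r * ((/ 2 * phi u r - 3 / 2 * Lop 2 (phi u) r) * q u r)) with
      ((/ 2 * (r * phi u r) - 3 / 2 * (r * Lop 2 (phi u) r)) * q u r) by ring.
    rewrite Ephi, EL. unfold Wv, qv. rewrite <- Eq. destruct (Req_dec r 0) as [->|Hr].
    + rewrite <- Ephi. assert (E0 := EL u 0). rewrite Rmult_0_l in E0.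
      replace (Gv kap Lam chi (h u) 0) with 0 by lra. lra.
    + field; auto.
Qed.
End OpsReg.

(** * Bootstrap along the characteristics, then in time *)

Lemma Rdiff0_C2 n f : Rdiff 0 n f -> C2 f.
Proof. intros H; apply (Ck2_C2 0), (Rdiff_Ck2 0 n), H. Qed.

Lemma Rdiff0_S n f fr : C2 f -> drv f fr -> Rdiff 0 n fr -> Rdiff 0 (S n) f.
Proof. intros H; apply Rdiff_intro. apply C2_continuous2, H. Qed.

Lemma Rdiff0_O f : C2 f -> Rdiff 0 0 f.
Proof. intros H; split; auto. apply C2_continuous2, H. Qed.

Lemma C2_comp2 f g : C2 f -> C2 g -> C2 (fun u r => f u (g u r)).
Proof. intros Hf Hg. apply (C2_comp f fst (fun p => g (fst p) (snd p))); auto; conts. Qed.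

(** Compositions, inverses and time integrals are treated for j = 0 only: they enter the radial
    bootstrap, where continuity in u is enough. *)
Lemma Rdiff_comp n : forall f g, Rdiff 0 n f -> Rdiff 0 n g -> Rdiff 0 n (fun u r => f u (g u r)).
Proof.
  induction n as [|n IH]; intros f g Hf Hg; assert (cf := Rdiff0_C2 _ _ Hf); assert (cg := Rdiff0_C2 _ _ Hg).
  - apply Rdiff0_O, C2_comp2; auto.
  - assert (Wg := Rdiff_weaken _ _ _ Hg). destruct Hf as [_ (fr & Df & Rf)], Hg as [_ (gr & Dg & Rg)].
    apply (Rdiff0_S n _ (fun u r => gr u r * fr u (g u r))); [apply C2_comp2; auto| |apply Rdiff_mult; auto].
    intros u r. apply (is_derive_comp (f u) (g u)); auto.
Qed.

Lemma Rdiff_inv n : forall f, (forall u r, f u r <> 0) -> Rdiff 0 n f -> Rdiff 0 n (fun u r => / f u r).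
Proof.
  intros f H0; induction n as [|n IH]; intros Hf; assert (cf := Rdiff0_C2 _ _ Hf);
    assert (ci : C2 (fun u r => / f u r)) by (apply cont_inv; auto).
  - apply Rdiff0_O; auto.
  - assert (Wf := Rdiff_weaken _ _ _ Hf). destruct Hf as [_ (fr & Df & Rf)].
    apply (Rdiff0_S n _ (fun u r => (-1) * fr u r * (/ f u r * / f u r))); auto.
    + intros u r. replace (-1 * fr u r * (/ f u r * / f u r)) with (- fr u r / f u r ^ 2) by (field; auto).
      apply (is_derive_inv (f u)); auto.
    + apply Rdiff_mult; [apply Rdiff_scal; auto|apply Rdiff_mult; auto].
Qed.

Lemma drv_Top th f fr : cont th -> C2 f -> drv f fr -> C2 fr ->
  drv (fun u r => Top th (fun s => f s r) u) (fun u r => Top th (fun s => fr s r) u).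
Proof.
  intros Ht Hf Hd Hr u r.
  apply (is_derive_RInt_par (fun r s => th s * f s r) (fun r s => th s * fr s r)).
  - intros x t. apply (is_derive_scal (f t)), Hd.
  - unfold C2. apply (cont_mult (fun p : R * R => th (snd p))).
    + apply (cont_comp snd th); auto. exact cont_snd.
    + apply (C2_comp fr snd fst); auto; conts.
  - intros y. assert (H := C2_su f y Hf). conts.
Qed.

Lemma Rdiff_Top th n : cont th -> forall f, Rdiff 0 n f -> Rdiff 0 n (fun u r => Top th (fun s => f s r) u).
Proof.
  intros Ht; induction n as [|n IH]; intros f Hf; assert (cf := Rdiff0_C2 _ _ Hf).
  - apply Rdiff0_O, C2_Top; auto.
  - destruct Hf as [_ (fr & Df & Rf)].
    apply (Rdiff0_S n _ (fun u r => Top th (fun s => fr s r) u)); auto using C2_Top.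
    apply drv_Top; auto. apply (Rdiff0_C2 n); auto.
Qed.

(** Differentiate f(u, r) = f(0, r) + integral of fu over [0, u] in r under the integral sign, then
    in u. Only one of the two mixed derivatives is assumed to exist. *)
Lemma swap_derivatives f fu fr g : duv f fu -> drv f fr -> drv fu g -> C2 fu -> C2 g -> duv fr g.
Proof.
  intros Hu Hr Hg Cu Cg.
  assert (E : forall u r, fr u r = fr 0 r + RInt (fun s => g s r) 0 u).
  { intros u r. rewrite <- (is_derive_unique _ _ _ (Hr u r)). apply is_derive_unique.
    apply (is_derive_ext (fun r => f 0 r + RInt (fun s => fu s r) 0 u)).
    - intros t. rewrite (RInt_FTC (fun v => f v t)); [eqR; ring|intros x; apply Hu|apply C2_su; auto].
    - apply (is_derive_plus (f 0) (fun r => RInt (fun s => fu s r) 0 u)); [apply Hr|].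
      apply (is_derive_RInt_par (fun r s => fu s r) (fun r s => g s r)).
      + intros x t; apply Hg.
      + apply (C2_comp g snd fst); auto; conts.
      + intros y; apply C2_su; auto. }
  intros u r. apply (is_derive_ext (fun v => fr 0 r + RInt (fun s => g s r) 0 v)); [intros; symmetry; apply E|].
  replace (g u r) with (0 + g u r) by ring.
  apply (is_derive_plus (fun _ => fr 0 r) (fun v => RInt (fun s => g s r) 0 v)); [apply is_derive_constR|].
  apply (is_derive_prim (fun s => g s r)), C2_su; auto.
Qed.

(** The induction on n passes to f_r, whose u-derivative is the r-derivative of [fu] by
    [swap_derivatives]. *)
Lemma joint_step j n : forall f fu, Rdiff j (S n) f -> duv f fu -> Rdiff j n fu -> Rdiff (S j) n f.
Proof.
  induction n as [|n IH]; intros f fu Hf Hu Hfu.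
  - destruct Hf as [Cf (fr & Dr & Rr)]. split; auto.
    apply (Ck2_intro j f fu fr); auto; [apply (Ck2_C2 j); auto|apply (Rdiff_Ck2 j 0); auto|apply (Rdiff_Ck2 j 0); auto].
  - destruct Hf as [Cf (fr & Dr & Rr)].
    apply (Rdiff_intro (S j) n f fr); auto.
    + apply (Ck2_intro j f fu fr); auto; [apply (Ck2_C2 j); auto|apply (Rdiff_Ck2 j (S n)); auto|apply (Rdiff_Ck2 j (S n)); auto].
    + destruct Hfu as [Cfu (g & Dg & Rg)]. apply (IH fr g); auto.
      apply (swap_derivatives f fu fr g); auto; [apply (Ck2_C2 j); auto|apply (Ck2_C2 j), (Rdiff_Ck2 j n); auto].
Qed.

Lemma Rdiff_le j n m f : (m <= n)%nat -> Rdiff j n f -> Rdiff j m f.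
Proof. intros H; induction H; auto. intros Hf; apply IHle, Rdiff_weaken, Hf. Qed.

Section SolReg.
Variables (kap Lam : R) (chi th dH0 : R -> R) (k : nat).
Variables (h p X Y Z I : R -> R -> R).
Hypothesis Hchi : Ck1 (S k) chi.
Hypothesis Hth : Ck1 (S k) th.
Hypothesis HdH0 : Ck1 k dH0.
Hypothesis Ch : C2 h.
Hypothesis Cp : C2 p.
Hypothesis CX : C2 X.
Hypothesis CY : C2 Y.
Hypothesis Dh : drv h p.
Hypothesis DX : drv X Z.
Hypothesis DY : drv Y (fun u r => / Z u (Y u r)).
Hypothesis EZ : forall u a, Z u a = exp (- Top th (fun s => Gv kap Lam chi (h s) (X s a)) u).
Hypothesis EI : forall u a, I u a = dH0 a + Top th (fun s => Z s a ^ 2 * Wv kap Lam chi (h s) (X s a)) u.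
Hypothesis Ep : forall u r, p u r = I u (Y u r) / Z u (Y u r) / Z u (Y u r).
Hypothesis Du : duv h (fun u r => th u * (Av kap Lam chi (h u) r * p u r + Bv kap Lam chi (h u) r)).

Let cth : cont th := Ck1_cont _ _ Hth.

Lemma Z_reg n : Rdiff 0 n (fun u r => Gv kap Lam chi (h u) r) -> Rdiff 0 n X -> Rdiff 0 n Z.
Proof.
  intros HG HX. replace Z with (fun u a => exp ((-1) * Top th (fun s => Gv kap Lam chi (h s) (X s a)) u))
    by (apply fun2_ext; intros; rewrite EZ; f_equal; ring).
  apply Rdiff_exp, Rdiff_scal. apply (Rdiff_Top th n cth (fun s a => Gv kap Lam chi (h s) (X s a))).
  apply (Rdiff_comp n (fun u r => Gv kap Lam chi (h u) r)); auto.
Qed.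

Lemma Z_neq u r : Z u r <> 0.
Proof. rewrite EZ. apply Rgt_not_eq, exp_pos. Qed.

(** If h has m + 1 radial derivatives, so have G and W; hence also X, Z, Y and I, and then p = h_r
    by its explicit formula. *)
Lemma radial_reg (m : nat) : (m <= k)%nat -> Rdiff 0 (S m) h.
Proof.
  induction m as [|m IH]; intros Hm.
  - apply (Rdiff0_S 0 h p); auto. apply Rdiff0_O; auto.
  - assert (Hh : Rdiff 0 (S m) h) by (apply IH; lia).
    assert (Hc : Ck1 (0 + S m) chi) by (apply Ck1_le with (2 := Hchi); lia).
    assert (HG := Gv_reg kap Lam chi 0 m h Hc Hh). assert (HW := Wv_reg kap Lam chi 0 m h Hc Hh).
    assert (Gle : forall i, (i <= S m)%nat -> Rdiff 0 i (fun u r => Gv kap Lam chi (h u) r)).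
    { intros i Hi; apply Rdiff_le with (S m); auto. }
    assert (HX : forall i, (i <= S m)%nat -> Rdiff 0 i X).
    { induction i as [|i IHi]; intros Hi; [apply Rdiff0_O; auto|].
      apply (Rdiff0_S i X Z); auto. apply Z_reg; [apply Gle; lia|apply IHi; lia]. }
    assert (HZ : Rdiff 0 (S m) Z) by (apply Z_reg; auto).
    assert (HY : forall i, (i <= S m)%nat -> Rdiff 0 i Y).
    { induction i as [|i IHi]; intros Hi; [apply Rdiff0_O; auto|].
      apply (Rdiff0_S i Y (fun u r => / Z u (Y u r))); auto.
      apply Rdiff_inv; [intros; apply Z_neq|]. apply Rdiff_comp; [apply Rdiff_le with (S m); auto; lia|apply IHi; lia]. }
    assert (HI : Rdiff 0 (S m) I).
    { replace I with (fun u a => dH0 a + Top th (fun s => Z s a * Z s a * Wv kap Lam chi (h s) (X s a)) u).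
      - apply (Rdiff_plus 0 (S m) (fun _ a => dH0 a)); [apply Rdiff_r, Ck1_le with (2 := HdH0); lia|].
        apply (Rdiff_Top th (S m) cth (fun s a => Z s a * Z s a * Wv kap Lam chi (h s) (X s a))).
        apply Rdiff_mult; [apply Rdiff_mult; auto|]. apply (Rdiff_comp (S m) (fun u r => Wv kap Lam chi (h u) r)); auto.
      - apply fun2_ext; intros u a. rewrite EI. f_equal. apply RInt_extR; intros; ring. }
    apply (Rdiff0_S (S m) h p); auto.
    assert (HYm : Rdiff 0 (S m) Y) by auto.
    assert (Hi : Rdiff 0 (S m) (fun u r => / Z u (Y u r))) by (apply Rdiff_inv; [intros; apply Z_neq|apply Rdiff_comp; auto]).
    replace p with (fun u r => I u (Y u r) * / Z u (Y u r) * / Z u (Y u r)) by (apply fun2_ext; intros; rewrite Ep; reflexivity).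
    apply Rdiff_mult; auto. apply Rdiff_mult; auto. apply Rdiff_comp; auto.
Qed.

(** The equation expresses h_u by A, B and p at the cost of one radial derivative, so each step
    trades one order in r for one joint order, the total being S k. *)
Lemma joint_reg (j : nat) : (j <= S k)%nat -> Rdiff j (S k - j) h.
Proof.
  induction j as [|j IH]; intros Hj; [apply radial_reg; lia|].
  assert (Hh : Rdiff j (S k - j) h) by (apply IH; lia).
  replace (S k - j)%nat with (S (k - j))%nat in Hh by lia.
  replace (S k - S j)%nat with (k - j)%nat by lia.
  assert (Hc : Ck1 (j + S (k - j)) chi) by (apply Ck1_le with (2 := Hchi); lia).
  apply (joint_step j (k - j) h _ Hh Du).
  apply (Rdiff_mult j (k - j) (fun u _ => th u)); [apply Rdiff_u, Ck1_le with (2 := Hth); lia|].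
  apply Rdiff_plus; [apply Rdiff_mult|].
  - apply Rdiff_weaken, Av_reg; auto.
  - apply (Rdiff_drv j (k - j) h p); auto.
  - apply Rdiff_weaken, Bv_reg; auto.
Qed.

Lemma solution_Ck2 : Ck2 (S k) h.
Proof. apply (Rdiff_Ck2 (S k) (S k - S k)), joint_reg; lia. Qed.
End SolReg.

(** * Sign conditions, maximum principle and uniqueness *)

Lemma Defs_RInt_eq (f : R -> R) (a b : R) : ex_RInt f a b -> Defs.RInt f a b = RInt f a b.
Proof.
  intros H. unfold Defs.RInt.
  destruct (excluded_middle_informative _) as [E|E].
  - destruct (constructive_indefinite_description _ E) as (I & pr & HI); simpl.
    rewrite <- HI; symmetry; apply RInt_Reals.
  - exfalso; apply E. exists (RiemannInt (ex_RInt_Reals_0 f a b H)), (ex_RInt_Reals_0 f a b H); reflexivity.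
Qed.

(** Agreement on the open interval is enough, and it has to be: the integrands of the problem divide
    by s and take a conventional value at 0. *)
Lemma Defs_RInt_ext (f g : R -> R) (r : R) : 0 <= r -> cont g -> (forall s, 0 < s < r -> f s = g s) ->
  Defs.RInt f 0 r = RInt g 0 r.
Proof.
  intros Hr Hg H. assert (E : forall s, Rmin 0 r < s < Rmax 0 r -> f s = g s).
  { rewrite Rmin_left, Rmax_right by auto; auto. }
  rewrite Defs_RInt_eq.
  - apply RInt_extR; auto.
  - apply (ex_RInt_ext g); [intros; symmetry; auto|apply ex_RInt_cont; auto].
Qed.

(** * The slice operators on [0, R]: original quantities and signs *)

Section Link.
Variables (kap Lam rho Rr : R) (chi : R -> R).
Hypothesis Hkap : 0 < kap.
Hypothesis HLam : 0 < Lam.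
Hypothesis HRr : 0 < Rr.
Hypothesis Hchi : cutoff rho chi.
Hypothesis Hone : forall r, 0 <= r <= Rr -> chi r = 1.

Let chi_cont : cont chi := proj1 Hchi.

Lemma wv_in r : 0 <= r <= Rr -> wv Lam chi r = 1 - Lam * r ^ 2.
Proof.
  intros Hr. unfold wv. rewrite Lop0_RInt by conts.
  rewrite (RInt_extR _ (fun s => s)).
  - rewrite (RInt_FTC (fun s => s ^ 2 / 2)); [field| |apply cont_id].
    intros x. auto_derive; auto; field.
  - rewrite Rmin_left, Rmax_right by lra. intros s Hs; rewrite Hone by lra; ring.
Qed.

Section OneSlice.
Variables (K : R) (g : R -> R).
Hypothesis Hg : Lip K g.

Let K_nonneg : 0 <= K := Lip_K_nonneg K g Hg.
Let gc : cont g := Lip_cont K g Hg.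
Let Qc : cont (Qv g) := Qv_cont K g Hg.
Let EvD : forall r, is_derive (Ev kap chi g) r (kap / 2 * (chi r * Qv g r)) := Ev_derive kap chi rho Hchi K g Hg.
Let Evc : cont (Ev kap chi g) := cont_derive _ _ EvD.
Let Fc : cont (Fv kap Lam chi g) := Fv_cont kap Lam chi rho Hchi K g Hg.

Lemma Qv_nonneg r : 0 <= r -> 0 <= Qv g r.
Proof.
  intros Hr. unfold Qv, qv. destruct Hr as [Hr| <-].
  - apply Rle_trans with (Dv g r * Dv g r / r); [|right; field; lra].
    apply Rdiv_le_0_compat; auto. apply Rle_0_sqr.
  - rewrite Dv_0; auto; lra.
Qed.

Lemma Ev_mono x y : 0 <= x <= y -> Ev kap chi g x <= Ev kap chi g y.
Proof.
  intros Hxy. destruct (MVT_gen (Ev kap chi g) x y (fun r => kap / 2 * (chi r * Qv g r))) as (c & Hc & E).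
  - intros; apply EvD.
  - intros z _; apply continuity_pt_filterlim, Evc.
  - rewrite Rmin_left, Rmax_right in Hc by lra.
    assert (0 <= kap / 2 * (chi c * Qv g c) * (y - x)); [|lra].
    assert (0 <= Qv g c) by (apply Qv_nonneg; lra). destruct (proj1 (proj2 Hchi) c). pos.
Qed.

Lemma Fv_0 : Fv kap Lam chi g 0 = 1.
Proof. unfold Fv, Ev, wv. rewrite !Rmult_0_l, !Rmult_0_r, exp_0; ring. Qed.

Lemma Av_0 : Av kap Lam chi g 0 = / 2.
Proof.
  unfold Av. assert (H := Dv_0 _ Fc). unfold Dv in H. rewrite Fv_0 in H. lra.
Qed.

(* Chebyshev's inequality: exp Ev is nondecreasing while 1 - Lam s^2 decreases through 0 at rc. *)
Lemma Av_R_neg : sqrt (3 / Lam) < Rr -> Av kap Lam chi g Rr < 0.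
Proof.
  intros HR. set (rc := sqrt (/ Lam)).
  assert (Hrc : 0 <= rc) by apply sqrt_pos.
  assert (Hrc2 : Lam * (rc * rc) = 1).
  { unfold rc; rewrite sqrt_sqrt; [field; lra|left; apply Rinv_0_lt_compat; auto]. }
  assert (HR2 : 3 < Lam * (Rr * Rr)).
  { assert (H3 : 0 <= 3 / Lam) by (apply Rdiv_le_0_compat; lra).
    assert (H4 := sqrt_sqrt _ H3). assert (H5 := sqrt_pos (3 / Lam)).
    assert (sqrt (3 / Lam) * sqrt (3 / Lam) < Rr * Rr) by nra.
    rewrite H4 in H. apply (Rmult_lt_compat_l Lam) in H; auto.
    replace (Lam * (3 / Lam)) with 3 in H by (field; lra). lra. }
  assert (E : Rr * Lop 0 (Fv kap Lam chi g) Rr = RInt (Fv kap Lam chi g) 0 Rr) by (apply Lop0_RInt; auto).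
  assert (Hle : RInt (Fv kap Lam chi g) 0 Rr <= RInt (fun s => exp (Ev kap chi g rc) * (1 - Lam * s ^ 2)) 0 Rr).
  { apply RInt_le; [lra|apply ex_RInt_cont; auto|apply ex_RInt_cont; conts|].
    intros s Hs. unfold Fv. rewrite wv_in by lra. replace (s ^ 2) with (s * s) by ring.
    destruct (Rle_dec s rc) as [h|h].
    - apply Rmult_le_compat_r; [|].
      + assert (Lam * (s * s) <= Lam * (rc * rc)) by (apply Rmult_le_compat_l; [lra|nra]). lra.
      + destruct (Ev_mono s rc) as [h'|h']; [lra|left; apply exp_increasing; auto|rewrite h'; lra].
    - assert (Hn : 1 - Lam * (s * s) <= 0).
      { assert (Lam * (rc * rc) <= Lam * (s * s)) by (apply Rmult_le_compat_l; [lra|nra]). lra. }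
      assert (He : exp (Ev kap chi g rc) <= exp (Ev kap chi g s)).
      { destruct (Ev_mono rc s) as [h'|h']; [lra|left; apply exp_increasing; auto|rewrite h'; lra]. }
      nra. }
  assert (Hint : RInt (fun s => exp (Ev kap chi g rc) * (1 - Lam * s ^ 2)) 0 Rr =
     exp (Ev kap chi g rc) * (Rr - Lam * Rr ^ 3 / 3)).
  { rewrite (RInt_FTC (fun s => exp (Ev kap chi g rc) * (s - Lam * s ^ 3 / 3))).
    - simpl; field.
    - intros x. apply (is_derive_scal (fun s => s - Lam * s ^ 3 / 3)). auto_derive; auto; field.
    - conts. }
  assert (Hp := exp_pos (Ev kap chi g rc)).
  assert (Hneg : Rr - Lam * Rr ^ 3 / 3 < 0).
  { replace (Rr - Lam * Rr ^ 3 / 3) with (Rr * (3 - Lam * (Rr * Rr)) / 3) by field. nra. }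
  unfold Av. assert (HL : Rr * Lop 0 (Fv kap Lam chi g) Rr < 0) by nra. nra.
Qed.

(** G is half a weighted average of Phi, and Phi <= 0 on [0, R]: since Q <= K^2 s there, kap/2 (1 -
    Lam s^2) Q <= kap/2 K^2 s <= 2 Lam s. *)
Lemma Gv_nonpos r : kap * (K * K) <= 4 * Lam -> 0 <= r <= Rr -> Gv kap Lam chi g r <= 0.
Proof.
  intros HK Hr. assert (Pc : cont (Phiv kap Lam chi g)) by (apply (Phiv_cont kap Lam chi rho Hchi K); auto).
  assert (HP : forall s, 0 <= s <= Rr -> Phiv kap Lam chi g s <= 0).
  { intros s Hs. unfold Phiv. rewrite Hone, Rmult_1_l by auto. rewrite wv_in by auto.
    assert (Hp := exp_pos (Ev kap chi g s)). assert (HQ := Qv_nonneg s (proj1 Hs)).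
    assert (HQ2 := Qv_bound K g s Hg). rewrite !Rabs_pos_eq in HQ2 by lra.
    assert (kap / 2 * (1 - Lam * s ^ 2) * Qv g s <= 2 * Lam * s).
    { assert (0 <= Lam * s ^ 2) by (apply Rmult_le_pos; [lra|apply pow2_ge_0]).
      apply Rle_trans with (kap / 2 * Qv g s).
      - rewrite Rmult_assoc. apply Rmult_le_compat_l; [lra|]. nra.
      - apply Rle_trans with (kap / 2 * (K * K * s)); [apply Rmult_le_compat_l; lra|].
        replace (kap / 2 * (K * K * s)) with (kap * (K * K) * s / 2) by field. nra. }
    nra. }
  unfold Gv. assert (H : Lop 1 (Phiv kap Lam chi g) r <= RInt (fun _ => 0) 0 1).
  { unfold Lop. apply RInt_le; [lra|apply ex_RInt_cont, cont_Lop_arg; auto|apply ex_RInt_cont, cont_const|].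
    intros t Ht. assert (Phiv kap Lam chi g (t * r) <= 0) by (apply HP; nra).
    destruct (pow01 1 t); [lra|]. nra. }
  rewrite RInt_const in H. change (scal (1 - 0) 0) with ((1 - 0) * 0) in H. lra.
Qed.

Variables (hh : R -> R -> R) (u : R).
Hypothesis Hhg : forall s, 0 <= s <= Rr -> hh u s = g s.

Lemma hbar_link r : 0 < r <= Rr -> hbar hh u r = Lop 0 g r.
Proof.
  intros Hr. unfold hbar, bar. rewrite (Defs_RInt_ext (hh u) g); auto; [|lra|intros; apply Hhg; lra].
  rewrite <- Lop0_RInt by auto. field; lra.
Qed.

Lemma f_link r : 0 <= r <= Rr -> f_of kap hh u r = exp (Ev kap chi g r).
Proof.
  intros Hr. unfold f_of, Ev. rewrite Lop0_RInt by conts. do 2 f_equal.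
  apply Defs_RInt_ext; [lra|conts|]. intros s Hs.
  rewrite hbar_link, Hhg, Hone by lra. unfold Qv, qv, Dv. field; lra.
Qed.

Lemma ftilde_link r : 0 < r <= Rr -> ftilde_of kap Lam hh u r = 2 * Av kap Lam chi g r.
Proof.
  intros Hr. unfold ftilde_of, bar, Av.
  assert (Ec : cont (fun s => exp (Ev kap chi g s))) by conts.
  rewrite (Defs_RInt_ext (f_of kap hh u) (fun s => exp (Ev kap chi g s))); auto; [|lra|intros; apply f_link; lra].
  rewrite (Defs_RInt_ext (fun s => f_of kap hh u s * s ^ 2) (fun s => exp (Ev kap chi g s) * s ^ 2));
    [|lra|conts|intros; rewrite f_link by lra; auto].
  replace (Lop 0 (Fv kap Lam chi g) r) with (/ r * RInt (Fv kap Lam chi g) 0 r)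
    by (rewrite <- Lop0_RInt by auto; field; lra).
  rewrite (RInt_extR (Fv kap Lam chi g) (fun s => exp (Ev kap chi g s) - Lam * (exp (Ev kap chi g s) * s ^ 2))).
  - rewrite <- RInt_sub by conts. rewrite RInt_cmul by conts. field; lra.
  - rewrite Rmin_left, Rmax_right by lra. intros s Hs. unfold Fv. rewrite wv_in by lra. ring.
Qed.

Lemma G_link r : 0 < r <= Rr -> G_of kap Lam hh u r = Gv kap Lam chi g r.
Proof.
  intros Hr. unfold G_of. rewrite ftilde_link, f_link by lra.
  replace (Gv kap Lam chi g r) with (r * Gv kap Lam chi g r / r) by (field; lra).
  rewrite (rGv kap Lam chi rho Hchi K g Hg). unfold Dv, Av.
  replace (Fv kap Lam chi g r) with (exp (Ev kap chi g r) * (1 - Lam * r ^ 2)) by (unfold Fv; rewrite wv_in by lra; ring).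
  field; lra.
Qed.
End OneSlice.
End Link.

(** * Maximum principle *)

(** Maximize in r, then in u. The slice maximum is continuous in u by [tube], although the maximizer
    [m] need not be. *)
Lemma max2d (w : R -> R -> R) (U Rr : R) : C2 w -> 0 <= U -> 0 <= Rr ->
  exists u0 r0, 0 <= u0 <= U /\ 0 <= r0 <= Rr /\
    forall u r, 0 <= u <= U -> 0 <= r <= Rr -> w u r <= w u0 r0.
Proof.
  intros Hw HU HR.
  assert (Hm : forall u, exists m, (forall r, 0 <= r <= Rr -> w u r <= w u m) /\ 0 <= m <= Rr).
  { intros u; apply continuity_ab_maj; auto. intros c _; apply continuity_pt_filterlim, (C2_sl w u Hw). }
  apply choice in Hm. destruct Hm as [m Hm].
  assert (Hg : cont (fun u => w u (m u))).
  { apply cont_eps; intros u eps He. generalize (tube _ 0 Rr u eps Hw He); apply filter_imp.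
    intros v Hv; simpl in Hv.
    assert (H1 := Hv _ (proj2 (Hm u))). assert (H2 := Hv _ (proj2 (Hm v))).
    assert (H3 := proj1 (Hm u) _ (proj2 (Hm v))). assert (H4 := proj1 (Hm v) _ (proj2 (Hm u))).
    revert H1 H2; unfold Rabs; repeat destruct Rcase_abs; lra. }
  destruct (continuity_ab_maj (fun u => w u (m u)) 0 U HU) as (u0 & Hu0 & Hu0').
  { intros c _; apply continuity_pt_filterlim, Hg. }
  exists u0, (m u0). split; auto. split; [apply Hm|].
  intros u r Hu Hr. apply Rle_trans with (w u (m u)); [apply Hm; auto|apply Hu0; auto].
Qed.

Lemma derive_max_left (f : R -> R) (x l d : R) : is_derive f x l -> 0 < d ->
  (forall y, x - d <= y <= x -> f y <= f x) -> 0 <= l.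
Proof.
  intros Hf Hd H. apply Rnot_lt_le; intros Hl.
  destruct (proj1 (is_derive_eps f x l) Hf (- l / 2)) as (e & He & Hy); [lra|].
  set (t := Rmin d e / 2). assert (Ht : 0 < t /\ t <= d /\ t < e).
  { unfold t; generalize (Rmin_l d e) (Rmin_r d e) (Rmin_glb_lt d e 0 Hd He); lra. }
  specialize (Hy (x - t)). replace (x - t - x) with (- t) in Hy by ring.
  rewrite Rabs_Ropp, (Rabs_pos_eq t) in Hy by lra. specialize (Hy ltac:(lra)).
  assert (Hm := Rabs_maj2 (f (x - t) - f x - - t * l)). specialize (H (x - t) ltac:(lra)). nra.
Qed.

Lemma derive_max_right (f : R -> R) (x l d : R) : is_derive f x l -> 0 < d ->
  (forall y, x <= y <= x + d -> f y <= f x) -> l <= 0.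
Proof.
  intros Hf Hd H. apply Rnot_lt_le; intros Hl.
  destruct (proj1 (is_derive_eps f x l) Hf (l / 2)) as (e & He & Hy); [lra|].
  set (t := Rmin d e / 2). assert (Ht : 0 < t /\ t <= d /\ t < e).
  { unfold t; generalize (Rmin_l d e) (Rmin_r d e) (Rmin_glb_lt d e 0 Hd He); lra. }
  specialize (Hy (x + t)). replace (x + t - x) with t in Hy by ring.
  rewrite (Rabs_pos_eq t) in Hy by lra. specialize (Hy ltac:(lra)).
  assert (Hm := Rabs_maj2 (f (x + t) - f x - t * l)). specialize (H (x + t) ltac:(lra)). nra.
Qed.

(* The transport velocity -a points out of [0, Rr] at both ends, so no boundary condition enters. *)
Lemma max_principle (v vu vr a : R -> R -> R) (U Rr L : R) : 0 < U -> 0 < Rr -> 0 <= L ->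
  C2 v -> duv v vu -> drv v vr ->
  (forall u, 0 <= u <= U -> 0 <= a u 0) -> (forall u, 0 <= u <= U -> a u Rr <= 0) ->
  (forall r, 0 <= r <= Rr -> v 0 r <= 0) ->
  (forall u r, 0 <= u <= U -> 0 <= r <= Rr -> 0 < v u r -> (forall r', 0 <= r' <= Rr -> v u r' <= v u r) ->
     vu u r <= a u r * vr u r + L * v u r) ->
  forall u r, 0 <= u <= U -> 0 <= r <= Rr -> v u r <= 0.
Proof.
  intros HU HR HL Cv Du Dr Ha0 HaR Hv0 Hpde u r Hu Hr. apply Rnot_lt_le; intros Hpos.
  (* At a positive maximum of w the weight forces v_u >= (L + 1) v, against v_u <= L v from the
     equation once a v_r <= 0 is known. *)
  set (w := fun u r => exp (- (L + 1) * u) * v u r).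
  assert (Cw : C2 w).
  { apply cont_mult; [|apply Cv]. apply (cont_exp (fun p : R * R => - (L + 1) * fst p)). conts. }
  destruct (max2d w U Rr Cw) as (u0 & r0 & Hu0 & Hr0 & Hmax); try lra.
  assert (Hw0 : 0 < w u0 r0).
  { apply Rlt_le_trans with (w u r); [|apply Hmax; auto]. apply Rmult_lt_0_compat; auto using exp_pos. }
  assert (Hv : 0 < v u0 r0).
  { assert (He := exp_pos (- (L + 1) * u0)). unfold w in Hw0. nra. }
  assert (Hu0p : 0 < u0).
  { destruct (proj1 Hu0) as [h|h]; auto. specialize (Hv0 r0 Hr0). rewrite h in Hv0. lra. }
  assert (Hsl : forall r', 0 <= r' <= Rr -> v u0 r' <= v u0 r0).
  { intros r' Hr'. apply Rmult_le_reg_l with (exp (- (L + 1) * u0)); [apply exp_pos|]. apply (Hmax u0 r'); auto. }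
  assert (Dw : is_derive (fun u => w u r0) u0 (- (L + 1) * exp (- (L + 1) * u0) * v u0 r0 + exp (- (L + 1) * u0) * vu u0 r0)).
  { apply (is_derive_mult (fun u => exp (- (L + 1) * u)) (fun u => v u r0)); [|apply Du|intros; apply Rmult_comm].
    auto_derive; auto; ring. }
  assert (Hd := derive_max_left _ _ _ u0 Dw Hu0p (fun y Hy => Hmax y r0 ltac:(lra) Hr0)).
  assert (He := exp_pos (- (L + 1) * u0)).
  assert (Hvu : (L + 1) * v u0 r0 <= vu u0 r0) by nra.
  assert (Hvr : a u0 r0 * vr u0 r0 <= 0).
  { assert (H1 : 0 < r0 -> 0 <= vr u0 r0).
    { intros h; apply (derive_max_left (v u0) r0 _ r0); auto. intros y Hy; apply Hsl; lra. }
    assert (H2 : r0 < Rr -> vr u0 r0 <= 0).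
    { intros h; apply (derive_max_right (v u0) r0 _ (Rr - r0)); auto; [lra|]. intros y Hy; apply Hsl; lra. }
    destruct (Req_dec r0 0) as [E|E].
    - subst r0. assert (vr u0 0 <= 0) by (apply H2; auto). specialize (Ha0 u0 Hu0). nra.
    - destruct (Req_dec r0 Rr) as [E'|E'].
      + subst r0. assert (0 <= vr u0 Rr) by (apply H1; lra). specialize (HaR u0 Hu0). nra.
      + assert (vr u0 r0 = 0) by (apply Rle_antisym; [apply H2|apply H1]; lra). rewrite H; lra. }
  specialize (Hpde u0 r0 Hu0 Hr0 Hv Hsl). nra.
Qed.

(** * From functions on an interval to functions on the line *)

(** The slice operators act on Lipschitz functions on the line; composing with [clamp 0 Rr] extends
    a slice known on [0, R] with the same Lipschitz constant. *)
Definition clamp (a b x : R) : R := Rmax a (Rmin x b).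

Lemma clamp_in a b x : a <= b -> a <= clamp a b x <= b.
Proof. unfold clamp, Rmax, Rmin; repeat destruct Rle_dec; lra. Qed.

Lemma clamp_id a b x : a <= x <= b -> clamp a b x = x.
Proof. unfold clamp, Rmax, Rmin; repeat destruct Rle_dec; lra. Qed.

Lemma clamp_Lip a b x y : Rabs (clamp a b x - clamp a b y) <= Rabs (x - y).
Proof. unfold clamp, Rmax, Rmin, Rabs; repeat destruct Rle_dec; repeat destruct Rcase_abs; lra. Qed.

Lemma clamp_fun_Lip (f df : R -> R) (a b K : R) : a <= b -> (forall x, is_derive f x (df x)) ->
  (forall x, a <= x <= b -> Rabs (df x) <= K) -> Lip K (fun x => f (clamp a b x)).
Proof.
  intros Hab Hf HK x y.
  assert (Hx := clamp_in a b x Hab). assert (Hy := clamp_in a b y Hab).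
  apply Rle_trans with (K * Rabs (clamp a b x - clamp a b y)).
  - apply (mvt_le f df); auto. intros z Hz; apply HK. revert Hz. unfold Rmin, Rmax.
    destruct (Rle_dec (clamp a b y) (clamp a b x)); lra.
  - apply Rmult_le_compat_l; [|apply clamp_Lip].
    apply Rle_trans with (2 := HK _ Hx). apply Rabs_pos.
Qed.

Lemma deriv_within_unique (f g : R -> R) (a b x l l' : R) : a < b -> a <= x <= b ->
  (forall y, a <= y <= b -> f y = g y) -> is_derive f x l -> deriv_within a b g x l' -> l' = l.
Proof.
  intros Hab Hx E Hf Hg. apply NNPP; intros Hne.
  assert (He : 0 < Rabs (l' - l) / 2) by (generalize (Rabs_pos_lt (l' - l)); lra).
  destruct (Hg _ He) as (d1 & Hd1 & H1).
  destruct (proj1 (is_derive_eps f x l) Hf _ He) as (d2 & Hd2 & H2).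
  (* y is taken on the side of x with more room, which covers the endpoints. *)
  assert (Hy : exists y, a <= y <= b /\ y <> x /\ Rabs (y - x) < d1 /\ Rabs (y - x) < d2).
  { assert (Hm : 0 < Rmin (Rmin d1 d2) (b - a) / 2).
    { assert (0 < Rmin (Rmin d1 d2) (b - a)) by (repeat apply Rmin_glb_lt; lra). lra. }
    set (t := Rmin (Rmin d1 d2) (b - a) / 2) in *.
    assert (Ht : t < d1 /\ t < d2 /\ t <= (b - a) / 2).
    { generalize (Rmin_l (Rmin d1 d2) (b - a)) (Rmin_r (Rmin d1 d2) (b - a)) (Rmin_l d1 d2) (Rmin_r d1 d2).
      unfold t in *; lra. }
    destruct (Rle_dec x ((a + b) / 2)) as [h|h].
    - exists (x + t). replace (x + t - x) with t by ring. rewrite Rabs_pos_eq by lra. lra.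
    - exists (x - t). replace (x - t - x) with (- t) by ring. rewrite Rabs_Ropp, Rabs_pos_eq by lra. lra. }
  destruct Hy as (y & Hy & Hyx & Hy1 & Hy2).
  specialize (H1 y Hy Hyx Hy1). specialize (H2 y Hy2). rewrite !E in H2 by auto.
  assert (Hp : 0 < Rabs (y - x)) by (apply Rabs_pos_lt; lra).
  assert (H3 : Rabs ((g y - g x) / (y - x) - l) <= Rabs (l' - l) / 2).
  { replace ((g y - g x) / (y - x) - l) with ((g y - g x - (y - x) * l) * / (y - x)) by (field; lra).
    rewrite Rabs_mult, Rabs_inv. apply Rmult_le_reg_r with (Rabs (y - x)); auto.
    rewrite Rmult_assoc, Rinv_l by lra. lra. }
  assert (H4 : Rabs (l' - l) <= Rabs ((g y - g x) / (y - x) - l) + Rabs ((g y - g x) / (y - x) - l')).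
  { replace (l' - l) with (((g y - g x) / (y - x) - l) - ((g y - g x) / (y - x) - l')) by ring.
    triangle. rewrite Rabs_Ropp; lra. }
  lra.
Qed.

Lemma is_derive_within (f g : R -> R) (a b x l : R) :
  (forall y, a <= y <= b -> f y = g y) -> a <= x <= b -> is_derive f x l -> deriv_within a b g x l.
Proof.
  intros E Hx Hf eps He. destruct (proj1 (is_derive_eps f x l) Hf (eps / 2)) as (d & Hd & H); [lra|].
  exists d; split; auto. intros y Hy Hyx Hyd. specialize (H y Hyd). rewrite !E in H by auto.
  assert (Hp : 0 < Rabs (y - x)) by (apply Rabs_pos_lt; lra).
  replace ((g y - g x) / (y - x) - l) with ((g y - g x - (y - x) * l) * / (y - x)) by (field; lra).
  rewrite Rabs_mult, Rabs_inv. apply Rmult_lt_reg_r with (Rabs (y - x)); auto.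
  rewrite Rmult_assoc, Rinv_l by lra. nra.
Qed.

Lemma cont_eq_at_0 (f g : R -> R) (b : R) : 0 < b -> cont f -> cont g ->
  (forall r, 0 < r <= b -> f r = g r) -> f 0 = g 0.
Proof.
  intros Hb Hf Hg H. apply NNPP; intros Hne.
  assert (He : 0 < Rabs (f 0 - g 0)) by (apply Rabs_pos_lt; lra).
  destruct (proj1 (cont_eps _) (cont_minus f g Hf Hg) 0 _ He) as [d Hd].
  set (t := Rmin d b / 2).
  assert (Ht : 0 < t /\ t < d /\ t <= b).
  { unfold t; generalize (Rmin_l d b) (Rmin_r d b) (Rmin_glb_lt d b 0 (cond_pos d) Hb); lra. }
  specialize (Hd t). rewrite (H t) in Hd by lra.
  rewrite Rminus_diag, Rminus_0_l, Rabs_Ropp in Hd.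
  apply (Rlt_irrefl (Rabs (f 0 - g 0))). apply Hd. change (Rabs (t - 0) < d). rewrite Rabs_pos_eq; lra.
Qed.

(** * Arbitrary solutions on the rectangle: uniqueness and the sup bound *)

Section RectSolutions.
Variables (kap Lam rho Rr U : R) (chi : R -> R).
Hypothesis Hkap : 0 < kap.
Hypothesis HLam : 0 < Lam.
Hypothesis HRr : 0 < Rr.
Hypothesis HsR : sqrt (3 / Lam) < Rr.
Hypothesis HU : 0 < U.
Hypothesis Hrho : 0 < rho.
Hypothesis Hchi : cutoff rho chi.
Hypothesis Hone : forall r, 0 <= r <= Rr -> chi r = 1.

Notation cl g := (fun r => g (clamp 0 Rr r)).

(** A solution in the sense of [solves_IVP] is replaced by its C^1 extension H and the equation is
    rewritten with the slice operators; at r = 0 it follows by continuity. K is the maximum of |H_r|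
    on the rectangle, so no smallness is asked of the solution. *)
Lemma rect_solution (k : nat) (h0 : R -> R) (h : R -> R -> R) : (1 <= k)%nat ->
  Ck_rect k U Rr h -> solves_IVP kap Lam U Rr h0 h ->
  exists H Hu Hr K, C2 H /\ duv H Hu /\ drv H Hr /\ C2 Hr /\
    (forall u r, 0 <= u <= U -> 0 <= r <= Rr -> H u r = h u r) /\
    (forall u, 0 <= u <= U -> Lip K (cl (H u))) /\
    (forall u r, 0 <= u <= U -> 0 <= r <= Rr ->
      Hu u r = Av kap Lam chi (cl (H u)) r * Hr u r + Bv kap Lam chi (cl (H u)) r).
Proof.
  intros Hk (H & HC & HE) (Hinit & hu & hr & Pu & Pr & Heq).
  destruct k as [|k]; [lia|].
  assert (cH := Ck2_C2 _ _ HC). destruct (Ck2_elim _ _ HC) as (Hu & Hr & Du & Dr & Cu & Cr).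
  assert (cHr := Ck2_C2 _ _ Cr). assert (cHu := Ck2_C2 _ _ Cu).
  destruct (max2d (fun u r => Hr u r * Hr u r) U Rr) as (u0 & r0 & _ & _ & Hmax); try lra.
  { apply cont_mult; apply cHr. }
  set (K := Rabs (Hr u0 r0)).
  assert (HK : forall u r, 0 <= u <= U -> 0 <= r <= Rr -> Rabs (Hr u r) <= K).
  { intros u r H1 H2. apply Rsqr_le_abs_0. apply Hmax; auto. }
  assert (HLip : forall u, 0 <= u <= U -> Lip K (cl (H u))).
  { intros u H1. apply (clamp_fun_Lip (H u) (Hr u)); auto; lra. }
  exists H, Hu, Hr, K. refine (conj cH (conj Du (conj Dr (conj cHr (conj HE (conj HLip _)))))). clear Hinit.
  assert (Hpos : forall u r, 0 <= u <= U -> 0 < r <= Rr ->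
      Hu u r = Av kap Lam chi (cl (H u)) r * Hr u r + Bv kap Lam chi (cl (H u)) r).
  { intros u r H1 H2.
    assert (Eu : hu u r = Hu u r).
    { apply (deriv_within_unique (fun u => H u r) (fun u => h u r) 0 U u); auto; [intros; apply HE; lra|apply Pu; lra]. }
    assert (Er : hr u r = Hr u r).
    { apply (deriv_within_unique (H u) (h u) 0 Rr r); auto; [lra|apply Pr; lra]. }
    assert (Ecl : forall s, 0 <= s <= Rr -> h u s = H u (clamp 0 Rr s)).
    { intros s Hs. rewrite clamp_id by auto. symmetry; apply HE; auto. }
    specialize (Heq u r H1 H2).
    rewrite (ftilde_link kap Lam rho Rr chi Hchi Hone K _ (HLip u H1) h u Ecl) in Heq by auto.
    rewrite (G_link kap Lam rho Rr chi Hchi Hone K _ (HLip u H1) h u Ecl) in Heq by auto.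
    rewrite (hbar_link Rr K _ (HLip u H1) h u Ecl) in Heq by auto.
    rewrite Eu, Er, (Ecl r) in Heq by lra. unfold Bv, Dv. cbv beta. lra. }
  intros u r H1 [[H2|H2] H3]; [apply Hpos; auto|]. subst r.
  apply (cont_eq_at_0 (Hu u) (fun r => Av kap Lam chi (cl (H u)) r * Hr u r + Bv kap Lam chi (cl (H u)) r) Rr); auto.
  - apply C2_sl; auto.
  - destruct (slice_bounds kap Lam rho K) as (C & _ & HCb); auto; [apply Rabs_pos|].
    destruct (HCb chi Hchi K _ (conj (Rabs_pos _) (Rle_refl _)) (HLip u H1)) as (_ & _ & _ & _ & HA & HB & _).
    apply cont_plus; [apply cont_mult|]; [apply (Lip_cont _ _ HA)|apply C2_sl; auto|apply (Lip_cont _ _ HB)].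
Qed.

(** The constants may depend on both solutions, since the maximum principle accepts any L. The speed
    is that of h', and h_r appears only in the error (A' - A) h_r, bounded by [P]. *)
Lemma rect_uniqueness (k : nat) (h0 : R -> R) (h h' : R -> R -> R) : (1 <= k)%nat ->
  Ck_rect k U Rr h -> solves_IVP kap Lam U Rr h0 h ->
  Ck_rect k U Rr h' -> solves_IVP kap Lam U Rr h0 h' ->
  forall u r, 0 <= u <= U -> 0 <= r <= Rr -> h' u r = h u r.
Proof.
  intros Hk HC HS HC' HS'.
  destruct (rect_solution k h0 h Hk HC HS) as (H & Hu & Hr & K & cH & Du & Dr & cr & HE & HL & Heq).
  destruct (rect_solution k h0 h' Hk HC' HS') as (H' & Hu' & Hr' & K' & cH' & Du' & Dr' & cr' & HE' & HL' & Heq').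
  set (M := Rmax K K').
  assert (HM : forall u, 0 <= u <= U -> Lip M (cl (H u))).
  { intros u h1; apply (Lip_weaken K); auto. apply Rmax_l. }
  assert (HM' : forall u, 0 <= u <= U -> Lip M (cl (H' u))).
  { intros u h1; apply (Lip_weaken K'); auto. apply Rmax_r. }
  assert (HM0 : 0 <= M) by (apply (Lip_K_nonneg M (cl (H 0))), HM; lra).
  destruct (slice_bounds kap Lam rho M) as (C & HCp & HCb); auto.
  destruct (max2d (fun u r => Hr u r * Hr u r) U Rr) as (u0 & r0 & _ & _ & Hmax); try lra.
  { apply cont_mult; apply cr. }
  set (P := Rabs (Hr u0 r0)). assert (HP0 : 0 <= P) by apply Rabs_pos.
  assert (HP : forall u r, 0 <= u <= U -> 0 <= r <= Rr -> Rabs (Hr u r) <= P).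
  { intros u r H1 H2. apply Rsqr_le_abs_0. apply Hmax; auto. }
  set (v := fun u r => H' u r - H u r).
  set (vu := fun u r => Hu' u r - Hu u r). set (vr := fun u r => Hr' u r - Hr u r).
  assert (Cv : C2 v) by (apply cont_minus; auto).
  assert (Dvu : duv v vu) by (intros u r; apply (is_derive_minus (fun u => H' u r) (fun u => H u r)); auto).
  assert (Dvr : drv v vr) by (intros u r; apply (is_derive_minus (H' u) (H u)); auto).
  assert (Hneg : forall u r, 0 <= u <= U -> 0 <= r <= Rr -> v u r * v u r <= 0).
  { apply (max_principle (fun u r => v u r * v u r) (fun u r => vu u r * v u r + v u r * vu u r)
      (fun u r => vr u r * v u r + v u r * vr u r) (fun u r => Av kap Lam chi (cl (H' u)) r) U Rr (2 * (C * P + C)));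
      auto; [pos| | | | | | |].
    - apply cont_mult; auto.
    - apply duv_mult; auto.
    - apply drv_mult; auto.
    - intros u h1. rewrite (Av_0 kap Lam rho chi Hchi M _ (HM' u h1)). lra.
    - intros u h1. left; apply (Av_R_neg kap Lam rho Rr chi Hkap HLam HRr Hchi Hone M _ (HM' u h1)); auto.
    - intros r h1. unfold v. rewrite HE, HE' by lra. destruct HS as [Hi _], HS' as [Hi' _].
      rewrite Hi, Hi' by auto. lra.
    - intros u r h1 h2 Hpos Hsup.
      (* At a maximum of v^2 over the slice, |v u r| is the sup distance of the two slices, so the
         nonlocal bounds on A' - A and B' - B become multiples of |v u r|. *)
      assert (Hd : forall s, Rabs (cl (H' u) s - cl (H u) s) <= Rabs (v u r)).
      { intros s. apply Rsqr_le_abs_0. apply (Hsup (clamp 0 Rr s)). apply clamp_in; lra. }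
      destruct (HCb chi Hchi M _ (conj HM0 (Rle_refl _)) (HM' u h1)) as (_ & _ & _ & _ & _ & _ & HD).
      destruct (HD _ _ (HM u h1) Hd) as [HA HB]. specialize (HA r). specialize (HB r).
      unfold vu. rewrite Heq, Heq' by auto. unfold vr.
      set (A := Av kap Lam chi (cl (H u)) r) in *. set (A' := Av kap Lam chi (cl (H' u)) r) in *.
      set (B := Bv kap Lam chi (cl (H u)) r) in *. set (B' := Bv kap Lam chi (cl (H' u)) r) in *.
      set (x := v u r) in *.
      assert (E : Rabs (x * ((A' - A) * Hr u r + (B' - B))) <= (C * P + C) * (x * x)).
      { rewrite Rabs_mult.
        assert (E1 : Rabs ((A' - A) * Hr u r + (B' - B)) <= (C * P + C) * Rabs x).
        { triangle. rewrite Rabs_mult.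
          assert (Rabs (A' - A) * Rabs (Hr u r) <= (C * Rabs x) * P)
            by (apply Rmult_le_compat; auto using Rabs_pos). lra. }
        apply Rle_trans with (Rabs x * ((C * P + C) * Rabs x)); [apply Rmult_le_compat_l; auto using Rabs_pos|].
        right. replace (Rabs x * ((C * P + C) * Rabs x)) with ((C * P + C) * (Rabs x * Rabs x)) by ring.
        rewrite <- Rabs_mult, Rabs_pos_eq by apply Rle_0_sqr. reflexivity. }
      assert (E' := Rle_abs (x * ((A' - A) * Hr u r + (B' - B)))). lra. }
  intros u r h1 h2. specialize (Hneg u r h1 h2). rewrite <- HE, <- HE' by auto. unfold v in Hneg. nra.
Qed.

(* G <= 0, and at an extremum of h over a slice h (h - avg h) >= 0, so h^2 cannot increase. *)
Lemma sup_nonincreasing (h p : R -> R -> R) (K s0 : R) : C2 h -> drv h p ->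
  (forall u, Lip K (h u)) -> kap * (K * K) <= 4 * Lam -> 0 <= s0 ->
  forall hu, duv h hu ->
  (forall u r, 0 <= u <= U -> 0 <= r <= Rr -> hu u r = Av kap Lam chi (h u) r * p u r + Bv kap Lam chi (h u) r) ->
  (forall r, 0 <= r <= Rr -> Rabs (h 0 r) <= s0) ->
  forall u r, 0 <= u <= U -> 0 <= r <= Rr -> Rabs (h u r) <= s0.
Proof.
  intros Ch Dh HL HK Hs hu Du Heq Hinit.
  assert (Hneg : forall u r, 0 <= u <= U -> 0 <= r <= Rr -> h u r * h u r - s0 * s0 <= 0).
  { apply (max_principle (fun u r => h u r * h u r - s0 * s0) (fun u r => hu u r * h u r + h u r * hu u r)
      (fun u r => p u r * h u r + h u r * p u r) (fun u r => Av kap Lam chi (h u) r) U Rr 0); auto; [lra| | | | | | |].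
    - apply cont_minus; [apply cont_mult; auto|apply cont_const].
    - intros u r. rewrite <- (Rminus_0_r (hu u r * h u r + h u r * hu u r)).
      apply (is_derive_minus (fun u => h u r * h u r) (fun _ => s0 * s0)); [|apply is_derive_constR].
      apply (duv_mult h hu h hu); auto.
    - intros u r. rewrite <- (Rminus_0_r (p u r * h u r + h u r * p u r)).
      apply (is_derive_minus (fun r => h u r * h u r) (fun _ => s0 * s0)); [|apply is_derive_constR].
      apply (drv_mult h p h p); auto.
    - intros u h1. rewrite (Av_0 kap Lam rho chi Hchi K _ (HL u)). lra.
    - intros u h1. left; apply (Av_R_neg kap Lam rho Rr chi Hkap HLam HRr Hchi Hone K _ (HL u)); auto.
    - intros r h1. specialize (Hinit r h1). rewrite <- (Rabs_pos_eq s0) in Hinit by auto.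
      apply Rsqr_le_abs_1 in Hinit. unfold Rsqr in Hinit; lra.
    - intros u r h1 h2 Hpos Hsup. rewrite Heq by auto.
      assert (HG := Gv_nonpos kap Lam rho Rr chi Hkap HLam Hchi Hone K _ (HL u) r HK h2).
      assert (Havg : Rabs (Lop 0 (h u) r) <= Rabs (h u r)).
      { apply Lop_bound; [apply C2_sl; auto|]. intros t Ht. apply Rsqr_le_abs_0. unfold Rsqr.
        assert (Htr : 0 <= t * r <= Rr) by (split; nra). specialize (Hsup (t * r) Htr). lra. }
      assert (HD : 0 <= h u r * Dv (h u) r).
      { unfold Dv. assert (H1 := Rabs_pos (h u r)).
        assert (H2 : h u r * Lop 0 (h u) r <= Rabs (h u r) * Rabs (h u r)).
        { apply Rle_trans with (1 := Rle_abs _). rewrite Rabs_mult. apply Rmult_le_compat_l; auto. }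
        rewrite <- Rabs_mult, (Rabs_pos_eq (h u r * h u r)) in H2 by apply Rle_0_sqr. lra. }
      unfold Bv. set (G := Gv kap Lam chi (h u) r) in *. nra. }
  intros u r h1 h2. rewrite <- (Rabs_pos_eq s0) by auto. apply Rsqr_le_abs_0.
  specialize (Hneg u r h1 h2). unfold Rsqr; lra.
Qed.
End RectSolutions.

(** * Existence *)

Ltac slice_bound H := intros g Hg; decompose [and] (H g Hg); assumption.

(** Passing from K/2 for the data to K for [k], and composing with the 2-Lipschitz [Y], gives slices
    of constant 2 K <= 1, hence the value 1 in [slice_constant]. *)
Lemma evolution_exists (kap Lam rho sig C K Lc : R) (chi th H0 dH0 : R -> R) :
  0 < kap -> 0 < Lam -> 0 < rho -> slice_constant kap Lam rho 1 C -> 0 < sig -> C * sig <= / 12 ->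
  cutoff rho chi -> Lip Lc chi -> cutoff sig th -> 0 <= K <= / 2 ->
  (forall a, is_derive H0 a (dH0 a)) -> cont dH0 -> (forall a, Rabs (dH0 a) <= K / 2) ->
  exists h p, C2 h /\ drv h p /\
    duv h (fun u r => th u * (Av kap Lam chi (h u) r * p u r + Bv kap Lam chi (h u) r)) /\
    (forall u, Lip (2 * K) (h u)) /\ (forall r, h 0 r = H0 r) /\
    forall k, Ck1 (S k) chi -> Ck1 (S k) th -> Ck1 k dH0 -> Ck2 (S k) h.
Proof.
  intros Hkap HLam Hrho [HC HCb] Hsig HCs Hchi HLc Hth HK HD cD HdB.
  specialize (HCb chi Hchi (2 * K)).
  assert (HCb' := fun g => HCb g ltac:(lra)). clear HCb.
  destruct (slice_bounds_Lip kap Lam rho 1 chi Lc) as (C' & HC' & HCl); auto; [lra|].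
  specialize (HCl (2 * K)). assert (HCl' := fun g => HCl g ltac:(lra)). clear HCl.
  assert (HA : op_bound (2 * K) C (Av kap Lam chi)) by slice_bound HCb'.
  assert (HG : op_bound (2 * K) C (Gv kap Lam chi)) by slice_bound HCb'.
  assert (HB : op_bound (2 * K) (C * (2 * K)) (Bv kap Lam chi)) by slice_bound HCb'.
  assert (HW : op_bound (2 * K) (C * (2 * K)) (Wv kap Lam chi)) by slice_bound HCb'.
  assert (HAL : op_Lip (2 * K) C (Av kap Lam chi)) by slice_bound HCb'.
  assert (HBL : op_Lip (2 * K) (C * (2 * K)) (Bv kap Lam chi)) by slice_bound HCb'.
  assert (HAd : op_diff (2 * K) C (Av kap Lam chi)).
  { intros g g' d Hg Hg' Hd. destruct (HCb' g Hg) as (_ & _ & _ & _ & _ & _ & H). apply (H g' d); auto. }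
  assert (HBd : op_diff (2 * K) C (Bv kap Lam chi)).
  { intros g g' d Hg Hg' Hd. destruct (HCb' g Hg) as (_ & _ & _ & _ & _ & _ & H). apply (H g' d); auto. }
  assert (HGL : op_Lip (2 * K) C' (Gv kap Lam chi)) by slice_bound HCl'.
  assert (HWL : op_Lip (2 * K) C' (Wv kap Lam chi)) by slice_bound HCl'.
  assert (HAT := fun g Hg => proj1 (proj2 (proj2 (HCl' g Hg)))).
  assert (HBT := fun g Hg => proj1 (proj2 (proj2 (proj2 (HCl' g Hg))))).
  assert (HGd : op_diff (2 * K) C' (Gv kap Lam chi)).
  { intros g g' d Hg Hg' Hd. destruct (HCl' g Hg) as (_ & _ & _ & _ & H). apply (H g' d); auto. }
  assert (HWd : op_diff (2 * K) C' (Wv kap Lam chi)).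
  { intros g g' d Hg Hg' Hd. destruct (HCl' g Hg) as (_ & _ & _ & _ & H). apply (H g' d); auto. }
  assert (HH0 : Lip (K / 2) H0) by (apply (Lip_derive H0 dH0); auto).
  destruct (characteristics_exist kap Lam chi th H0 sig C K Hsig Hth HC HCs HK HH0 HA HB HAL HBL HAd HBd)
    as (X & k & Y & good & eqX & eqk & XY).
  set (h := hof k Y) in *. set (p := pc kap Lam chi th dH0 X k Y).
  assert (Dh : drv h p)
    by exact (h_derive_r kap Lam chi th H0 dH0 sig C K C' Hsig Hth HC HC' HCs HK HD cD
                HG HW HAL HBL HAd HBd HGL HWL HGd HWd HAT HBT X k Y good eqX eqk XY).
  assert (Du := h_derive_u kap Lam chi th H0 dH0 sig C K C' Hsig Hth HC HC' HCs HK HD cD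
                HG HW HAL HBL HAd HBd HGL HWL HGd HWd HAT HBT X k Y good eqX eqk XY).
  assert (DX := X_derive kap Lam chi th sig C K C' Hsig Hth HC HC' HCs HK HG HAL HAd HGL HGd HAT X k Y good eqX).
  assert (DY := Y_derive kap Lam chi th sig C K C' Hsig Hth HC HC' HCs HK HG HAL HAd HGL HGd HAT X k Y good eqX XY).
  assert (Cp : C2 p) by exact (pc_C2 kap Lam chi th dH0 sig C K C' Hth HC HK cD HGL HWL HGd HWd X k Y good).
  assert (CX := X_C2 C K HC X k Y good). assert (CY := Y_C2 C K HC X k Y good).
  assert (hL : forall u, Lip (2 * K) (h u)) by (intros u; apply (hof_Lip C K HK X k Y u good)).
  assert (Ch : C2 h).
  { apply (C2_Lip _ (2 * C + 2 * K)); [lra|]. intros u u' r r'.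
    replace (h u r - h u' r') with ((h u r - h u r') + (h u r' - h u' r')) by ring.
    triangle.
    assert (E1 := hL u r r'). assert (E2 := hof_uLip C K HK X k Y u u' good r'). fold h in E2.
    assert (0 <= 2 * C * Rabs (r - r')) by (generalize (Rabs_pos (r - r')); intros; pos).
    assert (0 <= 2 * K * Rabs (u - u')) by (generalize (Rabs_pos (u - u')); intros; pos). lra. }
  exists h, p. refine (conj Ch (conj Dh (conj Du (conj hL (conj _ _))))).
  - intros r. unfold h, hof. assert (E : Y 0 r = r).
    { assert (E := eqX 0 (Y 0 r)). rewrite XY, Top_0 in E. lra. }
    rewrite eqk, Top_0, E; ring.
  - intros m Hc Ht Hd.
    apply (solution_Ck2 kap Lam chi th dH0 m h p X Y (Zc kap Lam chi th X k Y) (Ic kap Lam chi th dH0 X k Y)); auto.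
Qed.

(** * Cutoffs of class C^n and extension of the data *)

(** Functions of one variable are viewed as independent of u, so the closure properties of [Rdiff]
    serve for [Ck1] too. *)
Lemma Rdiff_Ck1 n : forall f, Rdiff 0 n (fun _ r => f r) -> Ck1 n f.
Proof.
  induction n as [|n IH]; intros f [Hf Hd].
  - intros x. apply continuity_pt_filterlim. apply (C2_sl (fun _ r => f r) 0). apply (Ck2_C2 0), Hf.
  - destruct Hd as (fr & Df & Rf). exists (fr 0). split; [intros x; apply is_derive_Reals, (Df 0)|].
    apply IH. assert (E : fr = fun _ r => fr 0 r); [|rewrite E in Rf; exact Rf].
    apply fun2_ext; intros u r. rewrite <- (is_derive_unique _ _ _ (Df u r)). apply is_derive_unique, (Df 0).
Qed.

(** The positive part to the power n + 1, of class C^n: finite smoothness is enough and spares the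
    flat exponential. *)
Definition ppow (n : nat) (x : R) : R := if Rle_dec x 0 then 0 else x ^ S n.

Lemma ppow_neg n x : x <= 0 -> ppow n x = 0.
Proof. intros H; unfold ppow; destruct Rle_dec; auto; lra. Qed.

Lemma ppow_pos n x : 0 < x -> ppow n x = x ^ S n.
Proof. intros H; unfold ppow; destruct Rle_dec; auto; lra. Qed.

Lemma ppow_Ck1 n : Ck1 n (ppow n).
Proof.
  assert (Sc : forall m c f, Ck1 m f -> Ck1 m (fun x => c * f x)).
  { intros m c f Hf. apply Rdiff_Ck1. apply (Rdiff_scal 0 m c (fun _ r => f r)), Rdiff_r, Hf. }
  induction n as [|n IH].
  - intros x. apply continuity_pt_filterlim. revert x. apply (cont_Lip _ 1). intros x y. unfold ppow.
    destruct (Rle_dec x 0), (Rle_dec y 0); simpl; unfold Rabs; repeat destruct Rcase_abs; lra.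
  - exists (fun x => INR (S (S n)) * ppow n x). split; [|apply Sc, IH].
    intros x. apply is_derive_Reals. destruct (Rtotal_order x 0) as [Hx|[->|Hx]].
    + rewrite (ppow_neg n) by lra. rewrite Rmult_0_r. apply (is_derive_ext_loc (fun _ => 0)); [|apply is_derive_constR].
      assert (Hx' : 0 < - x) by lra. exists (mkposreal _ Hx'). intros y Hy. change (Rabs (y - x) < - x) in Hy.
      rewrite ppow_neg; auto. apply Rabs_lt_between in Hy; lra.
    + rewrite (ppow_neg n) by lra. rewrite Rmult_0_r. apply is_derive_eps; intros eps He.
      exists (Rmin 1 eps). split; [apply Rmin_glb_lt; lra|]. intros y Hy. rewrite Rminus_0_r in Hy |- *.
      assert (Hy1 := Rlt_le_trans _ _ _ Hy (Rmin_l _ _)). assert (Hy2 := Rlt_le_trans _ _ _ Hy (Rmin_r _ _)).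
      rewrite (ppow_neg (S n) 0), Rmult_0_r, !Rminus_0_r by lra.
      destruct (Rle_dec y 0) as [h|h].
      * rewrite ppow_neg, Rabs_R0 by auto. generalize (Rabs_pos y); intros; pos.
      * rewrite ppow_pos by lra. rewrite (Rabs_pos_eq y) in * by lra.
        assert (Hp := pow01 n y ltac:(lra)). simpl. rewrite Rabs_pos_eq; [|pos].
        assert (y * (y * y ^ n) <= y * (y * 1)) by (repeat apply Rmult_le_compat_l; lra). nra.
    + rewrite ppow_pos by auto. apply (is_derive_ext_loc (fun y => y ^ S (S n))).
      * exists (mkposreal _ Hx). intros y Hy. change (Rabs (y - x) < x) in Hy.
        rewrite ppow_pos; auto. apply Rabs_lt_between in Hy; lra.
      * replace (INR (S (S n)) * x ^ S n) with (INR (S (S n)) * 1 * x ^ pred (S (S n))) by (rewrite Rmult_1_r; auto).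
        apply (is_derive_pow (fun y => y)). apply (@is_derive_id R_AbsRing).
Qed.

Definition stepf (n : nat) (x : R) : R := ppow n x / (ppow n x + ppow n (1 - x)).

Lemma ppow_nonneg n x : 0 <= ppow n x.
Proof. destruct (Rle_dec x 0); [rewrite ppow_neg; lra|rewrite ppow_pos by lra]. apply pow_le; lra. Qed.

Lemma stepf_den n x : 0 < ppow n x + ppow n (1 - x).
Proof.
  assert (H1 := ppow_nonneg n x). assert (H2 := ppow_nonneg n (1 - x)).
  destruct (Rle_dec x 0) as [h|h].
  - assert (0 < ppow n (1 - x)) by (rewrite ppow_pos by lra; apply pow_lt; lra). lra.
  - assert (0 < ppow n x) by (rewrite ppow_pos by lra; apply pow_lt; lra). lra.
Qed.

Lemma stepf_01 n x : 0 <= stepf n x <= 1.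
Proof.
  assert (H1 := ppow_nonneg n x). assert (H2 := ppow_nonneg n (1 - x)). assert (H3 := stepf_den n x).
  unfold stepf; split; [apply Rdiv_le_0_compat; auto|].
  apply Rmult_le_reg_r with (ppow n x + ppow n (1 - x)); auto. unfold Rdiv. rewrite Rmult_assoc, Rinv_l by lra. lra.
Qed.

Lemma stepf_0 n x : x <= 0 -> stepf n x = 0.
Proof. intros H; unfold stepf. rewrite ppow_neg by auto. unfold Rdiv; ring. Qed.

Lemma stepf_1 n x : 1 <= x -> stepf n x = 1.
Proof.
  intros H. assert (H3 := stepf_den n x). unfold stepf. rewrite (ppow_neg n (1 - x)) in * by lra.
  field; lra.
Qed.

Lemma Rdiff_comp_r n f g : Ck1 n f -> Rdiff 0 n (fun _ r => g r) -> Rdiff 0 n (fun _ r => f (g r)).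
Proof. intros Hf Hg. apply (Rdiff_comp n (fun _ r => f r) (fun _ r => g r)); auto. apply Rdiff_r, Hf. Qed.

Lemma Rdiff_affine n c d : Rdiff 0 n (fun _ r => c * r + d).
Proof. apply Rdiff_plus; [apply Rdiff_scal, Rdiff_id|apply Rdiff_const]. Qed.

Lemma stepf_Ck1 n : Ck1 n (stepf n).
Proof.
  apply Rdiff_Ck1. assert (H := Rdiff_r 0 n (ppow n) (ppow_Ck1 n)).
  apply (Rdiff_mult 0 n (fun _ r => ppow n r)); auto.
  apply (Rdiff_inv n (fun _ r => ppow n r + ppow n (1 - r))); [intros _ r; apply Rgt_not_eq, stepf_den|].
  apply Rdiff_plus; auto. apply (Rdiff_comp_r n (ppow n) (fun r => 1 - r)); [apply ppow_Ck1|].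
  apply Rdiff_minus; [apply Rdiff_const|apply Rdiff_id].
Qed.

(** For e > 0 it rises on [a - e, a] and falls on [b, b + e]; the arguments are in the form c x + d
    of [Rdiff_affine]. *)
Definition bump (n : nat) (a b e x : R) : R := stepf n (/ e * x + (e - a) / e) * stepf n (- / e * x + (b + e) / e).

Lemma bump_Ck1 n a b e : Ck1 n (bump n a b e).
Proof.
  apply Rdiff_Ck1. unfold bump. apply Rdiff_mult; apply (Rdiff_comp_r n (stepf n));
    auto using stepf_Ck1, Rdiff_affine.
Qed.

Lemma bump_01 n a b e x : 0 <= bump n a b e x <= 1.
Proof.
  unfold bump. generalize (stepf_01 n (/ e * x + (e - a) / e)) (stepf_01 n (- / e * x + (b + e) / e)). nra.
Qed.

Lemma bump_1 n a b e x : 0 < e -> a <= x <= b -> bump n a b e x = 1.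
Proof.
  intros He Hx. assert (Hi := Rinv_0_lt_compat e He). unfold bump.
  rewrite !stepf_1; [ring| |].
  - replace (- / e * x + (b + e) / e) with (1 + (b - x) * / e) by (field; lra). nra.
  - replace (/ e * x + (e - a) / e) with (1 + (x - a) * / e) by (field; lra). nra.
Qed.

Lemma bump_0 n a b e x : 0 < e -> (x <= a - e \/ b + e <= x) -> bump n a b e x = 0.
Proof.
  intros He Hx. assert (Hi := Rinv_0_lt_compat e He). unfold bump. destruct Hx as [Hx|Hx].
  - rewrite (stepf_0 n (/ e * x + (e - a) / e)); [ring|].
    replace (/ e * x + (e - a) / e) with ((x - (a - e)) * / e) by (field; lra). nra.
  - rewrite (stepf_0 n (- / e * x + (b + e) / e)); [ring|].
    replace (- / e * x + (b + e) / e) with ((b + e - x) * / e) by (field; lra). nra.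
Qed.

Lemma bump_cutoff n b e : 0 < e -> 0 <= b -> cutoff (b + e) (bump n 0 b e).
Proof.
  intros He Hb. split; [apply (Ck1_cont n), bump_Ck1|split; [intros; apply bump_01|]].
  intros r Hr. apply bump_0; auto. revert Hr; unfold Rabs; destruct Rcase_abs; lra.
Qed.

(** [chi] vanishes at -rho, rho and beyond, so clamping its argument to [-rho, rho] changes nothing,
    and chi' is bounded on that compact interval. *)
Lemma cutoff_Lip (rho : R) (chi : R -> R) (n : nat) : 0 < rho -> cutoff rho chi -> Ck1 (S n) chi -> exists L, Lip L chi.
Proof.
  intros Hrho (Hc & _ & Hout) (g & Hg & Cg).
  assert (cg := Ck1_cont _ _ Cg).
  destruct (continuity_ab_maj (fun x => Rabs (g x)) (- rho) rho) as (m & Hm & _); [lra| |].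
  { intros x _. apply continuity_pt_filterlim. apply (continuous_comp g Rabs); [apply cg|apply continuous_Rabs]. }
  exists (Rabs (g m)).
  apply (Lip_ext _ (fun x => chi (clamp (- rho) rho x))).
  - intros x. destruct (Rle_dec rho (Rabs x)) as [h|h].
    + rewrite (Hout x) by auto. apply Hout. revert h. unfold clamp, Rmax, Rmin, Rabs.
      repeat destruct Rle_dec; repeat destruct Rcase_abs; lra.
    + rewrite clamp_id; auto. revert h. unfold Rabs; destruct Rcase_abs; lra.
  - apply (clamp_fun_Lip chi g); [lra|intros; apply is_derive_Reals; auto|auto].
Qed.

(** The cutoff multiplies g', not g, so its steep derivative never enters: [H0] is a primitive of
    the product. The margin e is chosen so that |g'| <= 2 s1 on the support, by continuity of g' at
    both ends. This needs s1 > 0; if s1 = 0 the data are constant. *)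
Lemma extend_data (k : nat) (Rr s1 : R) (h0 dh0 : R -> R) : 0 < Rr ->
  Ck_interval (S k) 0 Rr h0 -> (forall x, 0 <= x <= Rr -> deriv_within 0 Rr h0 x (dh0 x)) ->
  (forall x, 0 <= x <= Rr -> Rabs (dh0 x) <= s1) ->
  exists H0 dH0, (forall a, is_derive H0 a (dH0 a)) /\ Ck1 k dH0 /\ (forall a, Rabs (dH0 a) <= 2 * s1) /\
    forall x, 0 <= x <= Rr -> H0 x = h0 x.
Proof.
  intros HR (g & (g' & Dg & Cg) & Eg) Hd Hs1.
  assert (Dg' : forall x, is_derive g x (g' x)) by (intros; apply is_derive_Reals; auto).
  assert (cg := Ck1_cont _ _ Cg).
  assert (Hs0 : 0 <= s1) by (apply Rle_trans with (2 := Hs1 0 ltac:(lra)); apply Rabs_pos).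
  assert (Hg' : forall x, 0 <= x <= Rr -> Rabs (g' x) <= s1).
  { intros x Hx. rewrite <- (deriv_within_unique g h0 0 Rr x (g' x) (dh0 x)); auto. }
  destruct Hs0 as [Hs|Hs].
  - assert (Near : forall z, exists e, 0 < e /\ forall x, Rabs (x - z) < e -> Rabs (g' x) <= Rabs (g' z) + s1).
    { intros z. destruct (proj1 (cont_eps g') cg z s1 Hs) as [e He]. exists e; split; [apply cond_pos|].
      intros x Hx. replace (g' x) with (g' z + (g' x - g' z)) by ring.
      triangle. apply Rplus_le_compat_l. left; apply He, Hx. }
    destruct (Near 0) as (e1 & He1 & N1). destruct (Near Rr) as (e2 & He2 & N2).
    assert (B1 := Hg' 0 ltac:(lra)). assert (B2 := Hg' Rr ltac:(lra)).
    set (e := Rmin e1 e2).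
    assert (He : 0 < e /\ e <= e1 /\ e <= e2).
    { unfold e; split; [apply Rmin_glb_lt; auto|split; [apply Rmin_l|apply Rmin_r]]. }
    set (dH0 := fun x => bump k 0 Rr e x * g' x).
    assert (CdH : Ck1 k dH0).
    { apply Rdiff_Ck1. apply (Rdiff_mult 0 k (fun _ r => bump k 0 Rr e r) (fun _ r => g' r));
        apply Rdiff_r; auto; apply bump_Ck1. }
    assert (cdH := Ck1_cont _ _ CdH).
    exists (fun x => h0 0 + RInt dH0 0 x), dH0. refine (conj _ (conj CdH (conj _ _))).
    + intros a. replace (dH0 a) with (0 + dH0 a) by ring.
      apply (is_derive_plus (fun _ => h0 0) (fun x => RInt dH0 0 x)); [apply is_derive_constR|apply is_derive_prim; auto].
    + intros a. unfold dH0. destruct (Rle_dec a (0 - e)) as [h|h]; [rewrite bump_0, Rmult_0_l, Rabs_R0; lra|].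
      destruct (Rle_dec (Rr + e) a) as [h'|h']; [rewrite bump_0, Rmult_0_l, Rabs_R0; lra|].
      assert (Hga : Rabs (g' a) <= 2 * s1).
      { destruct (Rlt_dec a 0) as [q|q].
        - apply Rle_trans with (Rabs (g' 0) + s1); [apply N1; rewrite Rabs_left; lra|lra].
        - destruct (Rlt_dec Rr a) as [q'|q'].
          + apply Rle_trans with (Rabs (g' Rr) + s1); [apply N2; rewrite Rabs_pos_eq; lra|lra].
          + apply Rle_trans with s1; [apply Hg'; lra|lra]. }
      rewrite Rabs_mult. destruct (bump_01 k 0 Rr e a). rewrite (Rabs_pos_eq (bump k 0 Rr e a)) by auto.
      generalize (Rabs_pos (g' a)); nra.
    + intros x Hx. rewrite (RInt_extR dH0 g').
      * rewrite (RInt_FTC g g') by auto. rewrite !Eg by lra. eqR; ring.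
      * rewrite Rmin_left, Rmax_right by lra. intros s Hs'. unfold dH0. rewrite bump_1 by lra; ring.
  - exists (fun _ => h0 0), (fun _ => 0). refine (conj _ (conj _ (conj _ _))).
    + intros; apply is_derive_constR.
    + apply Rdiff_Ck1, Rdiff_const.
    + intros; rewrite Rabs_R0; lra.
    + intros x Hx. rewrite <- !Eg by lra.
      assert (H : Rabs (g x - g 0) <= 0 * Rabs (x - 0)).
      { apply (mvt_le g g'); auto. rewrite Rmin_left, Rmax_right by lra. intros; rewrite Hs; apply Hg'; lra. }
      rewrite Rmult_0_l in H. generalize (Rabs_pos (g x - g 0)); intros H1.
      assert (H2 : Rabs (g x - g 0) = 0) by lra.
      destruct (Req_dec (g x - g 0) 0) as [E|E]; [lra|apply Rabs_pos_lt in E; lra].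
Qed.

Lemma Lip_derive_bound (K : R) (f : R -> R) (x l : R) : Lip K f -> is_derive f x l -> Rabs l <= K.
Proof.
  intros HL Hf. apply Rnot_lt_le; intros Hlt.
  destruct (proj1 (is_derive_eps f x l) Hf ((Rabs l - K) / 2)) as (d & Hd & H); [lra|].
  specialize (H (x + d / 2)). specialize (HL (x + d / 2) x).
  replace (x + d / 2 - x) with (d / 2) in * by ring. rewrite (Rabs_pos_eq (d / 2)) in * by lra.
  specialize (H ltac:(lra)).
  assert (E : Rabs (d / 2 * l) <= Rabs (f (x + d / 2) - f x) + Rabs (f (x + d / 2) - f x - d / 2 * l)).
  { replace (d / 2 * l) with ((f (x + d / 2) - f x) - (f (x + d / 2) - f x - d / 2 * l)) at 1 by ring.
    triangle. rewrite Rabs_Ropp; lra. }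
  rewrite Rabs_mult, (Rabs_pos_eq (d / 2)) in E by lra. nra.
Qed.

Theorem theorem4p1 (kappa Lambda Rr : R) :
  0 < kappa -> 0 < Lambda -> sqrt (3 / Lambda) < Rr ->
  exists delta, 0 < delta /\
  exists Cstar, 0 < Cstar /\
  exists Ufun : R -> R, (forall x, 0 <= x < delta -> 0 < Ufun x) /\
  forall (k : nat) (h0 dh0 : R -> R) (s0 s1 : R),
    (1 <= k)%nat ->
    Ck_interval k 0 Rr h0 ->
    (forall x, 0 <= x <= Rr -> deriv_within 0 Rr h0 x (dh0 x)) ->
    sup_abs_interval 0 Rr h0 s0 ->
    sup_abs_interval 0 Rr dh0 s1 ->
    s0 + s1 < delta ->
    let U := Ufun (s0 + s1) in
    exists h : R -> R -> R,
      Ck_rect k U Rr h /\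
      solves_IVP kappa Lambda U Rr h0 h /\
      (forall h' : R -> R -> R, Ck_rect k U Rr h' -> solves_IVP kappa Lambda U Rr h0 h' ->
         forall u r, 0 <= u <= U -> 0 <= r <= Rr -> h' u r = h u r) /\
      sup_abs_rect U Rr h s0 /\
      (forall hr, partial_r_rect U Rr h hr ->
         exists sh sr, sup_abs_rect U Rr h sh /\ sup_abs_rect U Rr hr sr /\
           sh + sr <= (1 + Cstar) * (s0 + s1)).
Proof.
  intros Hkap HLam HR.
  assert (HRr : 0 < Rr) by (generalize (sqrt_pos (3 / Lambda)); lra).
  set (rho := Rr + 1). assert (Hrho : 0 < rho) by (unfold rho; lra).
  destruct (slice_bounds kappa Lambda rho 1) as (C & HC); auto; [lra|].
  assert (HC0 := proj1 HC).
  set (sig := / (12 * C)). assert (Hsig : 0 < sig) by (apply Rinv_0_lt_compat; lra).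
  assert (HCs : C * sig <= / 12) by (right; unfold sig; field; lra).
  (* theta equals 1 on [0, U] and falls to 0 on [U, 2 U], so 2 U = sig. *)
  set (U := sig / 2). assert (HU : 0 < U) by (unfold U; lra).
  (* The first bound gives K = 4 s1 <= 1/2. With both, kappa (2 K)^2 = (2 kappa s1)(32 s1) <= 4
     Lambda, the condition for G <= 0. *)
  set (delta := Rmin (/ 8) (Lambda / (2 * kappa))).
  assert (Hdel : 0 < Lambda / (2 * kappa)) by (apply Rdiv_lt_0_compat; lra).
  exists delta. split; [apply Rmin_glb_lt; lra|].
  (* Slices have Lipschitz constant 2 K = 8 s1, so the sum of the suprema is at most s0 + 8 s1. *)
  exists 8. split; [lra|]. exists (fun _ => U). split; [auto|].
  intros k h0 dh0 s0 s1 Hk Hh0 Hdh0 Hs0 Hs1 Hs U'. subst U'.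
  destruct k as [|k]; [lia|].
  assert (Bh0 : forall x, 0 <= x <= Rr -> Rabs (h0 x) <= s0) by (intros x Hx; apply Hs0; exists x; auto).
  assert (Bdh0 : forall x, 0 <= x <= Rr -> Rabs (dh0 x) <= s1) by (intros x Hx; apply Hs1; exists x; auto).
  assert (Ps0 : 0 <= s0) by (apply Rle_trans with (2 := Bh0 0 ltac:(lra)); apply Rabs_pos).
  assert (Ps1 : 0 <= s1) by (apply Rle_trans with (2 := Bdh0 0 ltac:(lra)); apply Rabs_pos).
  assert (Hd1 := Rlt_le_trans _ _ _ Hs (Rmin_l _ _)). assert (Hd2 := Rlt_le_trans _ _ _ Hs (Rmin_r _ _)).
  (* The extended data satisfy |H0'| <= 2 s1, which has to be K/2. *)
  set (K := 4 * s1). assert (HK : 0 <= K <= / 2) by (unfold K; lra).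
  assert (HKG : kappa * (2 * K * (2 * K)) <= 4 * Lambda).
  { unfold K. assert (E : s1 * (2 * kappa) < Lambda).
    { apply Rmult_lt_reg_r with (/ (2 * kappa)); [apply Rinv_0_lt_compat; lra|].
      rewrite Rmult_assoc, Rinv_r, Rmult_1_r by lra. unfold Rdiv in Hd2; lra. }
    replace (kappa * (2 * (4 * s1) * (2 * (4 * s1)))) with (s1 * (2 * kappa) * (32 * s1)) by ring.
    apply Rle_trans with (s1 * (2 * kappa) * 4); [|lra].
    apply Rmult_le_compat_l; [pos|lra]. }
  destruct (extend_data k Rr s1 h0 dh0 HRr Hh0 Hdh0 Bdh0) as (H0 & dH0 & DH0 & CdH0 & BdH0 & EH0).
  set (chi := bump (S k) 0 Rr 1). set (th := bump (S k) 0 U U).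
  assert (Hchi : cutoff rho chi) by (apply bump_cutoff; lra).
  assert (Hth : cutoff sig th) by (replace sig with (U + U) by (unfold U; field); apply bump_cutoff; lra).
  assert (Hone : forall r, 0 <= r <= Rr -> chi r = 1) by (intros; apply bump_1; lra).
  assert (Hthone : forall u, 0 <= u <= U -> th u = 1) by (intros; apply bump_1; lra).
  assert (Cchi : Ck1 (S k) chi) by apply bump_Ck1. assert (Cth : Ck1 (S k) th) by apply bump_Ck1.
  destruct (cutoff_Lip rho chi k Hrho Hchi Cchi) as [Lc HLc].
  destruct (evolution_exists kappa Lambda rho sig C K Lc chi th H0 dH0) as (h & p & Ch & Dh & Du & hL & Eh0 & Hreg);
    auto; [apply (Ck1_cont _ _ CdH0)|intros a; apply Rle_trans with (1 := BdH0 a); unfold K; lra|].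
  assert (Hpde : forall u r, 0 <= u <= U -> 0 <= r <= Rr ->
     th u * (Av kappa Lambda chi (h u) r * p u r + Bv kappa Lambda chi (h u) r) =
     Av kappa Lambda chi (h u) r * p u r + Bv kappa Lambda chi (h u) r) by (intros; rewrite Hthone by auto; ring).
  assert (HCk : Ck_rect (S k) U Rr h) by (exists h; split; auto).
  assert (HS : solves_IVP kappa Lambda U Rr h0 h).
  { split; [intros r Hr; rewrite Eh0; auto|].
    exists (fun u r => th u * (Av kappa Lambda chi (h u) r * p u r + Bv kappa Lambda chi (h u) r)), p.
    refine (conj _ (conj _ _)).
    - intros u r Hu Hr. apply (is_derive_within (fun u => h u r)); auto.
    - intros u r Hu Hr. apply (is_derive_within (h u)); auto.
    - intros u r Hu Hr.
      rewrite (ftilde_link kappa Lambda rho Rr chi Hchi Hone (2 * K) (h u) (hL u) h u) by auto.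
      rewrite (G_link kappa Lambda rho Rr chi Hchi Hone (2 * K) (h u) (hL u) h u) by auto.
      rewrite (hbar_link Rr (2 * K) (h u) (hL u) h u) by auto.
      rewrite Hpde by lra. unfold Bv, Dv. field. }
  assert (Hsup : forall u r, 0 <= u <= U -> 0 <= r <= Rr -> Rabs (h u r) <= s0).
  { apply (sup_nonincreasing kappa Lambda rho Rr U chi Hkap HLam HRr HR HU Hchi Hone h p (2 * K) s0 Ch Dh hL HKG Ps0 _ Du Hpde).
    intros r Hr. rewrite Eh0, EH0 by auto. auto. }
  (* The initial slice u = 0 already has supremum s0. *)
  assert (Hlub : sup_abs_rect U Rr h s0).
  { split.
    - intros y (u & r & Hu & Hr & ->). auto.
    - intros b Hb. apply (proj2 Hs0). intros y (x & Hx & ->). apply Hb. exists 0, x.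
      rewrite Eh0, EH0 by auto. repeat split; auto; lra. }
  exists h. refine (conj HCk (conj HS (conj _ (conj Hlub _)))).
  - intros h' HC' HS'. apply (rect_uniqueness kappa Lambda rho Rr U chi Hkap HLam HRr HR HU Hrho Hchi Hone (S k) h0); auto; lia.
  - intros hr Hhr.
    (* An arbitrary one-sided radial derivative must equal p, also at r = 0 and r = R, and p is
       bounded by the Lipschitz constant of the slice. *)
    assert (Ehr : forall u r, 0 <= u <= U -> 0 <= r <= Rr -> Rabs (hr u r) <= 2 * K).
    { intros u r Hu Hr. rewrite (deriv_within_unique (h u) (h u) 0 Rr r (p u r) (hr u r)); auto.
      apply (Lip_derive_bound _ (h u) r); auto. }
    destruct (completeness (fun y => exists u r, 0 <= u <= U /\ 0 <= r <= Rr /\ y = Rabs (hr u r))) as [sr Hsr].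
    + exists (2 * K). intros y (u & r & Hu & Hr & ->). auto.
    + exists (Rabs (hr 0 0)), 0, 0. repeat split; lra.
    + exists s0, sr. refine (conj Hlub (conj Hsr _)).
      assert (sr <= 2 * K).
      { apply (proj2 Hsr). intros y (u & r & Hu & Hr & ->). auto. }
      unfold K in *. lra.
Qed.
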